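(* Let $\hbar\in\mathbb{C}$, $\hbar\neq0$, and let $z_1,\dots,z_n\in\mathbb{C}$ satisfy $z_a-z_b\ne\hbar$ for all $a,b=1,\dots,n$. Then the subalgebra $\mathcal{B}^S_{n,\hbar}(z_1,\dots,z_n)$ of $\mathbb{C}[\mathfrak{S}_n]$ is generated by the elements $S^{[n]}_{1,1},\dots,S^{[n]}_{1,n-1}$. More precisely, $$T^{[n]}(u,v;\hbar)=\mathcal{P}_\hbar(u,v;z_1,\dots,z_n;S^{[n]}_1),$$ where $$T^{[n]}(u,v;\hbar)=\sum_{m=0}^n(-1)^mT^{[n]}_m(u;n;\hbar)\,v^{n-m}=\sum_{k=0}^n(-1)^kS^{[n]}_k(u;\hbar)\,(v-1)^{n-k}.$$
   Context: $\mathfrak{S}_n$ is the symmetric group; $\sigma_{a,b}$ is the transposition of $a$ and $b$; permutations are multiplied as functions (right factor acts first). $A^{[m]}=\frac1{m!}\sum_{\sigma\in\mathfrak{S}_m}\mathrm{sign}(\sigma)\,\sigma$. For distinct $r_1,\dots,r_k\in\{1,\dots,n\}$, $\pi^{[n]}_{r_1,\dots,r_k}:\mathbb{C}[\mathfrak{S}_k]\to\mathbb{C}[\mathfrak{S}_n]$ is induced by $i\mapsto r_i$. We view $\mathfrak{S}_n\subset\mathfrak{S}_{n+m}$ as the permutations fixing $n+1,\dots,n+m$, and $\vartheta_m:\mathbb{C}[\mathfrak{S}_m]\to\mathbb{C}[\mathfrak{S}_{n+m}]$ is the embedding induced by $i\mapsto n+i$. For $p\in\mathbb{C}$ the linear map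 $\mathrm{Tr}^{(p)}_m:\mathbb{C}[\mathfrak{S}_{n+m}]\to\mathbb{C}[\mathfrak{S}_n]$ is defined as follows: for $\sigma\in\mathfrak{S}_{n+m}$ written as a product of disjoint cycles, delete all symbols $>n$ and read the result as $\tau\in\mathfrak{S}_n$; let $c(\sigma)$, $c(\tau)$ be the numbers of orbits of $\sigma$ on $\{1,\dots,n+m\}$ and of $\tau$ on $\{1,\dots,n\}$; then $\mathrm{Tr}^{(p)}_m(\sigma)=p^{c(\sigma)-c(\tau)}\tau$ (with $p^0=1$). It is applied coefficientwise to polynomials in $u$. Put $T^{[n]}_0(u;p;\hbar)=\prod_{a=1}^n(u-z_a)$ and, for $m\ge1$, $$T^{[n]}_m(u;p;\hbar)=\mathrm{Tr}^{(p)}_m\Bigl(\vartheta_m(A^{[m]})\bigl(u-z_n+\hbar\sum_{i=1}^m\sigma_{n,n+i}\bigr)\cdots\bigl(u-z_1+\hbar\sum_{i=1}^m\sigma_{1,n+i}\bigr)\Bigr),$$ $T^{[n]}_m(u;p;\hbar)=\sum_{i=0}^nT^{[n]}_{m,i}(p;\hbar)u^{n-i}$. $\mathcal{B}^S_{n,\hbar}(z_1,\dots,z_n)$ is the unital subalgebra of $\mathbb{C}[\mathfrak{S}_n]$ generated by all $T^{[n]}_{m,i}(p;\hbar)$, $m=1,\dots,n-1$, $i=1,\dots,n$, for a given $p$; it is commutative and does not depend on $p$. Put $S^{[n]}_0(u;\hbar)=\prod_{a=1}^n(u-z_a)$ and, for $k=1,\dots,n$, $$S^{[n]}_k(u;\hbar)=k!\,\hbar^k\sum_{1\le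 r_1<\dots<r_k\le n}\pi^{[n]}_{r_1,\dots,r_k}(A^{[k]})\prod_{1\le a\le n,\ a\notin\{r_1,\dots,r_k\}}^{\longleftarrow}\Bigl(u-z_a+\hbar\sum_{1\le j\le k,\ r_j<a}\sigma_{r_j,a}\Bigr),$$ where the arrow means that factors with larger $a$ stand to the left. In particular $S^{[n]}_1$ is a polynomial in $u$ of degree $n-1$, and the elements $S^{[n]}_{1,i}$ are defined by $$S^{[n]}_1(u;\hbar)=\hbar\,n\,u^{n-1}+\sum_{i=1}^{n-1}\hbar^{i+1}S^{[n]}_{1,i}\,u^{n-i-1}.$$ For distinct $z_1,\dots,z_n$ and a polynomial $q(u)$ of degree at most $n-1$ put $Z=\mathrm{diag}(z_1,\dots,z_n)$, $c_a=q(z_a)\prod_{b\ne a}\frac1{z_a-z_b}$, let $Q_\hbar$ be the $n\times n$ matrix with entries $(Q_\hbar)_{ab}=\dfrac{c_a}{z_a-z_b+\hbar}$, and set $$\mathcal{P}_\hbar(u,v;z_1,\dots,z_n;q)=\det\bigl((u-Z)(v-Q_\hbar)-\hbar Q_\hbar\bigr).$$ It is polynomial in $u,v$ and the coefficients of $q$, and rational in $z_1,\dots,z_n$, regular at the hyperplanes $z_a=z_b$; for coinciding $z$'s it is defined by this regularity. $\mathcal{P}_\hbar(u,v;z_1,\dots,z_n;S^{[n]}_1)$ means substituting for the coefficients of $q$ the (commuting) coefficients of $S^{[n]}_1(u;\hbar)$. *)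

(* Defs.v *)
From HB Require Import structures.
From mathcomp Require Import all_boot all_order all_algebra all_fingroup all_field.
From mathcomp.multinomials Require Import mpoly.
From mathcomp Require classical_sets.

Set Implicit Arguments.
Unset Strict Implicit.
Unset Printing Implicit Defensive.
Import GRing.Theory.
Local Open Scope ring_scope.

(* The group algebra F[S_n].  Permutations multiply as functions, the right
   factor acting first, whereas in MathComp (s * t)%g applies s first: the
   product st of the text is (t * s)%g, hence the factor g (s * t^-1) below
   and the order of the factors in permaM. *)
Definition perma (F : fieldType) (n : nat) := {ffun 'S_n -> F^o}.

Section PermAlgebra.
Variables (F : fieldType) (n : nat).
Local Notation A := (perma F n).
Implicit Types f g h : A.

HB.instance Definition _ := Vector.copy A {ffun 'S_n -> F^o}.

Definition permb (s : 'S_n) : A := [ffun t => (t == s)%:R : F].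

Definition perma_mul f g : A :=
  [ffun s => \sum_(t : 'S_n) (f t : F) * g (s * t^-1)%g].

Fact perma_mulA : associative perma_mul.
Proof.
move=> f g h; apply/ffunP => s; rewrite !ffunE.
under eq_bigr => r _ do rewrite ffunE mulr_sumr.
under [RHS]eq_bigr => t _ do rewrite ffunE mulr_suml.
rewrite exchange_big [RHS]exchange_big /= exchange_big; apply: eq_bigr => r _.
rewrite (reindex_inj (mulIg r^-1)%g) /=; apply: eq_bigr => t _.
by rewrite mulrA invMg invgK mulgA mulgKV.
Qed.

Fact perma_mul1l : left_id (permb 1%g) perma_mul.
Proof.
move=> f; apply/ffunP => s; rewrite ffunE (bigD1 1%g) //= big1 => [|t /negPf t1].
  by rewrite ffunE eqxx mul1r addr0 invg1 mulg1.
by rewrite ffunE t1 mul0r.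
Qed.

Fact perma_mul1r : right_id (permb 1%g) perma_mul.
Proof.
move=> f; apply/ffunP => s; rewrite ffunE (bigD1 s) //= big1 => [|t ts].
  by rewrite ffunE mulgV eqxx mulr1 addr0.
by rewrite ffunE -eq_mulgV1 eq_sym (negPf ts) mulr0.
Qed.

Fact perma_mulDl : left_distributive perma_mul +%R.
Proof.
move=> f g h; apply/ffunP => s; rewrite !ffunE -big_split /=.
by apply: eq_bigr => t _; rewrite ffunE mulrDl.
Qed.

Fact perma_mulDr : right_distributive perma_mul +%R.
Proof.
move=> f g h; apply/ffunP => s; rewrite !ffunE -big_split /=.
by apply: eq_bigr => t _; rewrite ffunE mulrDr.
Qed.

Fact perma_1neq0 : permb 1%g != 0.
Proof. by apply/eqP => /ffunP/(_ 1%g)/eqP; rewrite !ffunE eqxx oner_eq0. Qed.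

HB.instance Definition _ := GRing.Zmodule_isNzRing.Build A
  perma_mulA perma_mul1l perma_mul1r perma_mulDl perma_mulDr perma_1neq0.

Fact perma_scaleAl (a : F) f g : a *: (f * g) = (a *: f) * g.
Proof.
apply/ffunP => s; rewrite !ffunE scaler_sumr.
by apply: eq_bigr => t _; rewrite ffunE; exact: mulrA.
Qed.

HB.instance Definition _ := GRing.Lmodule_isLalgebra.Build F A perma_scaleAl.

Fact perma_scaleAr (a : F) f g : a *: (f * g) = f * (a *: g).
Proof.
apply/ffunP => s; rewrite !ffunE scaler_sumr.
by apply: eq_bigr => t _; rewrite ffunE; exact: mulrCA.
Qed.

HB.instance Definition _ := GRing.Lalgebra_isAlgebra.Build F A perma_scaleAr.
HB.instance Definition _ := Algebra_isFalgebra.Build F A.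

Lemma permaM (s t : 'S_n) : permb s * permb t = permb (t * s)%g.
Proof.
apply/ffunP => r; rewrite [LHS]ffunE (bigD1 s) //= big1 => [|u /negPf us].
  by rewrite !ffunE eqxx mul1r addr0 (can2_eq (mulgKV s) (mulgK s)).
by rewrite ffunE us mul0r.
Qed.

End PermAlgebra.

Definition antisym (F : fieldType) (m : nat) : perma F m :=
  (m`!%:R : F)^-1 *: \sum_(s : 'S_m) (-1) ^+ s *: permb F s.

(* The permutation r i |-> r (s i), fixing the points outside the range of r;
   it is the identity if r is not injective. *)
Definition perm_push (k n : nat) (r : 'I_k -> 'I_n) (s : 'S_k) : 'S_n :=
  insubd (1%g : 'S_n)
    [ffun x => if [pick i | r i == x] is Some i then r (s i) else x].

Definition perma_push (F : fieldType) (k n : nat) (r : 'I_k -> 'I_n)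
    (f : perma F k) : perma F n :=
  \sum_(s : 'S_k) (f s : F) *: permb F (perm_push r s).

Lemma perm_pushE (k n : nat) (r : 'I_k -> 'I_n) (s : 'S_k) (x : 'I_n) :
    injective r ->
  perm_push r s x = if [pick i | r i == x] is Some i then r (s i) else x.
Proof.
move=> inj_r; rewrite -pvalE [pval _]insubdK ?ffunE //.
apply/injectiveP => x1 x2; rewrite !ffunE.
case: pickP => [i1 /eqP<-|r1]; case: pickP => [i2 /eqP<-|r2].
- by move=> /inj_r/perm_inj->.
- by move=> e; move: (r2 (s i1)); rewrite e eqxx.
- by move=> e; move: (r1 (s i2)); rewrite -e eqxx.
- by [].
Qed.

Section Trace.
Variables (n m : nat).
Implicit Types (s : 'S_(n + m)) (i : 'I_n).

Definition keep_low (x : 'I_(n + m)) : option 'I_n :=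
  if split x is inl j then Some j else None.

(* The cycle of s through i, written starting from i, with all symbols in the
   last block of size m deleted. *)
Definition cut_cycle s i : seq 'I_n :=
  pmap keep_low (fingraph.orbit s (lshift m i)).

Lemma keep_lowK : pcancel (@lshift n m) keep_low.
Proof.
by move=> i; rewrite /keep_low -[lshift m i]/(unsplit (inl i)) unsplitK.
Qed.

Lemma keep_low_ocancel : ocancel keep_low (@lshift n m).
Proof.
move=> x; rewrite /keep_low; case: splitP => //= j e.
by apply: val_inj; rewrite /= e.
Qed.

Lemma mem_cut_cycle s i j :
  (j \in cut_cycle s i) = (lshift m j \in fingraph.orbit s (lshift m i)).
Proof.
rewrite mem_pmap; apply/mapP/idP => [[x xo jx]|jo].
  by have := keep_low_ocancel x; rewrite -jx /= => ->.
by exists (lshift m j); rewrite ?keep_lowK.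
Qed.

Lemma cut_cycle_uniq s i : uniq (cut_cycle s i).
Proof. exact: (pmap_uniq keep_low_ocancel) (fingraph.orbit_uniq _ _). Qed.

Lemma cut_cycle_rot s i k : k \in cut_cycle s i ->
  exists r, cut_cycle s i = rot r (cut_cycle s k).
Proof.
rewrite mem_cut_cycle => ki.
have inj_s : injective s by exact: perm_inj.
have ik : lshift m i \in fingraph.orbit s (lshift m k).
  by rewrite -fconnect_orbit fconnect_sym // fconnect_orbit.
have [r e] := orbit_rot_cycle (fingraph.cycle_orbit inj_s _)
                (fingraph.orbit_uniq s _) ik.
rewrite /cut_cycle e /rot pmap_cat.
set l := fingraph.orbit s (lshift m k).
exists (size (pmap keep_low (take r l))).
have -> : pmap keep_low l =
    pmap keep_low (take r l) ++ pmap keep_low (drop r l).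
  by rewrite -pmap_cat cat_take_drop.
by rewrite drop_size_cat // take_size_cat.
Qed.

Fact cut_inj s : injective (fun i => next (cut_cycle s i) i).
Proof.
move=> i j /=; set k := next _ i => e.
have cc l : l \in cut_cycle s l by rewrite mem_cut_cycle fingraph.in_orbit.
have ki : k \in cut_cycle s i by rewrite mem_next cc.
have kj : k \in cut_cycle s j by rewrite e mem_next cc.
have [ri ei] := cut_cycle_rot ki; have [rj ej] := cut_cycle_rot kj.
apply: (can_inj (prev_next (cut_cycle_uniq s k))).
have nk l r : cut_cycle s l = rot r (cut_cycle s k) ->
    next (cut_cycle s k) l = next (cut_cycle s l) l.
  by move=> ->; rewrite (next_rot r (cut_cycle_uniq s k)).
by rewrite (nk _ _ ei) (nk _ _ ej).
Qed.

Definition cut_perm s : 'S_n := perm (@cut_inj s).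

Definition ptrace (F : fieldType) (p : F) (f : perma F (n + m)) : perma F n :=
  \sum_(s : 'S_(n + m))
    ((f s : F) * p ^+ (#|porbits s| - #|porbits (cut_perm s)|)) *:
      permb F (cut_perm s).

End Trace.

(* The spectral data: polynomials in u are elements of {poly perma F n};
   indices 1..n of the text are the elements 0..n-1 of 'I_n. *)
Section Bethe.
Variables (F : fieldType) (n : nat) (hbar : F) (z : 'I_n -> F).

Definition Tpoly (p : F) (m : nat) : {poly perma F n} :=
  if m is 0 then \prod_(a < n) ('X - ((z a)%:A)%:P)
  else map_poly (ptrace p)
    ((perma_push (@rshift n m) (antisym F m))%:P *
     \prod_(a <- rev (enum 'I_n))
        ('X - ((z a)%:A)%:P +
         (hbar *: \sum_(i < m)
            permb F (tperm (lshift m a) (rshift n i)))%:P)).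

Definition Tcoef (p : F) (m i : nat) : perma F n := (Tpoly p m)`_(n - i).

Definition bethe (p : F) : {aspace perma F n} :=
  <<1 & [seq Tcoef p m i | m <- iota 1 n.-1, i <- iota 1 n]>>%AS.

Definition increasing (k : nat) (r : {ffun 'I_k -> 'I_n}) : bool :=
  [forall i : 'I_k, forall j : 'I_k, (i < j)%N ==> (r i < r j)%N].

Definition Spoly (k : nat) : {poly perma F n} :=
  if k is 0 then \prod_(a < n) ('X - ((z a)%:A)%:P)
  else (k`!%:R * hbar ^+ k)%:A *:
    \sum_(r : {ffun 'I_k -> 'I_n} | increasing r)
      (perma_push r (antisym F k))%:P *
      \prod_(a <- rev (enum 'I_n) | a \notin codom r)
         ('X - ((z a)%:A)%:P +
          (hbar *: \sum_(j < k | (r j < a)%N) permb F (tperm (r j) a))%:P).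

(* Spoly 1 = hbar n u^(n-1) + sum_(1 <= i < n) hbar^(i+1) S1coef i u^(n-i-1) *)
Definition S1coef (i : nat) : perma F n :=
  (hbar ^+ i.+1)^-1 *: (Spoly 1)`_(n - i.+1).

(* Polynomials in u and v: v is the outer variable, u the inner one. *)
Definition Tuv : {poly {poly perma F n}} :=
  \sum_(m < n.+1) (-1) ^+ m * ((Tpoly n%:R m)%:P * 'X^(n - m)).

Definition Suv : {poly {poly perma F n}} :=
  \sum_(k < n.+1) (-1) ^+ k * ((Spoly k)%:P * ('X - 1) ^+ (n - k)).

End Bethe.

(* det ((u - Z)(v - Q) - hbar Q) for pairwise distinct points z of a field K
   and q(u) = sum_(j < n) y_j u^j, with indeterminate coefficients y_j. *)
Section Determinant.
Variables (K : fieldType) (n : nat) (hbar : K) (z : 'I_n -> K).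
Local Notation M := {mpoly K[n]}.

Definition qval (x : K) : M := \sum_(j < n) x ^+ j *: 'X_j.

Definition cval (a : 'I_n) : M :=
  (\prod_(b < n | b != a) (z a - z b)^-1) *: qval (z a).

Definition Qmx : 'M[M]_n :=
  \matrix_(a, b) ((z a - z b + hbar)^-1 *: cval a).

Definition Zmx : 'M[M]_n := diag_mx (\row_a (z a)%:MP).

Definition Pdet : {poly {poly M}} :=
  let cst := map_mx (fun c : M => c%:P%:P) in
  \det ((('X%:P)%:M - cst Zmx) *m ('X%:M - cst Qmx) - cst (hbar%:MP *: Qmx)).

End Determinant.

Section Regularization.
Variables (F : fieldType) (n : nat).
Local Notation ratfun := {fraction {mpoly F[n]}}.
Local Notation "x %:F" := (FracField.tofrac x).

Definition ratfun_value (z : 'I_n -> F) (f : ratfun) (c : F) : Prop :=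
  exists N D : {mpoly F[n]},
    [/\ D.@[z] != 0, f = N%:F / D%:F & c = N.@[z] / D.@[z]].

(* The value at z of a rational function regular at z; 0 if f is not regular
   at z. *)
Definition ratfun_eval (z : 'I_n -> F) (f : ratfun) : F :=
  classical_sets.xget 0 (ratfun_value z f).

Lemma ratfun_evalE (z : 'I_n -> F) (f : ratfun) (c : F) :
  ratfun_value z f c -> ratfun_eval z f = c.
Proof.
rewrite /ratfun_eval => fc; case: classical_sets.xgetP => [c' _ fc'|/(_ c)//].
case: fc fc' => [N [D [Dz fE ->]]] [N' [D' [D'z f'E ->]]].
have nz E : E.@[z] != 0 -> E%:F != 0 :> ratfun.
  by rewrite tofrac_eq0; apply: contraNneq => ->; rewrite raddf0.
move: f'E; rewrite fE => /eqP; rewrite eqr_div ?nz // -!rmorphM /=.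
rewrite tofrac_eq => /eqP/(congr1 (meval z)); rewrite !rmorphM /= => e.
by apply/eqP; rewrite eqr_div // e.
Qed.

Definition generic_Pdet (hbar : F) : {poly {poly {mpoly ratfun[n]}}} :=
  Pdet (hbar%:MP%:F) (fun a : 'I_n => ('X_a)%:F).

(* Each coefficient of P, as a rational function of the z's, is evaluated at
   the given z, and the coefficient y_j of q is replaced by the coefficient of
   u^j in the given polynomial. *)
Definition Pcurve (hbar : F) (z : 'I_n -> F) (q : {poly perma F n}) :
    {poly {poly perma F n}} :=
  map_poly (map_poly
    (mmap (fun c : ratfun => (ratfun_eval z c)%:A) (fun j : 'I_n => q`_j)))
    (generic_Pdet hbar).

End Regularization.

(* Main.v *)
Require Import Defs.
From HB Require Import structures.
From mathcomp Require Import all_boot all_order all_algebra all_fingroup all_field.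
From mathcomp.multinomials Require Import ssrcomplements mpoly.
From mathcomp Require Import ring zify.
From mathcomp Require boolp.
From mathcomp Require Import reals complex.

Set Implicit Arguments.
Unset Strict Implicit.
Unset Printing Implicit Defensive.
Import GRing.Theory.
Local Open Scope ring_scope.
Local Open Scope complex_scope.

(** Write D(u) for the product of the u - z_a, w for v - 1, and S_k, T_m for the
polynomials Spoly k and Tpoly p m.

Explicit form.  Multiplying out one factor at a time shows that
  S_k = h^k sum_t sign(t) (sum_(|U| = k) prod_(b not in U) g_b(t)) t,
where g_b(t) is u - z_b, - h or 0 according to whether t^-1 b is equal to,
smaller or larger than b (insertion, Spoly_Sgen).  Hence the generating function
Theta(u) = sum_k (-1)^k w^(n-k) S_k is sum_t sign(t) (prod_b M(b, t^-1 b)) t for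
a matrix M: a determinant whose terms carry their permutations as labels
(Theta_Sgen).

Commutation and fusion.  Multiplying such a labelled determinant by
x - h sigma_{ab} recombines the rows and columns a and b of M, and for suitable
entries this only changes M (rho_leib_swap, rho_leib_merge).  Let Y_a be the
product, in cyclic order, of the z_a - z_b - h sigma_{ab} over the b other
than a.  Moving its factors through Theta one at a time gives
  Y_a S_m(u) = S_m(u) Y_a,
  Y_a (S_m(z_a) - S_{m+1}(z_a)) = prod_(b != a) (z_a - z_b + h) S_m(z_a - h).
The case m = 0 says that Y_a S_1(z_a) is a scalar, so Y_a can be eliminated:
S_1(z_a) commutes with every S_m(u), and
  D(z_a - h) (S_{m+1}(z_a) - S_m(z_a)) = S_1(z_a) S_m(z_a - h).
These are statements at the n points z_a.  Deforming z_a to z_a + a t makes the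
points differ by regular elements, so that they become statements modulo D(u),
and then t is set to 0: the coefficients of S_1 commute (Spol1_comm), and
  D(u - h) (S_{m+1} - S_m) = S_1 S_m(u - h)  modulo D(u)     (Spol_fusion).

Linear algebra.  On the quotient by D(u), in the Newton basis, u acts by a
triangular matrix Z, the substitution of u - h by a matrix R, and D(u - h) by
an invertible W; this is where z_a - z_b != h is used.  With Q = - W^-1 S_1(Z) R
the congruence reads s_{m+1} = (1 - Q) s_m for m > 0, where s_m is the vector of
S_m, and it stops with s_{n+1} = 0.  Thus
f = sum_(k > 0) (-1)^k w^(n-k) s_k solves (v - Q) f = - w^n s_1.
Moreover Q Z - (Z - h) Q = s_1 l, where l is the leading coefficient form.  This
rank one identity gives l adj(v - Q) s_1 = h (v chi' - n chi) for the
characteristic polynomial chi of Q, and together with the known leading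
coefficient of f it yields n chi = w chi', that is chi = w^n.  Hence
f = - adj(v - Q) s_1, and the determinant of a rank one update identifies
sum_k (-1)^k w^(n-k) S_k with det (v (u - Z) - (u - Z + h) Q) (spectral_curve).

Regularity.  For distinct z_a, evaluation at these points diagonalises Z and
turns Q into diag(q(z_a)) K for a Cauchy type matrix K, while the matrix Q_h of the
curve is the transpose of K diag(q(z_a)), so that both determinants agree
(Pdet_laxmx).  After multiplication by det W, both sides are polynomial in
the z_a, which gives the value of the curve at coinciding points
(ratfun_eval_Pdet).

Traces.  The insertion formula also expands the argument of the trace in T_m.
Deleting the last auxiliary symbol from its cycle gives a recursion for the
signed count of the permutations with a given trace (trace_sumE), and
  m! T_m(p) = sum_k m (m-1) ... (m-k+1) (prod_(k <= i < m) (p - i)) S_k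
(coef_Tpoly).  For p = n these are binomial coefficients, whence the equality of
the two expressions of T(u,v); the system is triangular, so all S_k and T_m(p)
are polynomials in the coefficients of S_1, which in turn are combinations
of those of T_1(p) and scalars (bethe_generated). *)

(** * Sums over permutations with matrix weights *)

Section Leibniz.
Variables (n : nat) (k : comNzRingType) (A : nzRingType).
Variables (iota : {rmorphism k -> A}) (rho : 'S_n -> A).
Hypothesis iotaC : forall c x, iota c * x = x * iota c.
Hypothesis rhoM : forall s t, rho s * rho t = rho (t * s)%g.

(** A determinant with labels: the term of t in the Leibniz expansion of
    det M is multiplied by rho t.  It is the determinant for trivial rho. *)
Definition leib (M : 'I_n -> 'I_n -> k) : A :=
  \sum_(t : 'S_n) iota ((-1) ^+ t * \prod_b M b ((t^-1)%g b)) * rho t.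

(** As leib, but with an arbitrary joint weight H for the rows a and b, so
    that a transposition acting on the labels can exchange these two rows. *)
Definition leib2 (a b : 'I_n) (H M : 'I_n -> 'I_n -> k) : A :=
  \sum_(t : 'S_n) iota ((-1) ^+ t * (H ((t^-1)%g a) ((t^-1)%g b) *
     \prod_(c | (c != a) && (c != b)) M c ((t^-1)%g c))) * rho t.

Lemma eq_leib M M' : (forall c d, M c d = M' c d) -> leib M = leib M'.
Proof.
move=> e; apply: eq_bigr => t _; congr (iota (_ * _) * _).
by apply: eq_bigr => c _; rewrite e.
Qed.

Lemma leib_leib2 a b M : a != b ->
  leib M = leib2 a b (fun i j => M a i * M b j) M.
Proof.
move=> ab; apply: eq_bigr => t _; congr (iota (_ * _) * _).
rewrite (bigD1 a) //= (bigD1 b) ?[b == a]eq_sym //= mulrA.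
by congr (_ * _); apply: eq_bigl => c; rewrite andbC.
Qed.

Lemma eq_leib2 a b H H' M M' : a != b ->
    (forall i j, i != j -> H i j = H' i j) ->
    (forall c d, c != a -> c != b -> M c d = M' c d) ->
  leib2 a b H M = leib2 a b H' M'.
Proof.
move=> ab eH eM; apply: eq_bigr => t _; congr (iota (_ * (_ * _)) * _).
  by apply: eH; rewrite (inj_eq perm_inj).
by apply: eq_bigr => c /andP[ca cb]; rewrite eM.
Qed.

Lemma leib2_lin a b H H' M x y :
  leib2 a b (fun i j => x * H i j + y * H' i j) M =
  iota x * leib2 a b H M + iota y * leib2 a b H' M.
Proof.
rewrite /leib2 !mulr_sumr -big_split /=; apply: eq_bigr => t _.
rewrite !mulrA -!rmorphM -mulrDl -rmorphD; congr (iota _ * _).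
move: (\prod_(_ | _) _) (H _ _) (H' _ _) ((-1) ^+ _) => p h h' e.
by ring.
Qed.

(** Reindexing by the transposition exchanges t^-1 a and t^-1 b. *)
Lemma rho_leib2 a b H M : a != b ->
  rho (tperm a b) * leib2 a b H M = - leib2 a b (fun i j => H j i) M.
Proof.
move=> ab; rewrite /leib2 mulr_sumr -sumrN.
rewrite (reindex_inj (mulIg (tperm a b))) /=; apply: eq_bigr => t _.
rewrite mulrA -iotaC -mulrA rhoM -mulgA tperm2 mulg1 -mulNr -rmorphN.
congr (iota _ * _); rewrite odd_permM odd_tperm ab addbT signrN mulNr.
rewrite invMg tpermV !permM tpermL tpermR; congr (- (_ * (_ * _))).
by apply: eq_bigr => c /andP[ca cb]; rewrite permM tpermD // eq_sym.
Qed.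

(** Conjugation of the labels permutes rows and columns simultaneously. *)
Lemma leib_rho s M :
  leib M * rho s = rho s * leib (fun c d => M (s c) (s d)).
Proof.
rewrite /leib mulr_suml mulr_sumr [RHS](reindex_inj (conjg_inj s^-1%g)) /=.
apply: eq_bigr => t _; rewrite [RHS]mulrA -iotaC -!mulrA !rhoM.
rewrite odd_permJ conjgE invgK mulgA mulgKV; congr (iota (_ * _) * _).
rewrite (reindex_inj (@perm_inj _ s)); apply: eq_bigr => c _.
by rewrite !invMg invgK !permM permKV.
Qed.

(** A Yang-Baxter type exchange: passing x - h sigma_{ab} through the sum
    swaps the entries (a, b) and (b, a).  It suffices to compare the coefficients of
    the pairs (t^-1 a, t^-1 b); rows and columns a and b must agree off the block
    {a, b}, and the pair (b, a) gives the only scalar condition. *)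
Lemma rho_leib_swap a b x h M M' : a != b ->
    (forall c d, (c == a) && (d == b) || (c == b) && (d == a) = false ->
       M' c d = M c d) ->
    M' a b = M b a -> M' b a = M a b ->
    (forall d, d != a -> d != b -> M a d = M b d) ->
    (forall c, c != a -> c != b -> M c a = M c b) ->
    x * (M a b - M b a) = h * (M a a - M b b) ->
  (iota x - iota h * rho (tperm a b)) * leib M =
  leib M' * (iota x - iota h * rho (tperm a b)).
Proof.
move=> ab eM' eab eba er ec exh.
have ba : b != a by rewrite eq_sym.
rewrite mulrBl mulrBr -[leib M' * iota x]iotaC mulrA -[leib M' * iota h]iotaC.
rewrite -!mulrA leib_rho.
set Ms := fun c d => _.
have eMs c d : c != a -> c != b -> Ms c d = M c d.
  move=> ca cb; rewrite /Ms tpermD 1?eq_sym // eM'; last first.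
    by rewrite (negPf ca) (negPf cb).
  case: tpermP => // ->; first by rewrite -ec.
  by rewrite ec.
rewrite (leib_leib2 M ab) (leib_leib2 M' ab) (leib_leib2 Ms ab).
rewrite (@eq_leib2 a b _ _ M' M ab (fun _ _ _ => erefl)); last first.
  by move=> c d ca cb; rewrite eM' // (negPf ca) (negPf cb).
rewrite (@eq_leib2 a b _ _ Ms M ab (fun _ _ _ => erefl)) //.
rewrite !rho_leib2 // !mulrN !opprK -!leib2_lin.
apply: eq_leib2 => // i j ij.
have M'aa : M' a a = M a a by rewrite eM' // (negPf ab) andbF.
have M'bb : M' b b = M b b by rewrite eM' // (negPf ba) andbF.
have M'ad d : d != a -> d != b -> M' a d = M a d.
  by move=> da db; rewrite eM' // (negPf da) (negPf db) !andbF.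
have M'bd d : d != a -> d != b -> M' b d = M b d.
  by move=> da db; rewrite eM' // (negPf da) (negPf db) !andbF.
rewrite /Ms tpermL tpermR.
have [ia|ia] := eqVneq i a; have [jb|jb] := eqVneq j b.
- by rewrite ia jb tpermL tpermR M'aa M'bb eab eba; ring.
- have ja : j != a by rewrite -ia eq_sym.
  rewrite ia tpermL tpermD 1?eq_sym // M'aa eab !M'bd // (er j) //; ring.
- rewrite jb tpermR eba M'bb; have [ib|ib] := eqVneq i b.
    by rewrite ib jb eqxx in ij.
  by rewrite tpermD 1?eq_sym // !M'ad // (er i) //; ring.
have [ib|ib] := eqVneq i b; have [ja|ja] := eqVneq j a.
- by rewrite ib ja tpermL tpermR M'aa M'bb eab eba; ring.
- rewrite ib tpermR tpermD 1?eq_sym // M'aa eab !M'bd // (er j) //.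
  apply/eqP; rewrite -subr_eq0; apply/eqP.
  transitivity (M b j * (x * (M a b - M b a) - h * (M a a - M b b))).
    by ring.
  by rewrite exh subrr mulr0.
- rewrite ja tpermL tpermD 1?eq_sym // M'bb eba !M'ad // (er i) //.
  apply/eqP; rewrite -subr_eq0; apply/eqP.
  transitivity (M b i * (h * (M a a - M b b) - x * (M a b - M b a))).
    by ring.
  by rewrite exh subrr mulr0.
by rewrite !tpermD 1?eq_sym // !M'ad // !M'bd // (er i) // (er j).
Qed.

(** Here the factor x - h sigma_{ab} acts on the rows a and b alone, so it
    may replace them by any two rows that satisfy the quadratic relation below. *)
Lemma rho_leib_merge a b x h y M M' : a != b ->
    (forall i j, i != j ->
       x * (M a i * M b j) + h * (M a j * M b i) = y * (M' a i * M' b j)) ->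
    (forall c d, c != a -> c != b -> M' c d = M c d) ->
  (iota x - iota h * rho (tperm a b)) * leib M = iota y * leib M'.
Proof.
move=> ab eH eM; rewrite mulrBl -mulrA (leib_leib2 M ab) rho_leib2 // mulrN.
rewrite opprK -leib2_lin (leib_leib2 M' ab).
rewrite (@eq_leib2 a b _ (fun i j => M' a i * M' b j) M' M ab) //.
transitivity (leib2 a b (fun i j => y * (M' a i * M' b j) + 0 * 0) M).
  by apply: eq_leib2 => // i j ij; rewrite eH // mulr0 addr0.
by rewrite leib2_lin rmorph0 mul0r addr0.
Qed.
End Leibniz.

(** * Moving a site around the circle *)

Lemma prod_lreg (k : nzRingType) (I : finType) (P : pred I) (g : I -> k) :
  (forall i, GRing.lreg (g i)) -> GRing.lreg (\prod_(i | P i) g i).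
Proof. by move=> rg; elim/big_ind: _ => //; [exact: lreg1 | exact: lregM]. Qed.

Section Chain.
Variables (n : nat) (k : comNzRingType) (A : nzRingType).
Variables (iota : {rmorphism k -> A}) (rho : 'S_n -> A).
Hypothesis iotaC : forall c x, iota c * x = x * iota c.
Hypothesis rhoM : forall s t, rho s * rho t = rho (t * s)%g.
Local Notation leib := (leib iota rho).

(** Conjugation by the diagonal matrix g: the product of the g_c over all rows
    equals the one over all columns. *)
Lemma leib_diag (g : 'I_n -> k) M M' : GRing.lreg (\prod_c g c) ->
    (forall c d, g d * M' c d = g c * M c d) -> leib M' = leib M.
Proof.
move=> reg_g eM; apply: eq_bigr => t _; congr (iota (_ * _) * _).
apply: reg_g; rewrite {1}(reindex_inj (@perm_inj _ t^-1%g)) /= -!big_split /=.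
by apply: eq_bigr => c _.
Qed.

Variables (w h : k) (z : 'I_n -> k).
Local Notation v := (w + 1).
Hypothesis reg_v : GRing.lreg v.

(** The rank of a site is kap, so that different orders of the sites can be
    compared. *)
Definition theta_mx (kap : 'I_n -> nat) (u : k) (c d : 'I_n) : k :=
  if c == d then w * (u - z c) - h
  else if (kap d < kap c)%N then - (h * v) else - h.

Definition Theta (u : k) : A := leib (theta_mx (@nat_of_ord n) u).

Section Site.
Variable a : 'I_n.

(** The order of the sites on a circle, starting from a. *)
Definition cyc_rank (c : 'I_n) : nat := (if a <= c then c - a else c + n - a)%N.
Local Notation kap := cyc_rank.

Lemma cyc_rank_lt c : (kap c < n)%N.
Proof. by rewrite /kap; case: ifP; have := ltn_ord c; have := ltn_ord a; lia. Qed.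

Lemma cyc_rankaa : kap a = 0%N. Proof. by rewrite /kap leqnn subnn. Qed.

Lemma cyc_rank_inj : injective kap.
Proof.
move=> c d; rewrite /kap => e; apply: val_inj => /=; move: e.
by have := ltn_ord c; have := ltn_ord d; have := ltn_ord a; do 2!case: ifP; lia.
Qed.

Lemma cyc_rank_gt0 c : c != a -> (0 < kap c)%N.
Proof.
by move=> ca; rewrite lt0n -cyc_rankaa (inj_eq cyc_rank_inj).
Qed.

(** Theta depends only on the cyclic order of the sites: the two matrices are
    conjugate under the diagonal matrix with entry w + 1 at the sites below a. *)
Lemma leib_theta_cyc u : leib (theta_mx kap u) = Theta u.
Proof.
apply: (@leib_diag (fun c => if (c < a)%N then v else 1)).
  by apply: prod_lreg => c; case: ifP => _ //; exact: lreg1.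
move=> c d; rewrite /theta_mx; have [->//|cd] := eqVneq c d.
have {}cd : c <> d :> nat by move/val_inj/eqP; apply/negP.
rewrite /kap; have an := ltn_ord a; have cn := ltn_ord c.
have dn := ltn_ord d.
case: (leqP a c) => ac; case: (leqP a d) => ad;
  case: (ltngtP d c) => dc //; case: ltnP => kdc; try lia; ring.
Qed.

(** The matrix of Theta for the order in which a has been moved after the
    sites of cyclic rank below j. *)
Definition swap_mx (u : k) (j : nat) (c d : 'I_n) : k :=
  if c == d then w * (u - z c) - h
  else if c == a then if (j <= kap d)%N then - h else - (h * v)
  else if d == a then if (j <= kap c)%N then - (h * v) else - h
  else if (kap d < kap c)%N then - (h * v) else - h.

Lemma leib_swap_mx1 u : leib (swap_mx u 1) = Theta u.
Proof.
rewrite -leib_theta_cyc; apply: eq_leib => c d; rewrite /swap_mx /theta_mx.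
have [//|cd] := eqVneq c d; have [ca|ca] := eqVneq c a.
  by rewrite ca cyc_rankaa ltn0 cyc_rank_gt0 // eq_sym -ca.
by have [->|//] := eqVneq d a; rewrite cyc_rankaa cyc_rank_gt0.
Qed.

(** With a in the last place this is again a cyclic order. *)
Lemma leib_swap_mxn u : leib (swap_mx u n) = Theta u.
Proof.
rewrite -leib_theta_cyc; apply: (@leib_diag (fun c => if c == a then v else 1)).
  by apply: prod_lreg => c; case: ifP => _ //; exact: lreg1.
move=> c d; rewrite /swap_mx /theta_mx; have [->//|cd] := eqVneq c d.
have [ca|ca] := eqVneq c a; have [da|da] := eqVneq d a.
- by rewrite ca da eqxx in cd.
- by rewrite ca cyc_rankaa leqNgt cyc_rank_lt /=; ring.
- by rewrite da cyc_rankaa leqNgt cyc_rank_lt cyc_rank_gt0 //=; ring.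
- by [].
Qed.

Local Notation F b := (iota (z a - z b) - iota h * rho (tperm a b)).

Lemma swap_step u b : b != a ->
  F b * leib (swap_mx u (kap b).+1) = leib (swap_mx u (kap b)) * F b.
Proof.
move=> ba; have ab : a != b by rewrite eq_sym.
have kb c : c != b -> (kap b < kap c)%N = (kap b <= kap c)%N.
  by move=> cb; rewrite [RHS]leq_eqVlt (inj_eq cyc_rank_inj) [b == c]eq_sym (negPf cb).
have kbC c : c != b -> (kap c < kap b)%N = ~~ (kap b <= kap c)%N.
  by move=> cb; rewrite ltnNge.
apply: rho_leib_swap => // [c d||||c|].
- move=> e; rewrite /swap_mx; have [//|cd] := eqVneq c d.
  move: e; have [ca|ca] := eqVneq c a.
    by have [//|db] := eqVneq d b; rewrite kb.
  have [da|//] := eqVneq d a.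
  by have [//|cb] := eqVneq c b; rewrite kb.
- by rewrite /swap_mx eqxx (negPf ab) (negPf ba) leqnn ltnn.
- by rewrite /swap_mx eqxx (negPf ab) (negPf ba) leqnn ltnn.
- move=> d da db; rewrite /swap_mx (eq_sym a) (negPf da) eqxx (eq_sym b).
  by rewrite (negPf db) (negPf ba) kbC // kb //; case: leqP.
- by move=> ca cb; rewrite /swap_mx (negPf ca) eqxx (negPf cb) (negPf ba).
- rewrite /swap_mx !eqxx (negPf ab) (negPf ba) ltnn; ring.
Qed.

(** Interpolates between Theta(z_a), where row a is multiplied by w + 1, and
    Theta(z_a - h): the parameter of row b drops from z_a to z_a - h when b has been
    processed. *)
Definition merge_mx (j : nat) (c d : 'I_n) : k :=
  if c == a then
    if d == a then - (h * v) else if (j <= kap d)%N then - h else - (h * v)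
  else if c == d then
    if (j <= kap c)%N then w * (z a - z c - h) - h else w * (z a - z c) - h
  else if (kap d < kap c)%N then - (h * v) else - h.

Lemma leib_merge_mx1 : leib (merge_mx 1) = Theta (z a - h).
Proof.
rewrite -leib_theta_cyc; apply: eq_leib => c d; rewrite /merge_mx /theta_mx.
have [->|ca] := eqVneq c a.
  have [_|da] := eqVneq d a; first by ring.
  by rewrite cyc_rankaa ltn0 cyc_rank_gt0.
by have [_|//] := eqVneq c d; rewrite cyc_rank_gt0 // [z a - h - _]addrAC.
Qed.

Lemma leib_scale_row y M M' :
    (forall d, M' a d = y * M a d) ->
    (forall c d, c != a -> M' c d = M c d) ->
  leib M' = iota y * leib M.
Proof.
move=> ea eM; rewrite /leib mulr_sumr; apply: eq_bigr => t _.
rewrite mulrA -rmorphM; congr (iota _ * _).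
rewrite (bigD1 a) // [in RHS](bigD1 a) //= ea.
rewrite -[y * _ * _]mulrA [LHS]mulrCA; rewrite (eq_bigr (fun c => M c ((t^-1)%g c))) // => c ca.
by rewrite eM.
Qed.

Lemma leib_merge_mxn : leib (merge_mx n) = iota v * Theta (z a).
Proof.
rewrite -leib_theta_cyc; apply: leib_scale_row => [d|c d ca].
  rewrite /merge_mx /theta_mx eqxx leqNgt cyc_rank_lt cyc_rankaa ltn0 eq_sym.
  by case: eqP => _; ring.
rewrite /merge_mx /theta_mx (negPf ca) leqNgt cyc_rank_lt /=.
by case: eqP => // <-.
Qed.

Lemma merge_step b : b != a ->
  F b * leib (merge_mx (kap b).+1) = iota (z a - z b + h) * leib (merge_mx (kap b)).
Proof.
move=> ba; have ab : a != b by rewrite eq_sym.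
have kb c : c != b -> (kap b < kap c)%N = (kap b <= kap c)%N.
  by move=> cb; rewrite [RHS]leq_eqVlt (inj_eq cyc_rank_inj) [b == c]eq_sym (negPf cb).
pose g i : k := if (kap b < kap i)%N then - h else - (h * v).
have rowa i : merge_mx (kap b).+1 a i = g i.
  by rewrite /merge_mx eqxx; case: eqP => // ->; rewrite /g cyc_rankaa.
have rowb i : i != b -> merge_mx (kap b).+1 b i = g i.
  move=> ib; rewrite /merge_mx /g (negPf ba) [b == i]eq_sym (negPf ib).
  by rewrite ltnNge -kb //; case: ltnP.
have rowa' i : i != b -> merge_mx (kap b) a i = g i.
  move=> ib; rewrite /merge_mx eqxx -kb // /g.
  by case: eqP => // ->; rewrite cyc_rankaa.
have rowb' i : i != b -> merge_mx (kap b) b i = g i.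
  by move=> ib; rewrite -rowb // /merge_mx (negPf ba) [b == i]eq_sym (negPf ib).
have gb : g b = - (h * v) by rewrite /g ltnn.
have bb : merge_mx (kap b).+1 b b = w * (z a - z b) - h.
  by rewrite /merge_mx (negPf ba) eqxx ltnn.
have bb' : merge_mx (kap b) b b = w * (z a - z b - h) - h.
  by rewrite /merge_mx (negPf ba) eqxx leqnn.
have ab' : merge_mx (kap b) a b = - h.
  by rewrite /merge_mx (negPf ba) eqxx leqnn.
apply: rho_leib_merge => // [i j ij|c d ca cb].
  rewrite !rowa; have [ib|ib] := eqVneq i b; have [jb|jb] := eqVneq j b.
  - by rewrite ib jb eqxx in ij.
  - by rewrite ib (rowb j) // gb bb ab' (rowb' j) //; ring.
  - by rewrite jb (rowb i) // gb bb bb' (rowa' i) //; ring.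
  - by rewrite !rowb // (rowa' i) // (rowb' j) //; ring.
by rewrite /merge_mx (negPf ca) kb.
Qed.

Definition cyc_site (j : nat) : 'I_n := insubd a ((a + j) %% n)%N.

Lemma cyc_siteK j : (j < n)%N -> kap (cyc_site j) = j.
Proof.
move=> jn; have an := ltn_ord a.
rewrite /cyc_site /kap val_insubd ltn_pmod; last by lia.
case: (ltnP (a + j) n) => e; first by rewrite modn_small // leq_addr addKn.
rewrite -(subnK e) modnDr modn_small; last by lia.
by case: ifP; lia.
Qed.

Definition moveop : A := \prod_(1 <= j < n) F (cyc_site j).

(** The factors of the operator act from the last site in cyclic order to
    the first. *)
Lemma moveop_ind (R : nat -> A -> Prop) :
  R n 1 -> (forall b x, b != a -> R (kap b).+1 x -> R (kap b) (F b * x)) ->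
  R 1%N moveop.
Proof.
move=> R1 RS; rewrite /moveop.
have n1 : (1 <= n)%N by have := ltn_ord a; lia.
suff H i : (i < n)%N -> R (n - i)%N (\prod_(n - i <= j < n) F (cyc_site j)).
  by have := H n.-1; rewrite -subn1 subKn //; apply; lia.
elim: i => [|i IHi] ilt; first by rewrite subn0 big_geq.
have e : (n - i.+1).+1 = (n - i)%N by lia.
rewrite big_ltn ?e; last by lia.
have kb : kap (cyc_site (n - i.+1)) = (n - i.+1)%N by rewrite cyc_siteK //; lia.
rewrite -{1}kb; apply: RS; last by rewrite kb e; apply: IHi; lia.
by apply: contraTneq isT => ba; move: kb; rewrite ba cyc_rankaa; lia.
Qed.

(** Each factor moves a past one site, from the last place to the first;
    both orders define Theta. *)
Lemma moveop_Theta u : moveop * Theta u = Theta u * moveop.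
Proof.
rewrite -{1}leib_swap_mxn -leib_swap_mx1.
apply: (@moveop_ind (fun j x => x * leib (swap_mx u n) = leib (swap_mx u j) * x)).
  by rewrite mul1r mulr1.
by move=> b x ba IH; rewrite -mulrA IH mulrA swap_step // mulrA.
Qed.

(** Each factor shifts the parameter of one row by h, at the cost of the
    scalar z_a - z_b + h. *)
Lemma moveop_fusion :
  iota v * moveop * Theta (z a) =
  iota (\prod_(b | b != a) (z a - z b + h)) * Theta (z a - h).
Proof.
rewrite iotaC -mulrA -leib_merge_mxn -leib_merge_mx1.
have -> : \prod_(b | b != a) (z a - z b + h) =
    \prod_(b | (1 <= kap b)%N) (z a - z b + h).
  apply: eq_bigl => b; apply/idP/idP; first exact: cyc_rank_gt0.
  by apply: contraTneq => ->; rewrite cyc_rankaa.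
apply: (@moveop_ind (fun j x => x * leib (merge_mx n) =
    iota (\prod_(b | (j <= kap b)%N) (z a - z b + h)) * leib (merge_mx j))).
  rewrite mul1r big_pred0 ?rmorph1 ?mul1r // => b.
  by rewrite leqNgt cyc_rank_lt.
move=> b x ba IH; rewrite -mulrA IH mulrA -iotaC -mulrA merge_step //.
rewrite mulrA -rmorphM; congr (iota _ * _).
rewrite [RHS](bigD1 b) //= mulrC; congr (_ * _); apply: eq_bigl => c.
rewrite ltn_neqAle (inj_eq cyc_rank_inj) [b == c]eq_sym.
by rewrite andbC.
Qed.

End Site.
End Chain.

(** * The explicit form of the S_k *)

Lemma map_poly_central (k : nzRingType) (A : nzRingType) (iota : {rmorphism k -> A}) :
  (forall c x, iota c * x = x * iota c) ->
  forall (c : {poly k}) (x : {poly A}), map_poly iota c * x = x * map_poly iota c.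
Proof.
move=> iotaC c x; apply/polyP => i; rewrite coefM coefMr.
by apply: eq_bigr => j _; rewrite coef_map iotaC.
Qed.

Lemma prod_addr_subsets (I : finType) (k : comNzRingType) (f g : I -> k) :
  \prod_i (f i + g i) =
  \sum_(U : {set I}) (\prod_(i in U) f i) * \prod_(i in ~: U) g i.
Proof.
rewrite bigA_distr; apply: eq_bigr => U _; rewrite (bigID (mem U)) /=.
congr (_ * _); first by apply: eq_bigr => i ->.
by apply: eq_big => i; [rewrite inE | move/negPf->].
Qed.

Section Sgen.
Variables (n : nat) (k : comNzRingType) (A : nzRingType).
Variables (iota : {rmorphism k -> A}) (rho : 'S_n -> A).
Variables (h : k) (z : 'I_n -> k).

(** The contribution of a site b outside U when t^-1 b = d. *)
Definition gwt (u : k) (b d : 'I_n) : k :=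
  if d == b then u - z b else if (d < b)%N then - h else 0.

Definition subset_wt u (t : 'S_n) (U : {set 'I_n}) : k :=
  \prod_(b in ~: U) gwt u b ((t^-1)%g b).

(** The explicit form of S_m: the sites in U contribute h, the others gwt.
    The coefficients, the labels and the point u are arbitrary, so that the
    same sum can be specialised, deformed and shifted. *)
Definition Sgen (u : k) (m : nat) : A :=
  \sum_(t : 'S_n)
    iota ((-1) ^+ t * (h ^+ m * \sum_(U : {set 'I_n} | #|U| == m) subset_wt u t U))
    * rho t.

(** Every entry of the matrix is - h + w g with g given by gwt; U is the set
    of the rows where the summand - h is chosen. *)
Lemma Theta_Sgen w u :
  Theta iota rho w h z u =
  \sum_(m < n.+1) iota ((-1) ^+ m * w ^+ (n - m)) * Sgen u m.
Proof.
rewrite /Theta /leib /Sgen.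
under [RHS]eq_bigr => m _ do rewrite mulr_sumr.
rewrite exchange_big /=; apply: eq_bigr => t _.
under [RHS]eq_bigr => m _ do rewrite mulrA -rmorphM.
rewrite -mulr_suml -rmorph_sum; congr (iota _ * _).
transitivity ((-1) ^+ t * \prod_b (- h + w * gwt u b ((t^-1)%g b))).
  congr (_ * _); apply: eq_bigr => b _; rewrite /theta_mx /gwt eq_sym.
  by case: eqP => _; first ring; case: ifP => _; ring.
rewrite prod_addr_subsets mulr_sumr.
rewrite (partition_big (fun U : {set 'I_n} => inord #|U| : 'I_n.+1) predT) //=.
apply: eq_bigr => m _; rewrite !mulr_sumr.
have lt_cardS (U : {set 'I_n}) : (#|U| < n.+1)%N.
  by rewrite ltnS -[X in (_ <= X)%N]card_ord max_card.
rewrite (eq_bigl (fun U : {set 'I_n} => #|U| == m)) => [|U]; last first.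
  by rewrite -val_eqE /= inordK.
apply: eq_bigr => U /eqP cU; rewrite prodr_const cU big_split /=.
rewrite prodr_const cardsCs setCK card_ord cU /subset_wt (exprNn h).
by rewrite [RHS]mulrCA [X in _ * X]mulrACA.
Qed.

Lemma Sgen0_gt u m : (n < m)%N -> Sgen u m = 0.
Proof.
move=> nm; rewrite /Sgen big1 // => t _; rewrite big_pred0 ?mulr0 ?rmorph0 ?mul0r // => U.
by apply: contraTF nm => /eqP<-; rewrite -leqNgt -[X in (_ <= X)%N]card_ord max_card.
Qed.
End Sgen.

Lemma subset_wt_map n (k k' : comNzRingType) (f : {rmorphism k -> k'})
    h z u h' z' u' t (U : {set 'I_n}) :
    f h = h' -> (forall a, f (z a) = z' a) -> f u = u' ->
  f (subset_wt h z u t U) = subset_wt h' z' u' t U.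
Proof.
move=> fh fz fu; rewrite rmorph_prod; apply: eq_bigr => b _; rewrite /gwt.
case: ifP => _; first by rewrite rmorphB /= fz fu.
by case: ifP => _; rewrite ?rmorphN ?rmorph0 // fh.
Qed.

Lemma Sgen_map n (k k' : comNzRingType) (A A' : nzRingType)
    (iota : {rmorphism k -> A}) (iota' : {rmorphism k' -> A'})
    (f : {rmorphism k -> k'}) (g : {rmorphism A -> A'})
    (rho : 'S_n -> A) (rho' : 'S_n -> A') h z u h' z' u' m :
    (forall c, g (iota c) = iota' (f c)) -> (forall s, g (rho s) = rho' s) ->
    f h = h' -> (forall a, f (z a) = z' a) -> f u = u' ->
  g (Sgen iota rho h z u m) = Sgen iota' rho' h' z' u' m.
Proof.
move=> gi gr fh fz fu; rewrite rmorph_sum; apply: eq_bigr => t _.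
rewrite rmorphM gi gr; congr (iota' _ * _).
rewrite !rmorphM rmorph_sign rmorphXn rmorph_sum fh; congr (_ * (_ * _)).
by apply: eq_bigr => U _; rewrite -(subset_wt_map _ _ fh fz fu).
Qed.

(** * Commutation and fusion at a site *)

Lemma perm_le_id n (s : 'S_n) : (forall b, (s b <= b)%N) -> s = 1%g.
Proof.
move=> le_s; apply/permP => b; rewrite perm1.
have [m] := ubnP (b : nat); elim: m b => // m IHm b /ltnSE le_bm.
apply/eqP; have := le_s b; rewrite leq_eqVlt => /orP[//|sb].
by rewrite -(inj_eq (@perm_inj _ s)) IHm // (leq_trans sb).
Qed.

Section Fusion.
Variables (n : nat) (k : comNzRingType) (A : nzRingType).
Variables (iota : {rmorphism k -> A}) (rho : 'S_n -> A).
Hypothesis iotaC : forall c x, iota c * x = x * iota c.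
Hypothesis rhoM : forall s t, rho s * rho t = rho (t * s)%g.
Hypothesis rho1 : rho 1%g = 1.
Variables (h : k) (z : 'I_n -> k).
Local Notation S := (Sgen iota rho h z).
Local Notation D u := (\prod_b (u - z b)).

(** A permutation other than 1 increases some b under t^-1, which kills its term. *)
Lemma Sgen0 u : S u 0 = iota (D u).
Proof.
rewrite /Sgen (bigD1 1%g) //= odd_perm1 expr0 !mul1r rho1 mulr1.
rewrite [X in _ + X]big1 ?addr0 => [|t t1].
  rewrite (big_pred1 set0) => [|U]; last by rewrite cards_eq0.
  congr (iota _); apply: eq_big => b; first by rewrite !inE.
  by rewrite invg1 perm1 /gwt eqxx.
rewrite (big_pred1 set0) => [|U]; last by rewrite cards_eq0.
have [b sb] : exists b : 'I_n, (b < (t^-1)%g b)%N.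
  apply/existsP; apply: contraNT t1; rewrite negb_exists => /forallP le_t.
  by rewrite -[t]invgK (@perm_le_id _ t^-1%g) ?invg1 // => b; rewrite leqNgt.
rewrite /subset_wt (bigD1 b) ?inE //= /gwt -val_eqE gtn_eqF //.
by rewrite ltnNge (ltnW sb) mul0r !mulr0 rmorph0 mul0r.
Qed.

Local Notation iotaP := (map_poly iota).
Let rhoP s := (rho s)%:P.

Let iotaPC := map_poly_central iotaC.

Let rhoPM s t : rhoP s * rhoP t = rhoP (t * s)%g.
Proof. by rewrite -polyCM rhoM. Qed.

Let zP b := (z b)%:P.
Let T u := Theta iotaP rhoP 'X h%:P zP u%:P.

(** Now w is an indeterminate and S_m is recovered as a coefficient. *)
Lemma coef_Theta u m : (m <= n)%N -> (T u)`_(n - m) = (-1) ^+ m * S u m.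
Proof.
move=> le_mn; rewrite /T Theta_Sgen coef_sum.
have SE i : Sgen iotaP rhoP h%:P zP u%:P i = (S u i)%:P.
  apply/esym; apply: (Sgen_map (f := polyC) (g := polyC)) => // c.
  by rewrite /= map_polyC.
have ME i : iotaP ((-1) ^+ i * 'X^(n - i)) = ((-1) ^+ i)%:P * 'X^(n - i).
  by rewrite rmorphM rmorph_sign /= map_polyXn rmorph_sign.
rewrite (bigD1 (inord m)) //= big1 ?addr0 => [|i im].
  by rewrite SE inordK // coefMC ME coefCM coefXn eqxx mulr1.
rewrite SE coefMC ME coefCM coefXn.
case: eqP => [e|]; last by rewrite mulr0 mul0r.
case/eqP: im; apply: val_inj; rewrite /= inordK //.
by have := ltn_ord i; lia.
Qed.

Hypothesis reg_z : forall a b, GRing.lreg (iota (z a - z b + h)).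

Lemma lreg_iotaN c : GRing.lreg (iota (- c)) -> GRing.lreg (iota c).
Proof. by rewrite rmorphN => /lregN; rewrite opprK. Qed.

Lemma lreg_iota_prod (I : finType) (P : pred I) (f : I -> k) :
  (forall i, GRing.lreg (iota (f i))) -> GRing.lreg (iota (\prod_(i | P i) f i)).
Proof. by move=> rf; rewrite rmorph_prod; apply: prod_lreg. Qed.

Section AtSite.
Variable a : 'I_n.
Let Y := moveop iota rho h z a.
Let kap := \prod_(b | b != a) (z a - z b + h).

Let moveopP : moveop iotaP rhoP h%:P zP a = Y%:P.
Proof.
rewrite /moveop /Y /moveop rmorph_prod; apply: eq_bigr => j _.
by rewrite /= -polyCB !map_polyC /= -polyCM -polyCB.
Qed.

Let regw : GRing.lreg ('X + 1 : {poly k}).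
Proof. by rewrite -polyC1; apply/monic_lreg/monicXaddC. Qed.

Let moveop_comm u m : (m <= n)%N -> Y * S u m = S u m * Y.
Proof.
move=> le_mn.
have := @moveop_Theta n _ _ iotaP rhoP iotaPC rhoPM 'X h%:P zP regw a u%:P.
rewrite moveopP => /(congr1 (fun p : {poly A} => p`_(n - m))).
rewrite coefCM coefMC coef_Theta // => e.
apply: (@lreg_sign _ m); rewrite !mulrA -e mulrA; congr (_ * _).
exact/esym/commr_sign.
Qed.

(** The coefficient of w^(n-m) in moveop_fusion; the factor w + 1 there
    produces the difference. *)
Let fusion_Y m : (m <= n)%N ->
  Y * (S (z a) m - S (z a) m.+1) = iota kap * S (z a - h) m.
Proof.
move=> le_mn.
have := @moveop_fusion n _ _ iotaP rhoP iotaPC rhoPM 'X h%:P zP regw a.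
rewrite moveopP -!polyCB -/(T _) -/(T _).
have -> : \prod_(b | b != a) (zP a - zP b + h%:P) = kap%:P.
  by rewrite rmorph_prod; apply: eq_bigr => b _; rewrite !(rmorphD, rmorphN).
rewrite -polyC1 rmorphD /= map_polyX !map_polyC /= rmorph1.
rewrite -mulrA mulrDl polyC1 mul1r => /(congr1 (fun p : {poly A} => p`_(n - m))).
rewrite coefCM coefD coefXM !coefCM !coef_Theta //.
have -> : (if (n - m)%N == 0%N then 0 else Y * (T (z a))`_(n - m).-1) =
    Y * ((-1) ^+ m.+1 * S (z a) m.+1).
  case: eqP => [nm|nm].
    by rewrite Sgen0_gt ?mulr0 //; lia.
  by rewrite -subnS coef_Theta //; lia.
move=> e; apply: (@lreg_sign _ m).
rewrite [RHS]mulrA -[X in X * S (z a - h) m]iotaC -[RHS]mulrA -e.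
by rewrite mulrA -(commr_sign Y m) -mulrA -mulrDr exprS mulN1r mulNr -mulrN -mulrDr addrC.
Qed.

Let cc := kap * (h * \prod_(b | b != a) (z a - z b - h)).

Let D0 : D (z a) = 0.
Proof. by rewrite (bigD1 a) //= subrr mul0r. Qed.

Let Dh : D (z a - h) = - (h * \prod_(b | b != a) (z a - z b - h)).
Proof.
rewrite (bigD1 a) //= addrAC subrr sub0r mulNr; congr (- (_ * _)).
by apply: eq_bigr => b _; rewrite addrAC.
Qed.

Let reg_kap : GRing.lreg (iota kap).
Proof. by apply: lreg_iota_prod => b; exact: reg_z. Qed.

Let reg_cc : GRing.lreg (iota cc).
Proof.
rewrite rmorphM; apply: lregM => //; rewrite rmorphM; apply: lregM.
  by have := @reg_z a a; rewrite subrr add0r.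
apply: lreg_iota_prod => b; apply: lreg_iotaN.
by rewrite opprB opprB addrC; exact: reg_z.
Qed.

(** For m = 0 the fusion relation only involves S_1 and scalars: S_0 is a scalar
    and vanishes at z_a. *)
Let YS1 : Y * S (z a) 1 = iota cc.
Proof.
have := fusion_Y (leq0n n); rewrite !Sgen0 D0 rmorph0 sub0r mulrN Dh rmorphN mulrN.
by move/oppr_inj->; rewrite -rmorphM.
Qed.

Let n_gt0 : (0 < n)%N. Proof. by have := ltn_ord a; lia. Qed.

(** S_1(z_a) is, up to a regular scalar, an inverse of moveop, which
    commutes with all S_m(u). *)
Lemma Sgen1_comm u m : S (z a) 1 * S u m = S u m * S (z a) 1.
Proof.
case: (ltnP n m) => [nm|mn]; first by rewrite !(Sgen0_gt _ _ _ _ _ nm) mulr0 mul0r.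
have S1Y : S (z a) 1 * Y = iota cc by rewrite -moveop_comm // YS1.
apply: reg_cc; rewrite iotaC -{1}YS1 -mulrA [S u m * _]mulrA -moveop_comm //.
by rewrite !mulrA S1Y.
Qed.

(** Multiply the fusion relation by S_1(z_a) to cancel moveop. *)
Lemma Sgen_fusion m : (m <= n)%N ->
  iota (D (z a - h)) * (S (z a) m.+1 - S (z a) m) = S (z a) 1 * S (z a - h) m.
Proof.
move=> mn; have S1Y : S (z a) 1 * Y = iota cc by rewrite -moveop_comm // YS1.
apply: reg_kap; rewrite [RHS]mulrA [in RHS]iotaC -[RHS]mulrA -fusion_Y // [RHS]mulrA S1Y.
rewrite mulrA -rmorphM Dh mulrN rmorphN mulNr -mulrN opprB.
by [].
Qed.
End AtSite.
End Fusion.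

(** * Passage from the sites to congruences *)

(** The coefficient ring is not commutative, but central roots whose
    differences are regular can be split off one after the other. *)
Lemma central_roots_factor (I : eqType) (A : nzRingType) (c : I -> A)
    (s : seq I) (p : {poly A}) :
    (forall i x, c i * x = x * c i) -> uniq s ->
    (forall i j, i != j -> GRing.lreg (c i - c j)) ->
    (forall i, i \in s -> p.[c i] = 0) ->
  exists q, p = q * \prod_(i <- s) ('X - (c i)%:P).
Proof.
move=> cC; elim: s p => [|i s IHs] p /= => [_ _ _|/andP[i_s us] reg_c p0].
  by exists p; rewrite big_nil mulr1.
have /factor_theorem[q pE] : root p (c i) by rewrite /root p0 ?mem_head.
have cfactor a x : comm_poly ('X - (c a)%:P) x.
  by rewrite /comm_poly hornerXsubC mulrBr mulrBl cC.
have [j sj|r qE] := IHs q us reg_c.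
  have /esym : p.[c j] = 0 by rewrite p0 // inE sj orbT.
  rewrite pE hornerM_comm // hornerXsubC => e.
  apply: (reg_c j i); first by apply: contraNneq i_s => <-.
  by rewrite mulr0 e mulrBr mulrBl !cC.
exists r; rewrite big_cons mulrA pE {1}qE -!mulrA; congr (_ * _).
apply/esym/commr_prod => j _; apply: commrB; first exact: commr_polyX.
by apply/polyP => l; rewrite coefMC coefCM cC.
Qed.

Section Sizes.
Variables (n : nat) (k : comNzRingType) (A : nzRingType).
Variables (iota : {rmorphism k -> A}) (rho : 'S_n -> A).
Variables (h : k) (z : 'I_n -> k).

Lemma size_polyCM_leq (R : nzRingType) (c : R) (p : {poly R}) :
  (size (c%:P * p)%R <= size p)%N.
Proof. by rewrite mul_polyC size_scale_leq. Qed.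

Lemma size_prod_gwt (V : {set 'I_n}) (d : 'I_n -> 'I_n) :
  (size (\prod_(b in V) gwt h%:P (fun a => (z a)%:P) 'X b (d b) : {poly k})%R <= #|V|.+1)%N.
Proof.
apply: (leq_trans (size_poly_prod_leq _ _)).
have -> : #|[pred b | b \in V]| = #|V| by exact: eq_card.
set sm := (\sum_(_ in _) _)%N.
suff : (sm <= 2 * #|V|)%N by lia.
rewrite /sm mulnC -sum_nat_const; apply: leq_sum => b _; rewrite /gwt.
case: ifP => _; first by rewrite size_XsubC.
by case: ifP => _; rewrite ?size_poly0 // -polyCN (leq_trans (size_polyC_leq1 _)).
Qed.

Lemma size_Sgen m :
  (size (Sgen (map_poly iota) (fun s => (rho s)%:P) h%:P (fun a => (z a)%:P) 'X m)
     <= (n - m).+1)%N.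
Proof.
apply: (leq_trans (size_sum _ _ _)); apply/bigmax_leqP => t _.
apply: (leq_trans (size_polyMleq _ _)).
apply: (@leq_trans ((n - m).+1 + 1).-1); last by rewrite addn1.
rewrite -!subn1 leq_sub2r // leq_add ?size_polyC_leq1 //.
apply: (leq_trans (size_poly _ _)).
rewrite -(rmorph_sign polyC) -(rmorphXn polyC) /=.
do 2!apply: (leq_trans (size_polyCM_leq _ _)).
apply: (leq_trans (size_sum _ _ _)); apply/bigmax_leqP => U /eqP cU.
apply: leq_trans (size_prod_gwt _ _) _.
by rewrite cardsCs setCK card_ord cU.
Qed.
End Sizes.

Section CentralRoots.
Variables (I : finType) (A : nzRingType) (c : I -> A).
Hypothesis cC : forall i x, c i * x = x * c i.
Hypothesis reg_c : forall i j, i != j -> GRing.lreg (c i - c j).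

Lemma central_roots_dvd (p : {poly A}) : (forall i, p.[c i] = 0) ->
  exists q, p = q * \prod_i ('X - (c i)%:P).
Proof.
move=> p0; apply: (@central_roots_factor _ _ c _ p cC (index_enum_uniq I)) => //.
Qed.

Lemma central_roots_eq0 (p : {poly A}) :
  (size p <= #|I|)%N -> (forall i, p.[c i] = 0) -> p = 0.
Proof.
move=> sp /central_roots_dvd[q pE]; apply/eqP; apply: contraTT sp => p0.
have q0 : q != 0 by apply: contraNneq p0 => q0; rewrite pE q0 mul0r.
have mon : \prod_i ('X - (c i)%:P) \is monic by apply: monic_prod_XsubC.
rewrite pE size_Mmonic // size_prod_XsubC -ltnNge.
have : (0 < size q)%N by rewrite lt0n size_poly_eq0.
have -> : size (index_enum I) = #|I|.
  by rewrite -sum1_size -sum1_card; apply: eq_bigl.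
by lia.
Qed.
End CentralRoots.

Section AllPoints.
Variables (n : nat) (F : fieldType) (A : nzRingType).
Variables (iota : {rmorphism F -> A}) (rho : 'S_n -> A).
Hypothesis iotaC : forall c x, iota c * x = x * iota c.
Hypothesis rhoM : forall s t, rho s * rho t = rho (t * s)%g.
Hypothesis rho1 : rho 1%g = 1.
Variables (h : F) (z : 'I_n -> F).
Hypothesis charF : [pchar F] =i pred0.
Hypothesis h0 : h != 0.

Local Notation Spol := (Sgen (map_poly iota) (fun s => (rho s)%:P) h%:P
  (fun a => (z a)%:P)).

(** The deformation z_a + a t, whose pairwise differences are regular in
    characteristic 0 even if some z_a coincide. *)
Let zt (a : 'I_n) : {poly F} := (z a)%:P + a%:R *: 'X.
Local Notation iotaP := (map_poly iota).
Let rhoP s := (rho s)%:P.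
Let iotaPC := map_poly_central iotaC.

Let rhoPM s t : rhoP s * rhoP t = rhoP (t * s)%g.
Proof. by rewrite -polyCM rhoM. Qed.

Let rhoP1 : rhoP 1%g = 1.
Proof. by rewrite /rhoP rho1. Qed.

Lemma lreg_iotaP (c : {poly F}) : c != 0 -> GRing.lreg (iotaP c).
Proof.
move=> c0; apply: lreg_lead; rewrite lead_coef_map.
have u : iota (lead_coef c)^-1 * iota (lead_coef c) = 1.
  by rewrite -rmorphM mulVf ?rmorph1 // lead_coef_eq0.
by apply: (@GRing.lregMl _ (iota (lead_coef c)^-1)); rewrite u; exact: lreg1.
Qed.

Lemma natr_inj_pchar0 (m p : nat) : m%:R = p%:R :> F -> m = p.
Proof.
wlog le_mp : m p / (m <= p)%N.
  by move=> IH; case/orP: (leq_total m p) => le e; [|apply/esym]; apply: IH.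
move=> e; apply/eqP; rewrite eqn_leq le_mp /= -subn_eq0.
by rewrite -(proj1 (pcharf0P F) charF) natrB // e subrr.
Qed.

Let zt_coef1 a b (c : F) : a != b -> zt a - zt b + c%:P != 0.
Proof.
move=> ab; apply: contraNneq ab => /(congr1 (fun p : {poly F} => p`_1)).
rewrite !(coefD, coefN, coefC, coefZ, coefX) /= !mulr1 !add0r addr0 => /eqP.
by rewrite subr_eq0 => /eqP/natr_inj_pchar0/val_inj->.
Qed.

Let reg_zt a b : a != b -> GRing.lreg (iotaP (zt a) - iotaP (zt b)).
Proof.
by move=> ab; rewrite -rmorphB; apply: lreg_iotaP; rewrite -[_ - _]addr0 zt_coef1.
Qed.

Let reg_zth a b : GRing.lreg (iotaP (zt a - zt b + h%:P)).
Proof.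
apply: lreg_iotaP; have [->|ab] := eqVneq a b; last exact: zt_coef1.
by rewrite subrr add0r polyC_eq0.
Qed.

Local Notation iotaPP := (map_poly iotaP).
Let rhoPP s := (rhoP s)%:P.
Let St := Sgen iotaPP rhoPP h%:P%:P (fun a => (zt a)%:P).

Let ev_comm c : commr_rmorph (@idfun {poly A}) (iotaP c).
Proof. by move=> x; exact: iotaPC. Qed.

Let ev c : {rmorphism {poly {poly A}} -> {poly A}} := horner_morph (ev_comm c).

Let evE c p : ev c p = p.[iotaP c].
Proof. by rewrite /= /horner_morph map_poly_id. Qed.

Let ev_iota c p : ev c (iotaPP p) = iotaP p.[c].
Proof. by rewrite evE horner_map. Qed.

Let ev_St c U m : (St U m).[iotaP c] = Sgen iotaP rhoP h%:P zt U.[c] m.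
Proof.
rewrite -evE; apply: (Sgen_map (f := horner_eval c) (g := ev c)) => [|s|||].
- exact: ev_iota.
- by rewrite evE hornerC.
- by rewrite /= /horner_eval hornerC.
- by move=> a; rewrite /= /horner_eval hornerC.
- by [].
Qed.

Let size_St m : (size (St 'X m) <= (n - m).+1)%N.
Proof. exact: size_Sgen. Qed.

Let zt_central a x : iotaP (zt a) * x = x * iotaP (zt a).
Proof. exact: iotaPC. Qed.

(** A commutator with S_1 has degree less than n in u, so it vanishes as soon
    as it vanishes at the n points. *)
Let St1_vanish (y : {poly A}) :
  (forall a, y * Sgen iotaP rhoP h%:P zt (zt a) 1 =
             Sgen iotaP rhoP h%:P zt (zt a) 1 * y) ->
  y%:P * St 'X 1 = St 'X 1 * y%:P.
Proof.
move=> yC; apply/eqP; rewrite -subr_eq0; apply/eqP.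
apply: (central_roots_eq0 zt_central reg_zt) => [|a].
  rewrite card_ord; case: (posnP n) => [n0|n_gt0].
    have -> : St 'X 1 = 0 by apply: Sgen0_gt; rewrite n0.
    by rewrite mulr0 mul0r subrr size_poly0.
  have sz : (size (St 'X 1) <= n)%N.
    by have := size_St 1; rewrite subn1 prednK.
  apply: (leq_trans (size_polyD _ _)); rewrite size_polyN geq_max.
  rewrite (leq_trans (size_polyCM_leq _ _)) //=.
  apply: (leq_trans (size_polyMleq _ _)).
  by rewrite -subn1 leq_subLR addnC leq_add ?size_polyC_leq1.
rewrite hornerD hornerN hornerCM hornerM_comm; last first.
  by rewrite /comm_poly hornerC zt_central.
by rewrite hornerC ev_St hornerX yC subrr.
Qed.

(** S_1(z_a) commutes with S_1(z_b) for all b, hence with the polynomial S_1;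
    so a coefficient of S_1 commutes with all S_1(z_a), hence with S_1. *)
Let St_comm i j : (St 'X 1)`_i * (St 'X 1)`_j = (St 'X 1)`_j * (St 'X 1)`_i.
Proof.
have evC a : (Sgen iotaP rhoP h%:P zt (zt a) 1)%:P * St 'X 1 =
    St 'X 1 * (Sgen iotaP rhoP h%:P zt (zt a) 1)%:P.
  apply: St1_vanish => b; exact: (Sgen1_comm iotaPC rhoPM rhoP1 reg_zth).
have cC : ((St 'X 1)`_i)%:P * St 'X 1 = St 'X 1 * ((St 'X 1)`_i)%:P.
  apply: St1_vanish => a; have /(congr1 (fun p : {poly {poly A}} => p`_i)) := evC a.
  by rewrite coefCM coefMC.
by have /(congr1 (fun p : {poly {poly A}} => p`_j)) := cC; rewrite coefCM coefMC.
Qed.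

Let St_fusion m : (m <= n)%N -> exists q,
  iotaPP (\prod_a ('X - h%:P%:P - (zt a)%:P)) * (St 'X m.+1 - St 'X m)
  - St 'X 1 * St ('X - h%:P%:P) m = q * \prod_a ('X - (iotaP (zt a))%:P).
Proof.
move=> mn; apply: (central_roots_dvd zt_central reg_zt) => a.
rewrite -evE rmorphB !rmorphM rmorphB !evE !ev_St horner_map !hornerE.
rewrite -(Sgen_fusion iotaPC rhoPM rhoP1 reg_zth a mn).
apply/eqP; rewrite subr_eq0; apply/eqP; congr (iotaP _ * _).
by rewrite horner_prod; apply: eq_bigr => b _; rewrite !hornerE.
Qed.

Let at0_comm : commr_rmorph (@idfun A) 0.
Proof. by move=> x; rewrite /GRing.comm mul0r mulr0. Qed.

(** Specialisation at t = 0. *)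
Let at0 : {rmorphism {poly A} -> A} := horner_morph at0_comm.

Let at0E p : at0 p = p.[0].
Proof. by rewrite /= /horner_morph map_poly_id. Qed.

Let at0_zt a : (zt a).[0] = z a.
Proof. by rewrite /zt !hornerE. Qed.

Let ev0 : {rmorphism {poly {poly F}} -> {poly F}} := map_poly (horner_eval 0).

Let at0_iota P : map_poly at0 (iotaPP P) = iotaP (ev0 P).
Proof.
rewrite /= -!map_poly_comp; apply: eq_map_poly => p.
by rewrite [LHS]at0E /= -[X in _.[X]](rmorph0 iota) horner_map.
Qed.

Let at0_St U m : map_poly at0 (St U m) = Spol (ev0 U) m.
Proof.
apply: (Sgen_map (f := ev0) (g := map_poly at0)) => [|s||a|//].
- exact: at0_iota.
- by have /= e := at0E (rho s)%:P; rewrite /= map_polyC /= e hornerC.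
- by rewrite /= map_polyC /= /horner_eval hornerC.
- by rewrite /= map_polyC /= /horner_eval at0_zt.
Qed.

Theorem Spol1_comm i j : (Spol 'X 1)`_i * (Spol 'X 1)`_j =
  (Spol 'X 1)`_j * (Spol 'X 1)`_i.
Proof.
have := congr1 at0 (St_comm i j); rewrite !rmorphM /= -!coef_map.
by rewrite at0_St /= map_polyX.
Qed.

Theorem Spol_fusion m : (m <= n)%N -> exists q,
  map_poly iota (\prod_a ('X - h%:P - (z a)%:P)) * (Spol 'X m.+1 - Spol 'X m)
  - Spol 'X 1 * Spol ('X - h%:P) m = q * map_poly iota (\prod_a ('X - (z a)%:P)).
Proof.
move=> mn; have [q /(congr1 (map_poly at0))] := St_fusion mn.
have ev0X : ev0 'X = 'X by exact: map_polyX.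
have ev0C c : ev0 c%:P%:P = c%:P by rewrite /= map_polyC /= /horner_eval hornerC.
have ev0Xh : ev0 ('X - h%:P%:P) = 'X - h%:P by rewrite rmorphB ev0X ev0C.
have ev0z a : ev0 (zt a)%:P = (z a)%:P.
  by rewrite /= map_polyC /= /horner_eval at0_zt.
have -> : \prod_a ('X - (iotaP (zt a))%:P) = iotaPP (\prod_a ('X - (zt a)%:P)).
  by rewrite rmorph_prod; apply: eq_bigr => a _; rewrite /= map_polyXsubC.
rewrite rmorphB !rmorphM rmorphB /= !at0_St ev0X => e; exists (map_poly at0 q).
have Ez : \prod_a ('X - (z a)%:P) = ev0 (\prod_a ('X - (zt a)%:P)).
  by rewrite rmorph_prod; apply: eq_bigr => a _; rewrite rmorphB ev0X ev0z.
have Ezh : \prod_a ('X - h%:P - (z a)%:P) =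
    ev0 (\prod_a ('X - h%:P%:P - (zt a)%:P)).
  by rewrite rmorph_prod; apply: eq_bigr => a _; rewrite rmorphB ev0Xh ev0z.
by rewrite Ez Ezh -!at0_iota -ev0Xh; exact: e.
Qed.
End AllPoints.

(** * Multiplication by u in the Newton basis *)

Section NewtonBasis.
Variables (R : comNzRingType) (n : nat).
Variable (z : 'I_n.+1 -> R).
Local Notation N := n.+1.
Local Notation zn i := (z (inord i)).

Definition newton (j : nat) (x : R) : R := \prod_(0 <= i < j) (x - zn i).

(** Multiplication by u modulo the product of the u - z_a in the basis
    e_j = (u - z_0) ... (u - z_{j-1}): u e_j = z_j e_j + e_{j+1}.  The j-th column of
    a matrix contains the image of e_j. *)
Definition mulmat : 'M[R]_N :=
  \matrix_(i, j) (if i == j then z j else (i == j.+1 :> nat)%:R).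

Definition e0 : 'cV[R]_N := delta_mx 0 0.
Definition topcoef : 'rV[R]_N := delta_mx 0 ord_max.
Definition newton_row (x : R) : 'rV[R]_N := \row_j newton j x.

(** Multiplication by the product of the u - h - z_i over i < j. *)
Definition shiftprod (h : R) (j : nat) : 'M[R]_N :=
  \prod_(0 <= i < j) (mulmat - (h + zn i)%:M).
(** The substitution of u - h for u: the j-th column is the reduction of
    e_j(u - h). *)
Definition shiftmat (h : R) : 'M[R]_N :=
  \matrix_(i, j) (shiftprod h j *m e0) i 0.

Lemma mulmat_col (m : nat) (B : 'M[R]_(m, N)) (i : 'I_m) (j : 'I_N) :
  (B *m mulmat) i j =
  B i j * z j + (if (j < n)%N then B i (inord j.+1) else 0).
Proof.
rewrite mxE (bigD1 j) //= !mxE eqxx; congr (_ + _).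
case: ifP => jn.
  have ji : inord j.+1 != j :> 'I_N by rewrite -val_eqE /= inordK ?gtn_eqF.
  rewrite (bigD1 (inord j.+1)) //= mxE (negPf ji) inordK // eqxx mulr1.
  rewrite big1 ?addr0 // => l /andP[lj li]; rewrite mxE (negPf lj).
  by rewrite -val_eqE /= inordK // in li; rewrite (negPf li) mulr0.
rewrite big1 // => l lj; rewrite mxE (negPf lj).
have -> : (l == j.+1 :> nat) = false; last by rewrite mulr0.
by apply/negP => /eqP lE; have := ltn_ord l; rewrite lE ltnS jn.
Qed.

Lemma newtonS j x : newton j.+1 x = newton j x * (x - zn j).
Proof. by rewrite /newton big_nat_recr. Qed.

Lemma newtonN x : newton N x = \prod_i (x - z i).
Proof. by rewrite /newton big_mkord; apply: eq_bigr => i _; rewrite inord_val. Qed.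

(** The row of the e_j(x) is a left eigenvector of multiplication by u, up to
    the product e_{n+1}(x) of the x - z_i in the last column. *)
Lemma newton_row_eigen x :
  newton_row x *m (x%:M - mulmat) = (\prod_i (x - z i)) *: topcoef.
Proof.
apply/rowP => j; rewrite mulmxBr mul_mx_scalar.
rewrite mxE [X in X + _]mxE [X in _ + X]mxE mulmat_col !mxE -newtonN.
rewrite eqxx /=; case: ifP => jn.
  rewrite inordK // newtonS inord_val -val_eqE /= ltn_eqF // mulr0.
  by rewrite mulrBr; ring.
have jE : j = n :> nat by apply/eqP; rewrite eqn_leq -ltnS ltn_ord leqNgt jn.
have zE : zn n = z j by congr z; apply: val_inj; rewrite /= inordK.
by rewrite -val_eqE /= jE eqxx mulr1 newtonS zE; ring.
Qed.

Lemma det_sub_mulmat x : \det (x%:M - mulmat) = \prod_i (x - z i).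
Proof.
rewrite det_trig; first by apply: eq_bigr => i _; rewrite !mxE eqxx.
apply/is_trig_mxP => i j ij; rewrite !mxE -val_eqE ltn_eqF //=.
by rewrite ltn_eqF ?subrr // (ltn_trans ij).
Qed.

Lemma scalar_comm (a : R) (B : 'M[R]_N) : GRing.comm B a%:M.
Proof. exact: scalar_mxC. Qed.

Lemma mulmat_shiftprod h j : GRing.comm mulmat (shiftprod h j).
Proof.
apply: commr_prod => i _; apply: commrB; first exact: commr_refl.
exact: scalar_comm.
Qed.

Lemma shiftprodS h j :
  shiftprod h j.+1 = (mulmat - (h + zn j)%:M) * shiftprod h j.
Proof.
rewrite /shiftprod big_nat_recr //= -/(shiftprod h j).
apply/commrB; last exact: scalar_comm.
exact/commr_sym/mulmat_shiftprod.
Qed.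

Lemma mulmat_e (j : 'I_N) :
  mulmat *m delta_mx j (0 : 'I_1) = z j *: delta_mx j 0 +
    (if (j < n)%N then delta_mx (inord j.+1) 0 else 0).
Proof.
apply/colP => i; rewrite mxE (bigD1 j) //= big1 => [|l lj]; last first.
  by rewrite [delta_mx _ _ _ _]mxE (negPf lj) mulr0.
rewrite addr0 [delta_mx _ _ _ _]mxE eqxx mulr1 !mxE eqxx andbT.
have [->|ij] := eqVneq i j.
  rewrite mulr1; case: ifP => jn; last by rewrite mxE addr0.
  by rewrite mxE -val_eqE /= inordK // ltn_eqF // addr0.
rewrite mulr0 add0r; case: ifP => jn.
  by rewrite mxE eqxx andbT -val_eqE /= inordK.
rewrite mxE; case: eqP => // iE; have := ltn_ord i.
by rewrite iE ltnS jn.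
Qed.

Lemma shiftprod0_e0 (j : 'I_N) : shiftprod 0 j *m e0 = delta_mx j 0.
Proof.
case: j => j; elim: j => [|j IHj] jN.
  rewrite /shiftprod big_geq // mul1mx; congr (delta_mx _ _); exact: val_inj.
have jn : (j < N)%N by rewrite ltnW.
rewrite shiftprodS -mulmxA (IHj jn) mulmxBl mulmat_e mul_scalar_mx add0r /=.
have jn1 : (j < n)%N by rewrite -ltnS.
rewrite jn1 (_ : inord j = Ordinal jn); last first.
  by apply: val_inj; rewrite /= inordK.
rewrite addrC addKr; congr (delta_mx _ _); apply: val_inj.
by rewrite /= inordK.
Qed.

Lemma shiftprod0N_e0 : shiftprod 0 N *m e0 = 0.
Proof.
rewrite shiftprodS -mulmxA (shiftprod0_e0 ord_max) mulmxBl mulmat_e ltnn addr0.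
by rewrite mul_scalar_mx add0r (_ : inord n = ord_max) ?subrr //;
  apply: val_inj; rewrite /= inordK.
Qed.

(** Substitution turns multiplication by u into multiplication by u - h; the
    rank one defect is the reduction modulo the product of the u - z_a, which
    the substitution does not respect. *)
Lemma shiftmat_mulmat h :
  shiftmat h *m mulmat =
  (mulmat - h%:M) *m shiftmat h - shiftprod h N *m e0 *m topcoef.
Proof.
have colE (B : 'M[R]_N) i j : (B *m shiftmat h) i j = (B *m (shiftprod h j *m e0)) i 0.
  by rewrite !mxE; apply: eq_bigr => l _; rewrite [shiftmat h _ _]mxE.
apply/matrixP => i j.
rewrite mulmat_col [RHS]mxE colE mulmxA -[X in (X *m e0) i 0]/(_ * _).
have -> : (mulmat - h%:M) * shiftprod h j =
    shiftprod h j.+1 + z j *: shiftprod h j.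
  rewrite shiftprodS inord_val -[z j *: _]mul_scalar_mx -[RHS]mulrDl.
  by rewrite raddfD /= opprD addrA subrK.
rewrite mulmxDl -scalemxAl [in RHS]mxE [X in _ + X + _]mxE [X in _ = _ + X]mxE.
rewrite [shiftmat h i j]mxE [X in - X]mxE big_ord1 [topcoef _ _]mxE eqxx /=.
case: ifP => jn.
  rewrite [shiftmat h _ _]mxE inordK // -val_eqE /= ltn_eqF // mulr0 subr0.
  by rewrite addrC mulrC.
have jE : j = n :> nat by apply/eqP; rewrite eqn_leq -ltnS ltn_ord leqNgt jn.
by rewrite -val_eqE /= jE eqxx mulr1 addr0 addrAC subrr add0r mulrC.
Qed.

Lemma mulmat_row (m : nat) (B : 'M[R]_(N, m)) (i : 'I_N) (j : 'I_m) :
  (mulmat *m B) i j =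
  z i * B i j + (if (0 < i)%N then B (inord i.-1) j else 0).
Proof.
rewrite mxE (bigD1 i) //= !mxE eqxx; congr (_ + _).
case: posnP => i0.
  by rewrite big1 // => l li; rewrite mxE eq_sym (negPf li) i0 mul0r.
have iN : (i.-1 < N)%N by rewrite prednK // ltnW.
have il : inord i.-1 != i :> 'I_N.
  by rewrite -val_eqE /= inordK // ltn_eqF // prednK.
rewrite (bigD1 (inord i.-1)) //= mxE eq_sym (negPf il) inordK // prednK // eqxx.
rewrite mul1r big1 ?addr0 // => l /andP[li lp]; rewrite mxE eq_sym (negPf li).
case: eqP => [iE|]; last by rewrite mul0r.
by rewrite iE /= inord_val eqxx in lp.
Qed.

Lemma mulmatX_e0_coord (i : nat) : (i <= n)%N ->
  (forall j : 'I_N, (i < j)%N -> (mulmat ^+ i *m e0) j 0 = 0) /\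
  (mulmat ^+ i *m e0) (inord i) 0 = 1.
Proof.
elim: i => [_|i IHi lt_in].
  split=> [j j0|]; rewrite expr0 mul1mx mxE.
    by rewrite -val_eqE /= gtn_eqF.
  by rewrite (_ : inord 0 = 0) ?eqxx //; apply: val_inj; rewrite /= inordK.
have [IH0 IH1] := IHi (ltnW lt_in); rewrite exprS -mulmxA.
split=> [j ij|]; rewrite mulmat_row.
  have j0 : (0 < j)%N by apply: leq_trans ij.
  have jE : (j.-1 < N)%N by rewrite prednK // ltnW.
  rewrite j0 !IH0 ?mulr0 ?addr0 //; last exact: ltnW.
  by rewrite inordK // -ltnS prednK.
by rewrite IH0 inordK //= mulr0 add0r IH1.
Qed.

Lemma topcoef_mulmatX_e0 (i : nat) : (i <= n)%N ->
  topcoef *m (mulmat ^+ i *m e0) = (i == n)%:R%:M.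
Proof.
move=> le_in; have [c0 c1] := mulmatX_e0_coord le_in.
apply/matrixP => a b; rewrite !ord1 [RHS]mxE eqxx mulr1n mxE (bigD1 ord_max) //=.
rewrite [topcoef _ _]mxE !eqxx mul1r big1 ?addr0 => [|j jn]; last first.
  by rewrite [topcoef _ _]mxE (negPf jn) andbF mul0r.
move: le_in; rewrite leq_eqVlt => /orP[/eqP iE|lt_in]; last first.
  by rewrite c0 // ltn_eqF.
rewrite iE eqxx -[RHS]c1 iE; congr (_ _ 0); apply: val_inj.
by rewrite /= inordK.
Qed.

Lemma newton_row_mulmatX_e0 x (i : nat) : (i <= n)%N ->
  newton_row x *m (mulmat ^+ i *m e0) = (x ^+ i)%:M.
Proof.
elim: i => [_|i IHi lt_in].
  rewrite expr0 mul1mx; apply/matrixP => a b; rewrite !ord1 mxE (bigD1 0) //=.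
  rewrite !mxE /newton big_geq // mul1r big1 ?addr0 ?mulr1n // => j j0.
  by rewrite [e0 _ _]mxE (negPf j0) mulr0.
have := newton_row_eigen x; rewrite mulmxBr mul_mx_scalar => e.
have {}e : newton_row x *m mulmat =
    x *: newton_row x - (\prod_i (x - z i)) *: topcoef.
  by rewrite -e opprB addrC subrK.
have i_n : (i == n) = false by rewrite ltn_eqF.
rewrite exprS -mulmxA mulmxA e mulmxBl -!scalemxAl IHi 1?ltnW //.
rewrite topcoef_mulmatX_e0 1?ltnW // i_n raddf0 scaler0 subr0 exprS.
by rewrite scale_scalar_mx.
Qed.

Lemma shiftmat_mulmatX_e0 h (i : nat) : (i <= n)%N ->
  shiftmat h *m (mulmat ^+ i *m e0) = (mulmat - h%:M) ^+ i *m e0.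
Proof.
elim: i => [_|i IHi lt_in].
  apply/colP => j; rewrite !expr0 !mul1mx mxE (bigD1 0) //= big1 => [|l l0].
    rewrite [e0 0 0]mxE mulr1 addr0 mxE /shiftprod big_geq // mul1mx //.
  by rewrite [e0 _ _]mxE (negPf l0) mulr0.
rewrite !exprS -!mulmxA [LHS]mulmxA shiftmat_mulmat mulmxBl -!mulmxA IHi 1?ltnW //.
by rewrite topcoef_mulmatX_e0 1?ltnW // ltn_eqF // raddf0 !mulmx0 subr0.
Qed.

Lemma det_shiftprod h :
  \det (shiftprod h N) = \prod_(i < N) \prod_(j < N) (z j - (h + z i)).
Proof.
rewrite /shiftprod big_mkord (big_morph _ (@det_mulmx _ _) (det1 _ _)).
apply: eq_bigr => i _; rewrite inord_val det_trig.
  by apply: eq_bigr => j _; rewrite !mxE eqxx.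
apply/is_trig_mxP => a b ab; rewrite !mxE -val_eqE ltn_eqF //=.
by rewrite ltn_eqF ?subrr // (ltn_trans ab).
Qed.

End NewtonBasis.

Section Map.
Variables (R R' : comNzRingType) (f : {rmorphism R -> R'}) (n : nat).
Variables (z : 'I_n.+1 -> R).
Let fz a := f (z a).

Lemma map_mulmat : map_mx f (mulmat z) = mulmat fz.
Proof.
by apply/matrixP => i j; rewrite !mxE; case: ifP => //; rewrite rmorph_nat.
Qed.

Lemma map_shiftprod h j : map_mx f (shiftprod z h j) = shiftprod fz (f h) j.
Proof.
rewrite /shiftprod rmorph_prod; apply: eq_bigr => i _.
by rewrite rmorphB /= map_mulmat map_scalar_mx rmorphD.
Qed.

Lemma map_e0 : map_mx f (e0 R n) = e0 R' n.
Proof. exact: map_delta_mx. Qed.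

Lemma map_topcoef : map_mx f (topcoef R n) = topcoef R' n.
Proof. exact: map_delta_mx. Qed.

Lemma map_shiftmat h : map_mx f (shiftmat z h) = shiftmat fz (f h).
Proof.
apply/matrixP => i j; rewrite mxE [in RHS]mxE [shiftmat _ _ _ _]mxE.
by rewrite -map_shiftprod -map_e0 -map_mxM [in RHS]mxE.
Qed.
End Map.

(** * Adjugates, traces and rank one updates *)

Lemma deriv_prod (R : comNzRingType) (I : finType) (F : I -> {poly R}) :
  (\prod_i F i)^`() = \sum_i (F i)^`() * \prod_(j | i != j) F j.
Proof.
have gen (s : seq I) : uniq s -> (\prod_(i <- s) F i)^`() =
    \sum_(i <- s) (F i)^`() * \prod_(j <- s | i != j) F j.
  elim: s => [_|i s IHs /= /andP[i_s us]]; first by rewrite !big_nil derivC.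
  rewrite big_cons derivM IHs // [in RHS]big_cons [X in _ + X = _]mulr_sumr.
  congr (_ * _ + _).
    rewrite [RHS]big_cons eqxx /= [RHS]big_seq_cond [LHS]big_seq_cond.
    apply: eq_bigl => j; rewrite andbT; case js: (j \in s) => //=.
    by apply/esym; apply: contraNneq i_s => ->.
  rewrite big_seq_cond [RHS]big_seq_cond; apply: eq_bigr => j /andP[js _].
  have ji : j != i by apply: contraNneq i_s => <-.
  by rewrite [in RHS]big_cons ji mulrCA.
exact: gen (index_enum_uniq I).
Qed.

(** Jacobi formula for the derivative of det (v - A). *)
Lemma char_poly_deriv (R : comNzRingType) m (A : 'M[R]_m) :
  (char_poly A)^`() = \tr (\adj (char_poly_mx A)).
Proof.
rewrite /char_poly /determinant raddf_sum /=.
transitivity (\sum_(s : 'S_m) \sum_i (-1) ^+ s *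
    ((s i == i)%:R * \prod_(j | i != j) char_poly_mx A j (s j))).
  apply: eq_bigr => s _; rewrite -signr_odd oddb -(rmorph_sign polyC).
  rewrite mul_polyC derivZ -mul_polyC deriv_prod mulr_sumr.
  apply: eq_bigr => i _; congr (_ * (_ * _)).
  by rewrite !mxE derivB derivC subr0 derivMn derivX eq_sym.
rewrite exchange_big; apply: eq_bigr => i _ /=; rewrite mxE expand_cofactor.
rewrite [RHS]big_mkcond; apply: eq_bigr => s _.
by case: eqP => _; rewrite ?mul1r // mul0r mulr0.
Qed.

(** The matrix determinant lemma with a left adjugate Y of X, read off
    from two triangular factorisations of a bordered matrix. *)
Lemma det_sub_rank1 (R : idomainType) m (X Y : 'M[R]_m) (c : 'cV[R]_m)
    (r : 'rV[R]_m) : \det X != 0 -> Y *m X = (\det X)%:M ->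
  \det (X - c *m r) = \det X - (r *m Y *m c) 0 0.
Proof.
move=> X0 YX; pose B := block_mx X c r (1%:M : 'M_1).
have d1 : \det B = \det (X - c *m r).
  have e : B *m block_mx 1%:M 0 (- r) 1%:M = block_mx (X - c *m r) c 0 1%:M.
    rewrite mulmx_block !mulmx1 !mulmx0 !mul1mx mulmxN addrC.
    by rewrite [- _ + X]addrC subrr !add0r.
  have := congr1 determinant e; rewrite det_mulmx det_lblock det_ublock !det1.
  by rewrite !mulr1.
have d2 : \det Y * (\det X * \det B) =
    \det X ^+ m * (\det X - (r *m Y *m c) 0 0).
  have e : block_mx Y 0 (- (r *m Y)) (\det X)%:M *m B =
      block_mx (\det X)%:M (Y *m c) 0 (\det X - (r *m Y *m c) 0 0)%:M.
    rewrite /B mulmx_block !mul0mx !addr0 YX !mulNmx -[r *m _ *m X]mulmxA YX.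
    rewrite mulmx1 mul_scalar_mx mul_mx_scalar addNr; congr (block_mx _ _ _ _).
    apply/matrixP => i j; rewrite !ord1 !mxE eqxx !mulr1n addrC.
    by [].
  have := congr1 determinant e; rewrite det_mulmx det_lblock det_ublock.
  by rewrite !det_scalar !expr1 mulrA.
have d3 : \det X * \det Y = \det X ^+ m.
  by rewrite mulrC -det_mulmx YX det_scalar.
apply: (mulfI (expf_neq0 m X0)); rewrite -d1 -d2 -d3.
by rewrite mulrCA mulrA.
Qed.

Section Intertwine.
Variables (M : comNzRingType) (n : nat) (h : M).
Variables (Z Q : 'M[M]_n.+1) (c : 'cV[M]_n.+1) (l : 'rV[M]_n.+1).
Hypothesis QZ : Q *m Z = (Z - h%:M) *m Q + c *m l.
Local Notation mC := (map_mx polyC).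
Local Notation chi := (char_poly Q).

Lemma adj_char_poly_mx_comm :
  \adj (char_poly_mx Q) *m mC Q = mC Q *m \adj (char_poly_mx Q).
Proof.
have e : char_poly_mx Q *m \adj (char_poly_mx Q) =
    \adj (char_poly_mx Q) *m char_poly_mx Q.
  by rewrite mul_mx_adj mul_adj_mx.
move: e; rewrite {1 4}/char_poly_mx mulmxBl mulmxBr => /eqP.
rewrite mul_scalar_mx mul_mx_scalar (inj_eq (addrI _)) eqr_opp => /eqP.
by [].
Qed.

Lemma adj_char_poly_trace :
  \tr (\adj (char_poly_mx Q) *m mC Q) = 'X * chi^`() - n.+1%:R * chi.
Proof.
have : \adj (char_poly_mx Q) *m char_poly_mx Q = chi%:M by rewrite mul_adj_mx.
rewrite {2}/char_poly_mx mulmxBr mul_mx_scalar => /(congr1 mxtrace).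
rewrite raddfB /= mxtraceZ -char_poly_deriv mxtrace_scalar => /eqP.
by rewrite subr_eq addrC -subr_eq => /eqP <-; rewrite mulr_natl.
Qed.

(** The rank one matrix c l is Q Z - (Z - h) Q.  Since adj (v - Q) commutes with
    Q, only h tr (adj (v - Q) Q) is left of its trace against adj (v - Q). *)
Lemma row_adj_col :
  (mC l *m \adj (char_poly_mx Q) *m mC c) 0 0 =
  h%:P * ('X * chi^`() - n.+1%:R * chi).
Proof.
have cl : mC c *m mC l = mC Q *m mC Z - (mC Z - h%:P%:M) *m mC Q.
  rewrite -!map_mxM /= QZ raddfD /= addrAC !map_mxM /= raddfB /=.
  by rewrite map_scalar_mx subrr add0r.
transitivity (\tr (\adj (char_poly_mx Q) *m (mC c *m mC l))).
  by rewrite [in RHS]mulmxA mxtrace_mulC mulmxA /mxtrace big_ord1.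
have trQZ : \tr (\adj (char_poly_mx Q) *m (mC Q *m mC Z)) =
    \tr (\adj (char_poly_mx Q) *m (mC Z *m mC Q)).
  by rewrite mulmxA adj_char_poly_mx_comm -mulmxA mxtrace_mulC -mulmxA.
rewrite cl mulmxBr raddfB /= [(mC Z - _) *m _]mulmxBl mulmxBr raddfB /= opprB.
rewrite trQZ addrC subrK mul_scalar_mx -scalemxAr mxtraceZ.
by rewrite adj_char_poly_trace.
Qed.
End Intertwine.

(** * Determinants of the curve *)

(** Its determinant is the curve, with x in the place of v. *)
Definition curve_form (E : comNzRingType) m (x u h : E) (Z Q : 'M[E]_m) : 'M[E]_m :=
  x *: (u%:M - Z) - (u%:M - Z + h%:M) *m Q.

Section CurveForm.
Variables (E : comNzRingType) (m : nat) (x u h : E).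
Implicit Types Z Q V R W : 'M[E]_m.

(** For an intertwiner Q with a rank one defect R, the curve is the
    determinant of a rank one update of a product. *)
Lemma curve_form_factor Z Q R : Q *m Z = (Z - h%:M) *m Q + R ->
  curve_form x u h Z Q = (x%:M - Q) *m (u%:M - Z) - R.
Proof.
move=> QZ; have -> : R = Q *m Z - (Z - h%:M) *m Q by rewrite QZ addrAC subrr add0r.
rewrite /curve_form !(mulmxDl, mulmxBl, mulmxBr, mulNmx).
rewrite !mul_scalar_mx !mul_mx_scalar scalerBr.
move: (Q *m Z) (Z *m Q) => x1 x2.
by apply/matrixP => i j; rewrite !mxE; ring.
Qed.

Lemma curve_form_conj V Z Q Z' Q' : V *m Z = Z' *m V -> V *m Q = Q' *m V ->
  V *m curve_form x u h Z Q = curve_form x u h Z' Q' *m V.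
Proof.
move=> VZ VQ; have VU : V *m (u%:M - Z) = (u%:M - Z') *m V.
  by rewrite mulmxBr mulmxBl VZ scalar_mxC.
have VH : V *m h%:M = h%:M *m V by rewrite scalar_mxC.
rewrite /curve_form mulmxBr mulmxBl -scalemxAr -scalemxAl VU; congr (_ - _).
by rewrite mulmxA mulmxDr VU VH -mulmxDl -!mulmxA VQ.
Qed.

(** The product of W with the curve matrix of Q, in terms of R = - W Q. *)
Definition clear_form W Z R : 'M[E]_m :=
  x *: (W *m (u%:M - Z)) + (u%:M - Z + h%:M) *m R.

Lemma curve_form_clear W Z Q R : W *m Z = Z *m W -> W *m Q = - R ->
  W *m curve_form x u h Z Q = clear_form W Z R.
Proof.
move=> WZ WQ; rewrite /curve_form mulmxBr -scalemxAr; congr (_ + _).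
rewrite mulmxA mulmxDr mulmxBr WZ !scalar_mxC -mulmxBl -mulmxDl -mulmxA WQ.
by rewrite mulmxN opprK.
Qed.
End CurveForm.

Lemma map_clear_form (E E' : comNzRingType) (f : {rmorphism E -> E'}) m
    (x u h : E) (W Z R : 'M[E]_m) :
  map_mx f (clear_form x u h W Z R) =
  clear_form (f x) (f u) (f h) (map_mx f W) (map_mx f Z) (map_mx f R).
Proof.
by rewrite /clear_form !(map_mxD, map_mxN, map_mxZ, map_mxM, map_scalar_mx).
Qed.

Lemma det_conj (E : idomainType) m (V X Y : 'M[E]_m) :
  \det V != 0 -> V *m X = Y *m V -> \det X = \det Y.
Proof.
by move=> V0 VX; apply: (mulfI V0); rewrite -det_mulmx VX det_mulmx mulrC.
Qed.

Lemma det_diag_swap (E : idomainType) m (a b : 'rV[E]_m) (K : 'M[E]_m) :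
    (forall i, b 0 i != 0) ->
  \det (diag_mx a - K *m diag_mx b) = \det (diag_mx a - diag_mx b *m K).
Proof.
move=> b0; have B0 : \det (diag_mx b) != 0.
  by rewrite det_diag; apply/prodf_neq0 => i _.
apply: (mulfI B0); rewrite -det_mulmx mulrC -det_mulmx; congr (\det _).
by rewrite mulmxBl mulmxBr mulmxA diag_mxC.
Qed.

(** As det_sub_rank1 for X = X1 X2, where r is the row l times the
    adjugate of X2. *)
Lemma det_mul_sub_rank1 (E : idomainType) m (X1 X2 J : 'M[E]_m) (a b : E)
    (c : 'cV[E]_m) (l r : 'rV[E]_m) :
    \det X1 = a -> \det X2 = b -> a != 0 -> b != 0 ->
    J *m X1 = a%:M -> r *m X2 = b *: l ->
  \det (X1 *m X2 - c *m l) = a * b - (r *m (J *m c)) 0 0.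
Proof.
move=> d1 d2 a0 b0 JX rX.
have YX : (\adj X2 *m J) *m (X1 *m X2) = (\det (X1 *m X2))%:M.
  rewrite det_mulmx d1 d2 -mulmxA [J *m _]mulmxA JX mul_scalar_mx -scalemxAr.
  by rewrite mul_adj_mx d2 scale_scalar_mx.
rewrite (det_sub_rank1 _ _ _ YX); last by rewrite det_mulmx d1 d2 mulf_neq0.
rewrite det_mulmx d1 d2; congr (_ - _); apply: (mulfI b0).
have lr : b *: (l *m \adj X2) = b *: r.
  by rewrite scalemxAl -rX -mulmxA mul_mx_adj d2 mul_mx_scalar.
transitivity ((b *: (r *m (J *m c))) 0 0); last by rewrite mxE.
by rewrite scalemxAl -lr -!scalemxAl !mulmxA [RHS]mxE.
Qed.

(** The transpose of the left hand matrix is diagonal minus K times diagonal;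
    moving the diagonal factor to the other side does not change the determinant. *)
Lemma det_curve_form_diag (E : idomainType) m (x u h : E) (a b : 'rV[E]_m)
    (K : 'M[E]_m) : (forall i, b 0 i * (u - a 0 i + h) != 0) ->
  \det ((u%:M - diag_mx a) *m (x%:M - (K *m diag_mx b)^T)
        - h *: (K *m diag_mx b)^T) =
  \det (curve_form x u h (diag_mx a) (diag_mx b *m K)).
Proof.
move=> nz; pose U := const_mx u - a; pose H := U + const_mx h.
have eU : u%:M - diag_mx a = diag_mx U by rewrite /U linearB /= diag_const_mx.
have eH : u%:M - diag_mx a + h%:M = diag_mx H.
  by rewrite eU /H [in RHS]linearD /= diag_const_mx.
pose be := \row_i (b 0 i * (u - a 0 i + h)).
have eB : diag_mx be = diag_mx b *m diag_mx H.
  by rewrite mulmx_diag; congr (diag_mx _); apply/rowP => i; rewrite !mxE.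
have -> : curve_form x u h (diag_mx a) (diag_mx b *m K) =
    diag_mx (x *: U) - diag_mx be *m K.
  by rewrite /curve_form eU -eU eH eU linearZ /= mulmxA eB (diag_mxC b).
rewrite -det_diag_swap => [|i]; last by rewrite mxE.
have -> : (u%:M - diag_mx a) *m (x%:M - (K *m diag_mx b)^T) - h *: (K *m diag_mx b)^T =
    x *: diag_mx U - diag_mx H *m (K *m diag_mx b)^T.
  rewrite -eH mulmxBr mul_mx_scalar [in RHS]mulmxDl mul_scalar_mx opprD addrA.
  by rewrite eU.
rewrite -[LHS]det_tr; congr (\det _); rewrite linearB linearZ /= trmx_mul trmxK.
by rewrite !tr_diag_mx linearZ eB mulmxA.
Qed.

Notation mx2 B := (map_mx (polyC \o polyC) B).

(** The outer variable is v, the inner one u. *)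
Definition curve_mx (M : comNzRingType) m (h : M) (Z Q : 'M[M]_m) :
    'M[{poly {poly M}}]_m :=
  curve_form 'X 'X%:P h%:P%:P (mx2 Z) (mx2 Q).

Lemma det_curve_mx_conj (M : idomainType) m (h : M) (V Z Q Z' Q' : 'M[M]_m) :
    \det V != 0 -> V *m Z = Z' *m V -> V *m Q = Q' *m V ->
  \det (curve_mx h Z Q) = \det (curve_mx h Z' Q').
Proof.
move=> V0 VZ VQ.
have V2 : \det (mx2 V) != 0 :> {poly {poly M}} by rewrite det_map_mx /= !polyC_eq0.
have e : mx2 V *m curve_mx h Z Q = curve_mx h Z' Q' *m mx2 V.
  by apply: curve_form_conj; rewrite -!map_mxM /= ?VZ ?VQ.
exact: det_conj V2 e.
Qed.

Lemma det_curve_form_clear_map (M E : comNzRingType) (f : {rmorphism M -> E}) m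
    (x u : E) (h : M) (W Z Q R : 'M[M]_m) : W *m Z = Z *m W -> W *m Q = - R ->
  f (\det W) * \det (curve_form x u (f h) (map_mx f Z) (map_mx f Q)) =
  \det (clear_form x u (f h) (map_mx f W) (map_mx f Z) (map_mx f R)).
Proof.
move=> WZ WQ; rewrite -det_map_mx -det_mulmx; congr (\det _).
by apply: curve_form_clear; rewrite -!map_mxM ?WZ ?WQ ?map_mxN.
Qed.

Lemma det_curve_mx_clear (M : comNzRingType) m (h : M) (W Z Q R : 'M[M]_m) :
    W *m Z = Z *m W -> W *m Q = - R ->
  (\det W)%:P%:P * \det (curve_mx h Z Q) =
  \det (clear_form 'X 'X%:P h%:P%:P (mx2 W) (mx2 Z) (mx2 R)).
Proof.
pose f := (polyC \o polyC : {rmorphism M -> {poly {poly M}}}).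
exact: (@det_curve_form_clear_map M _ f m 'X 'X%:P h W Z Q R).
Qed.

Lemma det_clear_form_comp (M M' E E' : comNzRingType) (f : {rmorphism M -> E})
    (g : {rmorphism M' -> E'}) (s : {rmorphism M -> M'}) (t : {rmorphism E -> E'})
    m x u (h : M) (W Z R : 'M[M]_m) : (forall c, t (f c) = g (s c)) ->
  t (\det (clear_form x u (f h) (map_mx f W) (map_mx f Z) (map_mx f R))) =
  \det (clear_form (t x) (t u) (g (s h)) (map_mx g (map_mx s W))
    (map_mx g (map_mx s Z)) (map_mx g (map_mx s R))).
Proof.
move=> tf; have e (B : 'M[M]_m) : map_mx t (map_mx f B) = map_mx g (map_mx s B).
  by apply/matrixP => i j; rewrite !mxE tf.
by rewrite -det_map_mx map_clear_form !e tf.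
Qed.

Lemma det_clear_form_map (M M' : comNzRingType) (s : {rmorphism M -> M'}) m (h : M)
    (W Z R : 'M[M]_m) :
  map_poly (map_poly s) (\det (clear_form 'X 'X%:P h%:P%:P (mx2 W) (mx2 Z) (mx2 R))) =
  \det (clear_form 'X 'X%:P (s h)%:P%:P (mx2 (map_mx s W)) (mx2 (map_mx s Z))
    (mx2 (map_mx s R))).
Proof.
pose f := (polyC \o polyC : {rmorphism M -> {poly {poly M}}}).
pose g := (polyC \o polyC : {rmorphism M' -> {poly {poly M'}}}).
pose t := (map_poly (map_poly s) : {rmorphism {poly {poly M}} -> {poly {poly M'}}}).
have tf c : t (f c) = g (s c) by rewrite /t /= !map_polyC /= map_polyC.
have tX : t 'X = 'X by rewrite /t /= map_polyX.
have tu : t 'X%:P = 'X%:P by rewrite /t /= map_polyC /= map_polyX.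
have := @det_clear_form_comp M M' _ _ f g s t m 'X 'X%:P h W Z R tf.
by rewrite tX tu => ->.
Qed.

Lemma diag_mulmxE (R : comNzRingType) m p (b : 'rV[R]_m) (K : 'M[R]_(m, p)) i j :
  (diag_mx b *m K) i j = b 0 i * K i j.
Proof. by rewrite mul_diag_mx mxE. Qed.

Lemma mulmx_diagE (R : comNzRingType) m p (b : 'rV[R]_m) (K : 'M[R]_(p, m)) i j :
  (K *m diag_mx b) i j = K i j * b 0 j.
Proof. by rewrite mul_mx_diag mxE. Qed.

Lemma det_curve_form_diag_map (M E : idomainType) (f : {rmorphism M -> E}) m
    (x u : E) (h : M) (a b : 'rV[M]_m) (K : 'M[M]_m) :
    (forall i, f (b 0 i) * (u - f (a 0 i) + f h) != 0) ->
  \det ((u%:M - map_mx f (diag_mx a)) *m (x%:M - map_mx f (K *m diag_mx b)^T)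
        - map_mx f (h *: (K *m diag_mx b)^T)) =
  \det (curve_form x u (f h) (map_mx f (diag_mx a)) (map_mx f (diag_mx b *m K))).
Proof.
move=> nz; rewrite map_mxZ -map_trmx !map_mxM !map_diag_mx.
by rewrite -det_curve_form_diag // => i; rewrite !mxE.
Qed.

Lemma det_curve_mx_diag (M : idomainType) m (h : M) (a b : 'rV[M]_m) (K : 'M[M]_m) :
    (forall i, b 0 i != 0) ->
  \det (('X%:P%:M - mx2 (diag_mx a)) *m ('X%:M - mx2 (K *m diag_mx b)^T)
        - mx2 (h *: (K *m diag_mx b)^T)) =
  \det (curve_mx h (diag_mx a) (diag_mx b *m K)).
Proof.
move=> b0; pose f := (polyC \o polyC : {rmorphism M -> {poly {poly M}}}).
have nz i : f (b 0 i) * ('X%:P - f (a 0 i) + f h) != 0; last first.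
  exact: (@det_curve_form_diag_map M _ f m 'X 'X%:P h a b K nz).
rewrite /f /= mulf_neq0 ?polyC_eq0 // -polyCB -polyCD polyC_eq0 -addrA -polyCN -polyCD.
by rewrite -size_poly_eq0 size_XaddC.
Qed.

Section Expand.
Variables (M : idomainType) (n : nat) (h : M) (z : 'I_n.+1 -> M).
Variables (Q : 'M[M]_n.+1) (c : 'cV[M]_n.+1).
Local Notation Z := (mulmat z).
Local Notation l := (topcoef M n).
Hypothesis QZ : Q *m Z = (Z - h%:M) *m Q + c *m l.
Local Notation mC := (map_mx polyC).
Local Notation chi := (char_poly Q).
Let zP i := (z i)%:P.

Lemma curve_mxE : curve_mx h Z Q = ('X%:M - mx2 Q) *m ('X%:P%:M - mx2 Z) - mx2 c *m mx2 l.
Proof.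
apply: curve_form_factor; rewrite -!map_mxM /= QZ raddfD /= !map_mxM /= raddfB /=.
by rewrite map_scalar_mx.
Qed.

(** The factors are v - Q and u - Z, with determinants chi and the product
    of the u - z_i; newton_row is topcoef times the adjugate of u - Z. *)
Lemma det_curve_mx :
  \det (curve_mx h Z Q) =
  map_poly polyC chi * (\prod_i ('X - (z i)%:P))%:P
  - \sum_(i < n.+1) (newton zP i 'X)%:P *
      map_poly polyC ((\adj (char_poly_mx Q) *m mC c) i 0).
Proof.
have eQ : 'X%:M - mx2 Q = map_mx (map_poly polyC) (char_poly_mx Q).
  rewrite /char_poly_mx raddfB /= map_scalar_mx /= map_polyX -map_mx_comp.
  by congr (_ - _); apply: eq_map_mx => x /=; rewrite map_polyC.
pose U := ('X%:M - mulmat zP : 'M[{poly M}]_n.+1).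
have eU : 'X%:P%:M - mx2 Z = mC U.
  rewrite raddfB /= map_scalar_mx map_mulmat; congr (_ - _).
  by rewrite map_mulmat.
have dQ : \det ('X%:M - mx2 Q) = map_poly polyC chi.
  by rewrite eQ det_map_mx.
have dU : \det ('X%:P%:M - mx2 Z) = (\prod_i ('X - (z i)%:P))%:P.
  by rewrite eU det_map_mx det_sub_mulmat.
pose J := map_mx (map_poly polyC) (\adj (char_poly_mx Q)) : 'M[{poly {poly M}}]_n.+1.
have JQ : J *m ('X%:M - mx2 Q) = (map_poly polyC chi)%:M.
  by rewrite eQ -map_mxM mul_adj_mx map_scalar_mx.
pose r := mC (newton_row zP 'X) : 'rV[{poly {poly M}}]_n.+1.
have rU : r *m ('X%:P%:M - mx2 Z) = (\prod_i ('X - (z i)%:P))%:P *: mx2 l.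
  rewrite eU -map_mxM newton_row_eigen map_mxZ; congr (_ *: _).
  by rewrite !map_topcoef.
have monU : (\prod_i ('X - (z i)%:P))%:P != 0 :> {poly {poly M}}.
  by rewrite polyC_eq0 monic_neq0 // monic_prod_XsubC.
have monQ : map_poly polyC chi != 0 :> {poly {poly M}}.
  by rewrite map_poly_eq0_id0 ?polyC_eq0 ?lead_coef_eq0 monic_neq0 ?char_poly_monic.
rewrite curve_mxE (det_mul_sub_rank1 _ dQ dU monQ monU JQ rU); congr (_ - _).
rewrite mxE; apply: eq_bigr => i _.
rewrite !mxE; congr (_ * _); rewrite rmorph_sum; apply: eq_bigr => j _.
by rewrite ![map_mx _ _ _ _]mxE [RHS]rmorphM /= map_polyC.
Qed.
End Expand.

(** * Reduction modulo the product of the u - z_a *)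

Section Reduce.
Variables (F : comNzRingType) (A : nzRingType) (iota : {rmorphism F -> A}).
Hypothesis iotaC : forall c x, iota c * x = x * iota c.
Variables (n : nat) (z : 'I_n.+1 -> F).
Local Notation N := n.+1.
Local Notation Z := (mulmat z).
Local Notation ZA := (map_mx iota Z).
Local Notation iotaP := (map_poly iota).

Implicit Types p q : {poly A}.

Definition powvec (i : nat) : 'cV[A]_N := map_mx iota (Z ^+ i *m e0 F n).
(** The remainder modulo the product of the u - z_a, in Newton coordinates:
    u^i is sent to Z^i e_0. *)
Definition redvec (p : {poly A}) : 'cV[A]_N := \sum_(i < size p) p`_i *: powvec i.

Lemma redvecE m p : (size p <= m)%N -> redvec p = \sum_(i < m) p`_i *: powvec i.
Proof.
move=> le_pm; rewrite /redvec (big_ord_widen m (fun i => p`_i *: powvec i)) //.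
rewrite big_mkcond; apply: eq_bigr => i _; case: ltnP => // sp.
by rewrite nth_default ?scale0r.
Qed.

Lemma redvecD p q : redvec (p + q) = redvec p + redvec q.
Proof.
pose m := maxn (size p) (size q).
rewrite (@redvecE m) ?size_polyD // (@redvecE m p) ?leq_maxl //.
rewrite (@redvecE m q) ?leq_maxr // -big_split; apply: eq_bigr => i _ /=.
by rewrite coefD scalerDl.
Qed.

Lemma redvecCM c p : redvec (c%:P * p) = c *: redvec p.
Proof.
rewrite (@redvecE (size p)) ?size_polyCM_leq // /redvec scaler_sumr.
by apply: eq_bigr => i _; rewrite coefCM scalerA.
Qed.

Lemma redvec0 : redvec 0 = 0.
Proof. by rewrite /redvec size_poly0 big_ord0. Qed.

Lemma redvecB p q : redvec (p - q) = redvec p - redvec q.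
Proof. by rewrite redvecD -mulN1r -polyCN redvecCM scaleN1r. Qed.

Lemma redvec_sum (I : Type) (r : seq I) (P : pred I) (G : I -> {poly A}) :
  redvec (\sum_(i <- r | P i) G i) = \sum_(i <- r | P i) redvec (G i).
Proof. exact: (big_morph _ redvecD redvec0). Qed.

Lemma map_iota_scale m1 m2 m3 (B : 'M[F]_(m1, m2)) (c : A) (v : 'M[A]_(m2, m3)) :
  map_mx iota B *m (c *: v) = c *: (map_mx iota B *m v).
Proof.
apply/matrixP => i j; rewrite !mxE mulr_sumr; apply: eq_bigr => l _.
by rewrite !mxE !mulrA iotaC.
Qed.

Lemma redvecMX p : redvec (p * 'X) = ZA *m redvec p.
Proof.
rewrite (@redvecE (size p).+1); last first.
  by rewrite (leq_trans (size_polyMleq _ _)) // size_polyX addn2.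
rewrite big_ord_recl coefMX eqxx scale0r add0r /redvec mulmx_sumr.
apply: eq_bigr => i _; rewrite map_iota_scale coefMX /=; congr (_ *: _).
by rewrite /powvec exprS -mulmxA map_mxM.
Qed.

Lemma redvecMXn p i : redvec (p * 'X^i) = map_mx iota (Z ^+ i) *m redvec p.
Proof.
elim: i => [|i IHi]; first by rewrite !expr0 mulr1 map_mx1 mul1mx.
rewrite exprSr mulrA redvecMX IHi mulmxA -map_mxM.
by rewrite exprS.
Qed.

Lemma redvecM_iota p c : redvec (p * (iota c)%:P) = iota c *: redvec p.
Proof.
rewrite -redvecCM; congr redvec.
by apply/polyP => i; rewrite coefMC coefCM iotaC.
Qed.

Lemma redvecM_root p c :
  redvec (p * ('X - (iota c)%:P)) = map_mx iota (Z - c%:M) *m redvec p.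
Proof.
rewrite mulrBr redvecB redvecMX redvecM_iota map_mxB mulmxBl map_scalar_mx.
by rewrite mul_scalar_mx.
Qed.

Lemma redvecM_shiftprod p h j :
  redvec (p * \prod_(0 <= i < j) ('X - (iota (h + z (inord i)))%:P)) =
  map_mx iota (shiftprod z h j) *m redvec p.
Proof.
elim: j => [|j IHj].
  by rewrite /shiftprod !big_geq // mulr1 map_mx1 mul1mx.
rewrite big_nat_recr //= mulrA redvecM_root IHj mulmxA -map_mxM.
by rewrite shiftprodS.
Qed.

Lemma iota_prodX h : iotaP (\prod_(a < N) ('X - h%:P - (z a)%:P)) =
  \prod_(0 <= i < N) ('X - (iota (h + z (inord i)))%:P).
Proof.
rewrite rmorph_prod big_mkord; apply: eq_bigr => i _.
by rewrite inord_val rmorphB rmorphB /= map_polyX !map_polyC rmorphD rmorphD /= opprD addrA.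
Qed.

Lemma redvecM_shift p h :
  redvec (iotaP (\prod_(a < N) ('X - h%:P - (z a)%:P)) * p) =
  map_mx iota (shiftprod z h N) *m redvec p.
Proof. by rewrite (map_poly_central iotaC) iota_prodX redvecM_shiftprod. Qed.

Lemma redvecM_mod p : redvec (p * iotaP (\prod_(a < N) ('X - (z a)%:P))) = 0.
Proof.
have -> : \prod_(a < N) ('X - (z a)%:P) = \prod_(a < N) ('X - 0%:P - (z a)%:P).
  by apply: eq_bigr => a _; rewrite polyC0 subr0.
rewrite iota_prodX redvecM_shiftprod /redvec mulmx_sumr big1 // => i _.
rewrite map_iota_scale /powvec -map_mxM mulmxA.
have -> : shiftprod z 0 N *m Z ^+ i = Z ^+ i *m shiftprod z 0 N.
  exact/commrX/commr_sym/mulmat_shiftprod.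
by rewrite -mulmxA shiftprod0N_e0 mulmx0 map_mx0 scaler0.
Qed.

Lemma redvec1 : redvec 1 = map_mx iota (e0 F n).
Proof.
rewrite /redvec size_poly1 big_ord1 coefC eqxx scale1r /powvec expr0.
by rewrite mul1mx.
Qed.

(** The polynomial p(u - h), with the coefficients of p on the left so
    that it can be reduced term by term. *)
Definition shiftp (h : F) (p : {poly A}) : {poly A} :=
  \sum_(i < size p) (p`_i)%:P * iotaP (('X - h%:P) ^+ i).

Lemma redvec_shiftp h p : (size p <= N)%N ->
  redvec (shiftp h p) = map_mx iota (shiftmat z h) *m redvec p.
Proof.
move=> sp; rewrite redvec_sum [in RHS]/redvec mulmx_sumr; apply: eq_bigr => i _.
rewrite redvecCM map_iota_scale; congr (_ *: _).
have le_in : (i <= n)%N by rewrite -ltnS (leq_trans (ltn_ord i)).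
rewrite /powvec -map_mxM shiftmat_mulmatX_e0 //.
elim: (nat_of_ord i) => [|j IHj]; first by rewrite !expr0 rmorph1 redvec1 mul1mx.
rewrite exprSr rmorphM rmorphB /= map_polyX map_polyC redvecM_root IHj.
by rewrite -map_mxM mulmxA exprS.
Qed.

Lemma topcoef_powvec i : (i <= n)%N -> powvec i ord_max 0 = (i == n)%:R.
Proof.
move=> le_in; have e : (topcoef F n *m (Z ^+ i *m e0 F n)) 0 0 =
    (Z ^+ i *m e0 F n) ord_max 0 by rewrite /topcoef -rowE mxE.
move: e; rewrite topcoef_mulmatX_e0 // [LHS]mxE eqxx mulr1n => e.
by rewrite /powvec [map_mx _ _ _ _]mxE -e rmorph_nat.
Qed.

Lemma topcoef_redvec p : (size p <= N)%N -> redvec p ord_max 0 = p`_n.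
Proof.
move=> sp; rewrite (redvecE sp) summxE (bigD1 ord_max) //= big1 ?addr0 => [|i im].
  by rewrite mxE topcoef_powvec // eqxx mulr1.
rewrite mxE topcoef_powvec -1?ltnS // -[n]/(nat_of_ord (@ord_max n)).
by rewrite val_eqE (negPf im) mulr0.
Qed.

Lemma sum_powvec i : (i <= n)%N ->
  \sum_(j < N) (powvec i j 0)%:P * iotaP (newton (fun a => (z a)%:P) j 'X) = 'X^i.
Proof.
move=> le_in; pose zP a := (z a)%:P.
have e : (newton_row zP 'X *m (mulmat zP ^+ i *m e0 {poly F} n)) 0 0 = 'X^i.
  by rewrite newton_row_mulmatX_e0 // mxE eqxx mulr1n.
have -> : 'X^i = iotaP 'X^i by rewrite map_polyXn.
rewrite -[in RHS]e mxE rmorph_sum; apply: eq_bigr => j _.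
rewrite rmorphM /= (map_poly_central iotaC) [newton_row _ _ _ _]mxE; congr (_ * _).
have -> : mulmat zP = map_mx polyC Z by rewrite map_mulmat.
rewrite -(map_e0 polyC) -rmorphXn -map_mxM.
rewrite /powvec ![map_mx _ _ _ _]mxE.
by rewrite [RHS]map_polyC.
Qed.

(** A polynomial of degree less than n is its own remainder, so it is
    recovered from its Newton coordinates. *)
Lemma redvecK p : (size p <= N)%N ->
  p = \sum_(j < N) (redvec p j 0)%:P * iotaP (newton (fun a => (z a)%:P) j 'X).
Proof.
move=> sp; rewrite (redvecE sp).
under eq_bigr => j _ do rewrite summxE rmorph_sum mulr_suml.
rewrite exchange_big /=.
have {1}-> : p = \sum_(i < N) (p`_i)%:P * 'X^i.
  apply/polyP => i; under eq_bigr do rewrite mul_polyC.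
  rewrite -(poly_def N (fun i => p`_i)) coef_poly; case: ltnP => // le_Ni.
  by rewrite nth_default // (leq_trans sp).
apply: eq_bigr => i _; rewrite -sum_powvec -1?ltnS // mulr_sumr.
by apply: eq_bigr => j _; rewrite [fun_of_matrix (_ *: _) j 0]mxE polyCM mulrA.
Qed.
End Reduce.

(** * The matrix Q *)

Section Eulerian.
Variables (F : comNzRingType) (A : nzRingType) (iota : {rmorphism F -> A}).

(** The difference d of two monic solutions satisfies the same equation and
    has degree m less than N; the coefficient of degree m gives (N - m) d_m = 0. *)
Lemma eulerian_poly (N : nat) (chi : {poly A}) :
    (forall (x : A) m, x *+ m.+1 = 0 -> x = 0) ->
    chi \is monic -> size chi = N.+1 ->
    chi *+ N = ('X - 1) * chi^`() -> chi = ('X - 1) ^+ N.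
Proof.
move=> nat_reg mon_chi sz e.
have [monX szX] : ('X - 1 : {poly A}) ^+ N \is monic /\
    size (('X - 1 : {poly A}) ^+ N) = N.+1.
  by rewrite -polyC1 size_exp_XsubC monic_exp ?monicXsubC.
have eX : (('X - 1) ^+ N) *+ N = ('X - 1) * (('X - 1) ^+ N)^`() :> {poly A}.
  have -> : ('X - 1 : {poly A}) ^+ N = map_poly iota (('X - 1) ^+ N).
    by rewrite rmorphXn rmorphB /= map_polyX rmorph1.
  have -> : ('X - 1 : {poly A}) = map_poly iota ('X - 1).
    by rewrite rmorphB /= map_polyX rmorph1.
  rewrite deriv_map -rmorphM -rmorphMn; congr (map_poly iota _).
  case: (N) => [|m]; first by rewrite mulr0n expr0 derivC mulr0.
  by rewrite -polyC1 deriv_exp derivB derivX derivC subr0 mul1r mulrnAr -exprS.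
apply/eqP; rewrite -subr_eq0; set d := _ - _; apply/eqP.
have ed : d *+ N = ('X - 1) * d^`() by rewrite derivB mulrBr -e -eX mulrnBl.
have szd : (size d <= N)%N.
  rewrite -ltnS; apply: (leq_trans _ (leqnn N.+1)).
  have lc : (chi - ('X - 1) ^+ N)`_N = 0.
    have := monicP mon_chi; have := monicP monX; rewrite !lead_coefE sz szX /=.
    by rewrite coefB => -> ->; rewrite subrr.
  rewrite ltnS; apply/leq_sizeP => j; rewrite leq_eqVlt => /orP[/eqP <-//|lt_Nj].
  by rewrite coefB !nth_default ?subrr ?szX ?sz.
clearbody d; apply/eqP; apply: contraT => d0.
have sd0 : (0 < size d)%N by rewrite lt0n size_poly_eq0.
pose m := (size d).-1; have mN : (m < N)%N by rewrite prednK.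
have /(congr1 (fun p : {poly A} => p`_m)) := ed.
rewrite coefMn mulrBl mul1r coefB coefXM !coef_deriv.
have dm1 : d`_m.+1 = 0 by rewrite nth_default // prednK.
rewrite dm1 mul0rn subr0 => e1.
have {}e1 : d`_m *+ (N - m) = 0.
  rewrite mulrnBr ?(ltnW mN) // e1; case: eqP => [->|/eqP m0].
    by rewrite mulr0n subr0.
  by rewrite prednK ?lt0n // subrr.
have : d`_m = 0 by apply: (nat_reg _ (N - m).-1); rewrite prednK // subn_gt0.
by move/eqP; rewrite /m -lead_coefE lead_coef_eq0 (negPf d0).
Qed.
End Eulerian.

(** Multiplication by q(u) = sum_i y_i u^i in the Newton basis. *)
Definition symbol_mx (R M : comNzRingType) (iM : {rmorphism R -> M}) n
    (z : 'I_n.+1 -> R) (y : 'I_n.+1 -> M) : 'M[M]_n.+1 :=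
  \sum_(i < n.+1) y i *: map_mx iM (mulmat z) ^+ i.

Section LaxMatrix.
Variables (F : fieldType) (M : idomainType) (n : nat) (iM : {rmorphism F -> M}).
Variables (h : F) (z : 'I_n.+1 -> F) (y : 'I_n.+1 -> M).
Local Notation N := n.+1.
Local Notation Z := (mulmat z).
Local Notation W := (shiftprod z h N).
Local Notation ZM := (map_mx iM Z).
Local Notation symbol_mx := (symbol_mx iM z y).

(** The matrix Q of the recursion s_{k+1} = (1 - Q) s_k, for q = S_1. *)
Definition laxmx : 'M[M]_N :=
  - (map_mx iM (invmx W) *m symbol_mx *m map_mx iM (shiftmat z h)).

Hypothesis W_unit : W \in unitmx.

Lemma symbol_mx_comm (B : 'M[F]_N) : comm_mx Z B ->
  comm_mx (map_mx iM B) symbol_mx.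
Proof.
move=> ZB; apply: comm_mx_sum => i _; rewrite /comm_mx -scalemxAr -scalemxAl.
congr (_ *: _); rewrite -rmorphXn -!map_mxM; congr (map_mx _ _).
exact/commrX/commr_sym.
Qed.

(** W and q(Z) commute with Z, so only the rank one defect of the
    substitution survives, and W cancels in it. *)
Lemma laxmx_intertwine :
  laxmx *m ZM = (ZM - (iM h)%:M) *m laxmx + symbol_mx *m e0 M n *m topcoef M n.
Proof.
have WZ : comm_mx W Z by exact/commr_sym/mulmat_shiftprod.
have iWZ : comm_mx (invmx W) (Z - h%:M).
  apply: comm_mxB; last exact: comm_mx_scalar.
  have := congr1 (fun B => invmx W *m B *m invmx W) WZ.
  by rewrite /comm_mx !mulmxA mulVmx // mul1mx -!mulmxA mulmxV // mulmx1 => ->.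
have qZ : comm_mx (map_mx iM (Z - h%:M)) symbol_mx.
  by apply: symbol_mx_comm; apply: comm_mxB; [exact: comm_mx_refl | exact: comm_mx_scalar].
have qW : comm_mx (map_mx iM W) symbol_mx.
  by apply: symbol_mx_comm; apply: comm_mx_sym.
rewrite /laxmx mulNmx mulmxN -[_ *m _ *m ZM]mulmxA -map_mxM shiftmat_mulmat.
rewrite raddfB /= mulmxBr opprB addrC -map_scalar_mx -raddfB; congr (- _ + _).
  rewrite map_mxM !mulmxA; congr (_ *m _).
  by rewrite /= -[LHS]mulmxA (esym qZ : symbol_mx *m _ = _) !mulmxA -!map_mxM iWZ.
rewrite !map_mxM map_e0 map_topcoef !mulmxA; congr (_ *m _ *m _).
by rewrite -[LHS]mulmxA (esym qW : symbol_mx *m _ = _) mulmxA -map_mxM mulVmx // map_mx1 mul1mx.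
Qed.
End LaxMatrix.

(** * The spectral curve *)

Section SpectralCurve.
Variables (F : fieldType) (A : nzRingType) (iota : {rmorphism F -> A}).
Hypothesis iotaC : forall c x, iota c * x = x * iota c.
Hypothesis charF : [pchar F] =i pred0.
Variables (n : nat) (h : F) (z : 'I_n.+1 -> F).
Local Notation N := n.+1.
Local Notation Z := (mulmat z).
Local Notation W := (shiftprod z h N).
Local Notation iotaP := (map_poly iota).
Local Notation red := (redvec iota z).
Hypothesis h0 : h != 0.
Hypothesis W_unit : W \in unitmx.

Variable S : nat -> {poly A}.
Hypothesis S0 : S 0 = iotaP (\prod_(a < N) ('X - (z a)%:P)).
Hypothesis S_top : S N.+1 = 0.
Hypothesis size_S : forall k, (size (S k) <= (N - k).+1)%N.
Hypothesis S1_lead : (S 1)`_n = iota (h * N%:R).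
Hypothesis S_fusion : forall k, (k <= N)%N -> exists q,
  iotaP (\prod_(a < N) ('X - h%:P - (z a)%:P)) * (S k.+1 - S k)
  - S 1 * shiftp iota h (S k) = q * iotaP (\prod_(a < N) ('X - (z a)%:P)).

Variables (M : idomainType) (iM : {rmorphism F -> M}) (phi : {rmorphism M -> A}).
Hypothesis phi_iM : forall c, phi (iM c) = iota c.
Variable y : 'I_N -> M.
Hypothesis phi_y : forall i, phi (y i) = (S 1)`_i.

Local Notation q := (symbol_mx iM z y).
Local Notation Q := (laxmx iM h z y).
Local Notation s k := (red (S k)).

Let map_phi_iM m1 m2 (B : 'M[F]_(m1, m2)) : map_mx phi (map_mx iM B) = map_mx iota B.
Proof. by apply/matrixP => i j; rewrite !mxE phi_iM. Qed.

Let phi_q : map_mx phi q = \sum_(i < N) (S 1)`_i *: map_mx iota (Z ^+ i).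
Proof.
rewrite /symbol_mx [LHS]raddf_sum; apply: eq_bigr => i _.
by rewrite /= map_mxZ phi_y -rmorphXn /= map_phi_iM.
Qed.

Let redvec_S1M p : red (S 1 * p) = map_mx phi q *m red p.
Proof.
have {1}-> : S 1 = \sum_(i < N) ((S 1)`_i)%:P * 'X^i.
  apply/polyP => i; under eq_bigr do rewrite mul_polyC.
  rewrite -(poly_def N (fun i => (S 1)`_i)) coef_poly; case: ltnP => // le_Ni.
  by rewrite nth_default // (leq_trans (size_S 1)) // subn1.
rewrite mulr_suml redvec_sum // phi_q mulmx_suml; apply: eq_bigr => i _.
by rewrite -mulrA -commr_polyXn redvecCM redvecMXn // -scalemxAl.
Qed.

Let s1E : s 1 = map_mx phi (q *m e0 M n).
Proof.
by rewrite -[S 1]mulr1 redvec_S1M redvec1 map_mxM -(map_e0 iM) map_phi_iM.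
Qed.

(** The fusion congruence in Newton coordinates.  It needs k > 0, because S_0 has
    degree N and is not its own remainder. *)
Let s_step k : (0 < k)%N -> (k <= N)%N -> s k.+1 = s k - map_mx phi Q *m s k.
Proof.
move=> k0 kN; have [r /(congr1 red)] := S_fusion kN.
rewrite redvecM_mod // redvecB redvecM_shift // redvec_S1M redvec_shiftp //; last first.
  by rewrite (leq_trans (size_S k)) // ltn_subrL k0.
move/eqP; rewrite subr_eq0 => /eqP e.
have WA : map_mx iota (invmx W) *m map_mx iota W = 1%:M.
  by rewrite -map_mxM mulVmx // map_mx1.
have -> : map_mx phi Q *m s k = - (s k.+1 - s k).
  rewrite -[s k.+1 - s k]mul1mx -WA -redvecB -mulmxA e /laxmx map_mxN !map_mxM /=.
  by rewrite !map_phi_iM mulNmx !mulmxA.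
by rewrite opprK addrC subrK.
Qed.
Local Notation w := ('X - 1 : {poly A}).
Local Notation phiP := (map_poly phi).
Local Notation mC := (map_mx polyC).
Local Notation chi := (char_poly Q).

Let g k : {poly A} := (-1) ^+ k * w ^+ (N - k).
Let fvec : 'cV[{poly A}]_N := \sum_(1 <= k < N.+1) g k *: mC (s k).

Let w_iota : w = iotaP ('X - 1).
Proof. by rewrite rmorphB /= map_polyX rmorph1. Qed.

Let wX_central m (x : {poly A}) : w ^+ m * x = x * w ^+ m.
Proof. by rewrite w_iota -rmorphXn (map_poly_central iotaC). Qed.

Let g_central k (x : {poly A}) : g k * x = x * g k.
Proof. by rewrite /g -mulrA wX_central !mulrA -(commr_sign x). Qed.

Let central_scale m1 m2 (c : {poly A}) (B : 'M[{poly A}]_(m1, m2)) (x : 'cV_m2) :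
  (forall a, c * a = a * c) -> B *m (c *: x) = c *: (B *m x).
Proof.
move=> cC; apply/colP => i; rewrite !mxE mulr_sumr; apply: eq_bigr => j _.
by rewrite mxE !mulrA cC.
Qed.

Let monw m : w ^+ m \is monic.
Proof. by rewrite monic_exp // -polyC1 monicXsubC. Qed.

Let phiP_C m1 m2 (B : 'M[M]_(m1, m2)) : map_mx phiP (mC B) = mC (map_mx phi B).
Proof. by apply/matrixP => i j; rewrite !mxE /= map_polyC. Qed.

(** (v - Q) s_k = w s_k + s_{k+1}, so the alternating sum telescopes. *)
Let pencil_f : map_mx phiP (char_poly_mx Q) *m fvec = - (w ^+ N *: mC (s 1)).
Proof.
have step k : (0 < k)%N -> (k <= N)%N ->
    map_mx phiP (char_poly_mx Q) *m mC (s k) = w *: mC (s k) + mC (s k.+1).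
  move=> k0 kN; rewrite s_step // /char_poly_mx map_mxB map_scalar_mx /= map_polyX.
  rewrite phiP_C mulmxBl -map_mxM mul_scalar_mx map_mxB scalerBl scale1r.
  by rewrite addrA subrK.
pose G k := (-1) ^+ k *: (w ^+ (N.+1 - k) *: mC (s k)).
transitivity (\sum_(1 <= k < N.+1) (G k - G k.+1)).
  rewrite /fvec mulmx_sumr; apply: eq_big_nat => k /andP[k0 kN].
  rewrite (central_scale _ _ (g_central k)) step // scalerDr /G !scalerA subSS exprS mulN1r.
  by rewrite mulNr scaleNr opprK subSn // exprSr mulrA.
under eq_bigr => k _ do rewrite -[G k]opprK addrC.
rewrite (telescope_sumr (fun k => - G k)) // opprK /G S_top redvec0 map_mx0.
by rewrite !scaler0 oppr0 add0r subn1 expr1 scaleN1r.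
Qed.
Let adj_f : phiP chi *: fvec =
  - (w ^+ N *: map_mx phiP (\adj (char_poly_mx Q) *m mC (q *m e0 M n))).
Proof.
have e : map_mx phiP (\adj (char_poly_mx Q)) *m map_mx phiP (char_poly_mx Q) =
    (phiP chi)%:M by rewrite -map_mxM mul_adj_mx map_scalar_mx.
rewrite -mul_scalar_mx -e -mulmxA pencil_f mulmxN central_scale; last exact: wX_central.
by rewrite s1E -phiP_C -map_mxM.
Qed.

(** Among the S_k with k > 0 only S_1 has degree N - 1. *)
Let f_top : fvec ord_max 0 = - (w ^+ n * (iota (h * N%:R))%:P).
Proof.
rewrite /fvec summxE big_ltn // big_nat big1 => [|k /andP[k1 kN]].
  rewrite addr0 mxE /g expr1 mulN1r subn1 mulNr; congr (- (_ * _)).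
  by rewrite mxE topcoef_redvec ?S1_lead // (leq_trans (size_S 1)) // subn1.
rewrite mxE [mC _ _ _]mxE topcoef_redvec; last first.
  by rewrite (leq_trans (size_S k)) // ltn_subrL (ltn_trans _ k1).
rewrite nth_default ?polyC0 ?mulr0 // (leq_trans (size_S k)) //.
by move: k1 kN; lia.
Qed.

Let QZ := laxmx_intertwine iM y W_unit.

Let charA (x : A) m : x *+ m.+1 = 0 -> x = 0.
Proof.
move=> e; have m0 : m.+1%:R != 0 :> F by rewrite (proj1 (pcharf0P F) charF).
rewrite -[x]mul1r -(rmorph1 iota) -(mulVf m0) rmorphM rmorph_nat -mulrA.
by rewrite mulr_natl e mulr0.
Qed.

(** Compare the last coordinates in adj_f: on the left the leading coefficient
    h N of S_1, on the right row_adj_col. *)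
Let phi_chi_ode : phiP chi *+ N = w * (phiP chi)^`().
Proof.
have := congr1 (fun B : 'cV[{poly A}]_N => B ord_max 0) adj_f.
rewrite mxE f_top [RHS]mxE [in RHS]mxE [(map_mx phiP _) _ _]mxE.
have -> : (\adj (char_poly_mx Q) *m mC (q *m e0 M n)) ord_max 0 =
    (iM h)%:P * ('X * chi^`() - N%:R * chi).
  rewrite -(row_adj_col QZ) -mulmxA map_topcoef /topcoef -rowE.
  by rewrite [RHS]mxE.
have C_comm x : (iota h)%:P * x = x * (iota h)%:P :> {poly A}.
  by apply/polyP => j; rewrite coefMC coefCM iotaC.
have C_reg : GRing.lreg ((iota h)%:P : {poly A}).
  rewrite -[_%:P](map_polyC iota) /=; apply: lreg_iotaP.
  by rewrite polyC_eq0.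
have -> : (iota (h * N%:R))%:P = (iota h)%:P * N%:R.
  by rewrite rmorphM rmorph_nat polyCM [N%:R%:P]rmorph_nat.
have -> : phiP ((iM h)%:P * ('X * chi^`() - N%:R * chi)) =
    (iota h)%:P * ('X * (phiP chi)^`() - N%:R * phiP chi).
  rewrite rmorphM rmorphB !rmorphM rmorph_nat deriv_map /= map_polyC map_polyX /=.
  by rewrite phi_iM.
rewrite mulrN => /oppr_inj; rewrite [phiP chi * _]mulrA -wX_central -mulrA exprSr -mulrA => e.
have {}e := monic_lreg (monw n) e.
have {}e : phiP chi * N%:R = w * ('X * (phiP chi)^`() - N%:R * phiP chi).
  apply: C_reg; rewrite [LHS]mulrA C_comm -[LHS]mulrA e [RHS]mulrA [in RHS]C_comm.
  by rewrite -[RHS]mulrA.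
apply: (monic_lreg (monicX A)) => /=.
have Xw (a : {poly A}) : 'X * a = w * a + a by rewrite mulrBl mul1r subrK.
rewrite -mulr_natr Xw {2}e mulrBr mulr_natl mulr_natr addrC subrK.
by rewrite !mulrA; congr (_ * _); rewrite mulrBl mulrBr mul1r mulr1.
Qed.

Lemma phi_char_poly : phiP chi = w ^+ N.
Proof.
have mon : phiP chi \is monic by rewrite monic_map ?char_poly_monic.
apply: (eulerian_poly iota charA mon _ phi_chi_ode).
rewrite size_map_poly_id0 ?size_char_poly //.
by rewrite (monicP (char_poly_monic _)) rmorph1 oner_neq0.
Qed.

Let fvecE i : fvec i 0 = - phiP ((\adj (char_poly_mx Q) *m mC (q *m e0 M n)) i 0).
Proof.
have := congr1 (fun B : 'cV[{poly A}]_N => B i 0) adj_f.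
rewrite mxE phi_char_poly [RHS]mxE [in RHS]mxE [(map_mx phiP _) _ _]mxE -mulrN.
exact: (monic_lreg (monw N)).
Qed.

Local Notation phi2 := (map_poly phiP).

(** Both sides are w^N S_0 plus the Newton expansion of f = - adj (v - Q) s_1. *)
Theorem spectral_curve :
  \sum_(k < N.+1) (-1) ^+ k * ((S k)%:P * ('X - 1) ^+ (N - k)) =
  phi2 (\det (curve_mx (iM h) (map_mx iM Z) Q)).
Proof.
rewrite map_mulmat (det_curve_mx (c := q *m e0 M n)); last first.
  by rewrite -map_mulmat QZ.
have phi2C p : phi2 (map_poly polyC p) = map_poly polyC (phiP p).
  by rewrite -!map_poly_comp; apply: eq_map_poly => a /=; rewrite map_polyC.
rewrite rmorphB rmorphM [X in _ = _ - X]rmorph_sum /= phi2C phi_char_poly map_polyC /=.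
have -> : phiP (\prod_(i < N) ('X - (iM (z i))%:P)) = S 0.
  rewrite S0 !rmorph_prod; apply: eq_bigr => i _.
  by rewrite !rmorphB /= !map_polyX !map_polyC /= phi_iM.
have -> : map_poly polyC (w ^+ N) = ('X - 1) ^+ N.
  by rewrite rmorphXn rmorphB /= map_polyX rmorph1.
rewrite big_ord_recl expr0 mul1r subn0 /=; congr (_ + _).
  apply: commrX; apply: commrB; [exact: commr_polyX | exact: commr1].
have fE (i : 'I_N) : map_poly polyC (fvec i 0) =
    \sum_(k < N) (-1) ^+ k.+1 * (('X - 1) ^+ (N - k.+1) * ((s k.+1 i 0)%:P)%:P).
  rewrite /fvec big_add1 /= big_mkord summxE rmorph_sum; apply: eq_bigr => k _.
  rewrite mxE /g -mulrA !rmorphM rmorph_sign !rmorphXn rmorphB /= map_polyX rmorph1.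
  by rewrite mxE map_polyC.
transitivity (\sum_(i < N) (iotaP (newton (fun a => (z a)%:P) i 'X))%:P *
    map_poly polyC (fvec i 0)).
  under [RHS]eq_bigr => i _ do rewrite fE mulr_sumr.
  rewrite exchange_big /=; apply: eq_bigr => k _.
  rewrite /bump leq0n add1n {1}(redvecK iotaC z (p := S k.+1)); last first.
    by rewrite (leq_trans (size_S _)) // subSS ltnS leq_subr.
  rewrite rmorph_sum mulr_suml mulr_sumr; apply: eq_bigr => i _.
  have EC x : (iotaP (newton (fun a => (z a)%:P) i 'X))%:P * x =
      x * (iotaP (newton (fun a => (z a)%:P) i 'X))%:P :> {poly {poly A}}.
    by apply/polyP => j; rewrite coefCM coefMC (map_poly_central iotaC).
  have WC x : ('X - 1) ^+ (N - k.+1) * x = x * ('X - 1) ^+ (N - k.+1) :> {poly {poly A}}.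
    apply/esym/commrX; apply: commrB; [exact: commr_polyX | exact: commr1].
  by rewrite /= polyCM [RHS]EC [in RHS]WC -[RHS]mulrA; congr (_ * _);
    rewrite -mulrA EC mulrA.
rewrite -sumrN; apply: eq_bigr => i _; rewrite fvecE rmorphM /= map_polyC phi2C.
rewrite rmorphN mulrN; congr (- (_%:P * _)).
rewrite /= /newton !rmorph_prod; apply: eq_bigr => j _.
by rewrite !rmorphB /= !map_polyX !map_polyC /= phi_iM.
Qed.
End SpectralCurve.

(** * The curve at distinct points *)

Lemma conj_intertwine (M : comUnitRingType) m (h : M) (V Z D Q : 'M[M]_m)
    (c : 'cV[M]_m) (l : 'rV[M]_m) :
    V \in unitmx -> V *m Z = D *m V -> Q *m Z = (Z - h%:M) *m Q + c *m l ->
  V *m Q *m invmx V *m D = (D - h%:M) *m (V *m Q *m invmx V) +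
    V *m c *m (l *m invmx V).
Proof.
move=> uV VZ QZ; have VDi : Z *m invmx V = invmx V *m D.
  rewrite -[LHS]mul1mx -(mulVmx uV) -!mulmxA (mulmxA V) VZ.
  by rewrite -mulmxA mulmxV // mulmx1.
have := congr1 (fun B => V *m B *m invmx V) QZ.
rewrite mulmxDr mulmxDl -!mulmxA VDi !mulmxA => ->.
by rewrite mulmxBr VZ scalar_mxC -mulmxBl -!mulmxA.
Qed.

Section Cauchy.
Variables (K : fieldType) (n : nat) (h : K) (z : 'I_n.+1 -> K).
Local Notation N := n.+1.
Local Notation M := {mpoly K[N]}.
Hypothesis z_inj : forall a b, a != b -> z a != z b.
Hypothesis z_h : forall a b, z b - z a + h != 0.
Local Notation Z := (mulmat z).
Local Notation W := (shiftprod z h N).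
Hypothesis W_unit : W \in unitmx.

Definition evalmx : 'M[K]_N := \matrix_(a, j) newton z j (z a).

Lemma evalmx_unit : evalmx \in unitmx.
Proof.
rewrite unitmxE det_trig.
  rewrite unitfE; apply/prodf_neq0 => a _; rewrite mxE /newton.
  rewrite big_mkord; apply/prodf_neq0 => i _; rewrite subr_eq0.
  apply: z_inj; rewrite -val_eqE /= inordK ?gtn_eqF //.
  exact: ltn_trans (ltn_ord i) (ltn_ord a).
apply/is_trig_mxP => a j aj; rewrite mxE /newton big_mkord.
by rewrite (bigD1 (Ordinal aj)) //= inord_val subrr mul0r.
Qed.

Lemma evalmx_mulmat : evalmx *m Z = diag_mx (\row_a z a) *m evalmx.
Proof.
apply/row_matrixP => a; rewrite !row_mul row_diag_mx mxE -scalemxAl -rowE.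
have -> : row a evalmx = newton_row z (z a) by apply/rowP => j; rewrite !mxE.
have := newton_row_eigen z (z a); rewrite (bigD1 a) //= subrr mul0r scale0r.
by rewrite mulmxBr mul_mx_scalar => /eqP; rewrite subr_eq0 => /eqP <-.
Qed.

Lemma evalmx_e0 a : (evalmx *m e0 K n) a 0 = 1.
Proof.
by rewrite /e0 -colE !mxE /newton big_geq.
Qed.

Let d a : K := (topcoef K n *m invmx evalmx) 0 a.

(** Lagrange interpolation: the leading coefficient of the polynomial that is
    1 at z_a and 0 at the other points. *)
Lemma topcoef_evalmx a : d a * \prod_(b | b != a) (z a - z b) = 1.
Proof.
pose zP b := (z b)%:P; pose mC := (map_mx polyC : 'M[K]_N -> 'M[{poly K}]_N).
pose r := newton_row zP 'X *m mC (invmx evalmx).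
have ZV : Z *m invmx evalmx = invmx evalmx *m diag_mx (\row_b z b).
  rewrite -[LHS]mul1mx -(mulVmx evalmx_unit) -!mulmxA (mulmxA evalmx) evalmx_mulmat.
  by rewrite -mulmxA mulmxV ?evalmx_unit // mulmx1.
have rE : r *m ('X%:M - mC (diag_mx (\row_b z b))) =
    (\prod_b ('X - (z b)%:P)) *: map_mx polyC (topcoef K n *m invmx evalmx).
  rewrite /r -mulmxA mulmxBr -map_mxM -ZV map_mxM scalar_mxC -mulmxBl mulmxA.
  by rewrite (map_mulmat polyC) newton_row_eigen -scalemxAl map_mxM map_topcoef.
have ra : r 0 a * ('X - (z a)%:P) = \prod_b ('X - (z b)%:P) * (d a)%:P.
  have := congr1 (fun B : 'rV_N => B 0 a) rE.
  rewrite /mC map_diag_mx -diag_const_mx -linearB mul_mx_diag !mxE => ->.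
  by rewrite /d mxE.
have {}ra : r 0 a = (d a)%:P * \prod_(b | b != a) ('X - (z b)%:P).
  apply: (@mulIf _ ('X - (z a)%:P)); first by rewrite polyXsubC_eq0.
  by rewrite ra (bigD1 a) //=; ring.
have r1 : (r 0 a).[z a] = 1.
  transitivity ((evalmx *m invmx evalmx) a a); last first.
    by rewrite mulmxV ?evalmx_unit // mxE eqxx.
  rewrite /r !mxE horner_sum; apply: eq_bigr => j _; rewrite hornerM !mxE hornerC.
  congr (_ * _); rewrite /newton horner_prod; apply: eq_bigr => i _.
  by rewrite !hornerE.
rewrite -[RHS]r1 ra hornerM hornerC horner_prod; congr (_ * _).
by apply: eq_bigr => b _; rewrite !hornerE.
Qed.

Lemma topcoef_evalmxE a : d a = \prod_(b | b != a) (z a - z b)^-1.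
Proof.
have e : \prod_(b | b != a) (z a - z b) != 0.
  by apply/prodf_neq0 => b ba; rewrite subr_eq0 z_inj // eq_sym.
by apply: (mulIf e); rewrite topcoef_evalmx prodfV mulVf.
Qed.

Local Notation toM := (@mpolyC N K).
Local Notation Vm := (map_mx toM evalmx).
Local Notation Q := (laxmx toM h z (fun i : 'I_N => 'X_i : M)).
Local Notation q := (symbol_mx toM z (fun i : 'I_N => 'X_i : M)).
Let D := diag_mx (\row_a (z a)%:MP) : 'M[M]_N.

Let map_ZV : Vm *m map_mx toM Z = D *m Vm.
Proof.
rewrite -map_mxM evalmx_mulmat map_mxM map_diag_mx; congr (diag_mx _ *m _).
by apply/rowP => a; rewrite !mxE.
Qed.

Lemma evalmx_symbol a : (Vm *m (q *m e0 M n)) a 0 = qval N (z a).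
Proof.
have VZi i : Vm *m map_mx toM Z ^+ i = D ^+ i *m Vm.
  elim: i => [|i IHi]; first by rewrite !expr0 mulmx1 mul1mx.
  by rewrite !exprS -[_ * _ ^+ i]/(_ *m _) mulmxA map_ZV -mulmxA IHi mulmxA.
rewrite mulmxA /symbol_mx mulmx_sumr mulmx_suml summxE; apply: eq_bigr => i _.
rewrite -scalemxAr -scalemxAl VZi -mulmxA -(map_e0 toM) -map_mxM.
have -> : D ^+ i = diag_mx (\row_b ((z b) ^+ i)%:MP).
  elim: (nat_of_ord i) => [|j IHj].
    by apply/matrixP => b c; rewrite !mxE expr0 mpolyC1.
  rewrite exprS IHj -[_ * _]/(_ *m _) mul_diag_mx; apply/matrixP => b c.
  by rewrite !mxE mulrnAr -mpolyCM exprS.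
rewrite mxE mul_diag_mx mxE [fun_of_matrix (map_mx _ _) a 0]mxE evalmx_e0.
by rewrite mxE rmorph1 mulr1 mulrC mul_mpolyC.
Qed.

Let bq := \row_a qval N (z a) : 'rV[M]_N.
Let Kq := \matrix_(a, b) ((z b - z a + h)^-1 * d b)%:MP : 'M[M]_N.
Let Q0 : 'M[M]_N := diag_mx bq *m Kq.

Let Q0E a b : Q0 a b = ((z b - z a + h)^-1 * d b) *: qval N (z a).
Proof. by rewrite diag_mulmxE !mxE mulrC mul_mpolyC. Qed.

(** Conjugated to the points, the intertwining relation becomes
    (z_b - z_a + h) Q_{ab} = q(z_a) d_b, which determines Q. *)
Lemma laxmx_evalmx : Vm *m Q = Q0 *m Vm.
Proof.
have uV : Vm \in unitmx by rewrite unitmxE det_map_mx rmorph_unit // -unitmxE evalmx_unit.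
pose X := Vm *m Q *m invmx Vm.
suff -> : Q0 = X by rewrite /X mulmxKV.
have := conj_intertwine uV map_ZV
  (laxmx_intertwine toM (fun i : 'I_N => 'X_i : M) W_unit).
rewrite -/X; clearbody X => XD; apply/matrixP => a b; rewrite Q0E.
have lV : (topcoef M n *m invmx Vm) ord0 b = (d b)%:MP.
  have -> : invmx Vm = map_mx toM (invmx evalmx).
    rewrite -[RHS]mul1mx -(mulVmx uV) -mulmxA -map_mxM mulmxV ?evalmx_unit //.
    by rewrite map_mx1 mulmx1.
  by rewrite -(map_topcoef toM) -map_mxM mxE.
have := congr1 (fun B : 'M_N => B a b) XD.
rewrite mul_mx_diag mxE [in RHS]mxE [X in _ = _ + X]mxE big_ord1 evalmx_symbol.
rewrite mulmxBl mul_diag_mx mul_scalar_mx [X in _ = X + _]mxE lV.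
rewrite [fun_of_matrix (- _) a b]mxE [fun_of_matrix (_ *: _) a b]mxE.
rewrite [fun_of_matrix (\matrix_(_, _) _) a b]mxE !mxE => e.
have {}e : (z b - z a + h) *: X a b = d b *: qval N (z a).
  rewrite scalerDl scalerBl -!mul_mpolyC [_ * X a b]mulrC [in LHS]e.
  by rewrite [(z a)%:MP * _]mulrC; ring.
by rewrite -scalerA -e scalerA mulVf ?scale1r.
Qed.

(** In the coordinates of the points Q is diag (q(z_a)) K for a Cauchy type
    matrix K, while the matrix of the curve is the transpose of K diag (q(z_a)). *)
Theorem Pdet_laxmx :
  Pdet h z = \det (curve_mx h%:MP (map_mx toM Z) Q).
Proof.
have V0 : \det Vm != 0.
  by rewrite det_map_mx /= mpolyC_eq0 -unitfE -unitmxE evalmx_unit.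
rewrite (det_curve_mx_conj _ V0 map_ZV laxmx_evalmx).
rewrite -det_curve_mx_diag => [|a]; last first.
  rewrite mxE; apply/eqP => /(congr1 (mcoeff U_(0))).
  rewrite mcoeff0 /qval raddf_sum (bigD1 0) //= big1 => [|i i0].
    by rewrite addr0 mcoeffZ mcoeffX eqxx expr0 mulr1 => /eqP; rewrite oner_eq0.
  rewrite mcoeffZ mcoeffX; case: eqP => [e|]; last by rewrite mulr0.
  by move/eqP: e; rewrite eq_mnm1 (negPf i0).
have -> : (Kq *m diag_mx bq)^T = Qmx h z.
  apply/matrixP => a b; rewrite mxE mulmx_diagE !mxE topcoef_evalmxE.
  by rewrite mul_mpolyC -scalerA.
by [].
Qed.
End Cauchy.

(** * The curve at arbitrary points *)

Lemma map_symbol_mx (R R' M M' : comNzRingType) (iM : {rmorphism R -> M})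
    (iM' : {rmorphism R' -> M'}) (f : {rmorphism R -> R'}) (g : {rmorphism M -> M'})
    n (z : 'I_n.+1 -> R) z' y y' :
    (forall c, g (iM c) = iM' (f c)) -> (forall i, f (z i) = z' i) ->
    (forall i, g (y i) = y' i) ->
  map_mx g (symbol_mx iM z y) = symbol_mx iM' z' y'.
Proof.
move=> gi fz gy; rewrite /symbol_mx (raddf_sum (map_mx g)); apply: eq_bigr => i _.
rewrite /= map_mxZ gy (rmorphXn (map_mx g)) /=; congr (_ *: _ ^+ _).
by apply/matrixP => a b; rewrite !mxE gi; case: ifP => _; rewrite ?fz ?rmorph_nat.
Qed.

(** The curve matrix multiplied by W: its entries are polynomial in h, z and y,
    hence natural in the coefficient ring. *)
Definition clear_mx (k M : comNzRingType) (iM : {rmorphism k -> M}) n (h : k)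
    (z : 'I_n.+1 -> k) (y : 'I_n.+1 -> M) : 'M[{poly {poly M}}]_n.+1 :=
  clear_form 'X 'X%:P (iM h)%:P%:P (mx2 (map_mx iM (shiftprod z h n.+1)))
    (mx2 (map_mx iM (mulmat z))) (mx2 (symbol_mx iM z y *m map_mx iM (shiftmat z h))).

Lemma det_clear_mx (K : fieldType) (M : idomainType) (iM : {rmorphism K -> M}) n
    (h : K) (z : 'I_n.+1 -> K) (y : 'I_n.+1 -> M) : shiftprod z h n.+1 \in unitmx ->
  \det (clear_mx iM h z y) = (iM (\det (shiftprod z h n.+1)))%:P%:P *
    \det (curve_mx (iM h) (map_mx iM (mulmat z)) (laxmx iM h z y)).
Proof.
move=> uW; rewrite -det_map_mx; apply/esym/det_curve_mx_clear.
  by rewrite -!map_mxM; congr map_mx; exact/commr_sym/mulmat_shiftprod.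
by rewrite /laxmx mulmxN !mulmxA -map_mxM mulmxV // map_mx1 mul1mx.
Qed.

Lemma det_clear_mx_map (k k' M M' : comNzRingType) (iM : {rmorphism k -> M})
    (iM' : {rmorphism k' -> M'}) (f : {rmorphism k -> k'}) (g : {rmorphism M -> M'}) n h
    (z : 'I_n.+1 -> k) y y' :
    (forall c, g (iM c) = iM' (f c)) -> (forall i, g (y i) = y' i) ->
  map_poly (map_poly g) (\det (clear_mx iM h z y)) =
  \det (clear_mx iM' (f h) (fun a => f (z a)) y').
Proof.
move=> gi gy; rewrite /clear_mx det_clear_form_map /= gi.
have toM m1 m2 (B : 'M[k]_(m1, m2)) : map_mx g (map_mx iM B) = map_mx iM' (map_mx f B).
  by apply/matrixP => i j; rewrite !mxE /= gi.
rewrite (map_mxM g) !toM map_shiftprod map_mulmat map_shiftmat.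
by rewrite (map_symbol_mx (z' := fun a => f (z a)) gi _ gy).
Qed.

Section Regular.
Variables (F : fieldType) (n : nat) (hbar : F) (z : 'I_n.+1 -> F).
Local Notation N := n.+1.
Local Notation ratfun := {fraction {mpoly F[N]}}.
Local Notation "x %:F" := (FracField.tofrac x).
Hypothesis z_h : forall a b, z a - z b != hbar.

Let zX (a : 'I_N) : {mpoly F[N]} := 'X_a.
Let hX : {mpoly F[N]} := hbar%:MP.
Let toF := @FracField.tofrac {mpoly F[N]}.

Let WX : {mpoly F[N]} := \det (shiftprod zX hX N).

Let fW (K : fieldType) (f : {rmorphism {mpoly F[N]} -> K}) :
  \det (shiftprod (fun a => f (zX a)) (f hX) N) = f WX.
Proof. by rewrite /WX -det_map_mx map_shiftprod. Qed.

Let zXz : (fun a => (zX a).@[z]) = z.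
Proof. by apply: boolp.funext => a; exact: mevalXU. Qed.

Let hXz : hX.@[z] = hbar. Proof. exact: mevalC. Qed.

Let WXz_neq0 : WX.@[z] != 0.
Proof.
rewrite -(fW (meval z)) /= zXz hXz.
rewrite det_shiftprod; apply/prodf_neq0 => i _; apply/prodf_neq0 => j _.
by rewrite opprD addrA addrAC subr_eq0 z_h.
Qed.

Let WX_neq0 : WX != 0.
Proof. by apply: contraNneq WXz_neq0 => e; rewrite e raddf0. Qed.

Let coef3C (K : comNzRingType) (c : K) (P : {poly {poly {mpoly K[N]}}}) i j m :
  ((c%:MP%:P%:P * P)`_i`_j)@_m = c * (P`_i`_j)@_m.
Proof. by rewrite !coefCM mcoeffCM. Qed.

Definition spectral_poly (K : fieldType) (h : K) (x : 'I_N -> K) : {poly {poly {mpoly K[N]}}} :=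
  \det (curve_mx (h%:MP : {mpoly K[N]}) (map_mx (@mpolyC N K) (mulmat x))
    (laxmx (@mpolyC N K) h x (fun i => 'X_i))).

(** The common numerator, with indeterminates for the z_a. *)
Let PX := \det (clear_mx (@mpolyC N {mpoly F[N]}) hX zX (fun i => 'X_i)).

(** For f the embedding into the rational functions, and for f the evaluation
    at z: the numerator is det W times the curve. *)
Let curve_coef (K : fieldType) (f : {rmorphism {mpoly F[N]} -> K}) i j m : f WX != 0 ->
  f ((PX`_i`_j)@_m) = f WX * ((spectral_poly (f hX) (fun a => f (zX a)))`_i`_j)@_m.
Proof.
move=> fW0.
have W_unit : shiftprod (fun a => f (zX a)) (f hX) N \in unitmx.
  by rewrite unitmxE unitfE fW.
rewrite -[f WX]fW -coef3C /spectral_poly.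
have e := @det_clear_mx _ _ (@mpolyC N K) n (f hX) _ (fun i => 'X_i) W_unit.
have gC (c : {mpoly F[N]}) : map_mpoly f c%:MP_[N] = (f c)%:MP_[N].
  by rewrite map_mpolyC.
have gX (i0 : 'I_N) : map_mpoly f 'X_i0 = 'X_i0 by rewrite map_mpolyX.
have e' := @det_clear_mx_map _ _ _ _ (@mpolyC N {mpoly F[N]}) (@mpolyC N K) f
  (map_mpoly f) n hX zX _ _ gC gX.
move: (etrans e' e) => /(congr1 (fun P : {poly {poly {mpoly K[N]}}} => (P`_i`_j)@_m)) <-.
by rewrite !coef_map /= mcoeff_map_mpoly.
Qed.

Lemma generic_Pdet_spectral : generic_Pdet N hbar = spectral_poly (toF hX) (fun a => toF (zX a)).
Proof.
have fz (f : {mpoly F[N]}) : f.@[z] != 0 -> toF f != 0.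
  by rewrite tofrac_eq0; apply: contraNneq => ->; rewrite raddf0.
apply: Pdet_laxmx => [a b ab|a b|].
- rewrite tofrac_eq; apply: contraNneq ab => /(congr1 (mcoeff U_(a))).
  rewrite !mcoeffX eqxx eq_mnm1 [b == a]eq_sym; case: eqP => // _ /esym/eqP.
  by rewrite eq_sym oner_eq0.
- rewrite -rmorphB -rmorphD; apply: fz; rewrite raddfD raddfB /= !mevalXU hXz.
  by rewrite addrC -opprB subr_eq0 eq_sym z_h.
- by rewrite unitmxE unitfE (fW toF) tofrac_eq0.
Qed.

(** The denominator det W, a product of the z_a - z_b - h, does not vanish
    at z. *)
Lemma ratfun_eval_Pdet i j m :
  ratfun_eval z (((generic_Pdet N hbar)`_i`_j)@_m) = ((spectral_poly hbar z)`_i`_j)@_m.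
Proof.
apply: ratfun_evalE; exists ((PX`_i`_j)@_m), WX; split=> //.
  rewrite (curve_coef _ _ _ (f := toF)) ?tofrac_eq0 // -generic_Pdet_spectral.
  by rewrite mulrAC mulfV ?mul1r // tofrac_eq0.
rewrite -[X in X / _]/(meval z _) curve_coef //= zXz hXz mulrAC.
by rewrite mulfV ?mul1r.
Qed.
End Regular.

(** * Evaluation at commuting elements *)

Section CommutingEvaluation.
Variables (F : comNzRingType) (A : nzRingType) (n : nat).
Variables (iota : {rmorphism F -> A}) (y : 'I_n -> A).
Hypothesis iotaC : forall c x, iota c * x = x * iota c.
Hypothesis yC : forall i j, y i * y j = y j * y i.

Lemma mmap1D m1 m2 : mmap1 y (m1 + m2) = mmap1 y m1 * mmap1 y m2.
Proof.
have yXC i j a b : GRing.comm (y i ^+ a) (y j ^+ b).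
  exact/commrX/commr_sym/commrX/commr_sym/yC.
rewrite /mmap1; elim: (index_enum _) => [|i r IHr]; first by rewrite !big_nil mulr1.
rewrite !big_cons IHr mnmDE exprD -!mulrA; congr (_ * _); rewrite !mulrA.
by congr (_ * _); apply: commr_prod => j _; exact: yXC.
Qed.

(** The target is not commutative, but the y_i commute with each other and with
    the scalars. *)
Fact commuting_eval_monoid_morphism : monoid_morphism (mmap iota y).
Proof.
split=> [|p q]; first by rewrite -mpolyC1 mmapC /= rmorph1.
have -> : p * q = \sum_(m1 <- msupp p) \sum_(m2 <- msupp q)
    (p@_m1 * q@_m2) *: 'X_[m1 + m2].
  rewrite {1}[p]mpolyE {1}[q]mpolyE mulr_suml; apply: eq_bigr => m1 _.
  rewrite mulr_sumr; apply: eq_bigr => m2 _.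
  by rewrite -scalerAl -scalerAr scalerA -mpolyXD.
rewrite raddf_sum /= [mmap iota y p]/mmap mulr_suml; apply: eq_bigr => m1 _.
rewrite raddf_sum /= mulr_sumr; apply: eq_bigr => m2 _.
by rewrite mmapZ mmapX mmap1D rmorphM -!mulrA; congr (_ * _); rewrite !mulrA iotaC.
Qed.

Definition commuting_eval : {mpoly F[n]} -> A := mmap iota y.
HB.instance Definition _ := GRing.Additive.on commuting_eval.
HB.instance Definition _ := GRing.isMonoidMorphism.Build _ _ commuting_eval
  commuting_eval_monoid_morphism.

Definition commuting_rmorphism : {rmorphism {mpoly F[n]} -> A} := commuting_eval.

Lemma commuting_evalC c : commuting_eval c%:MP = iota c.
Proof. exact: mmapC. Qed.

Lemma commuting_evalX i : commuting_eval 'X_i = y i.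
Proof. by rewrite /commuting_eval mmapX mmap1U. Qed.

End CommutingEvaluation.

(** The evaluation of rational functions at z is not additive, so the usual theory
    of polynomial evaluation does not apply to it; only its values matter. *)
Lemma mmap_coef_eq (K K' : nzRingType) (A : nzRingType) n (f : K -> A) (g : K' -> A)
    (y : 'I_n -> A) (p : {mpoly K[n]}) (q : {mpoly K'[n]}) :
  f 0 = 0 -> g 0 = 0 -> (forall m, f p@_m = g q@_m) -> mmap f y p = mmap g y q.
Proof.
move=> f0 g0 fg.
have E (L : nzRingType) (k : L -> A) (r : {mpoly L[n]}) i : k 0 = 0 -> (msize r <= i)%N ->
    mmap k y r = \sum_(m : 'X_{1..n < i}) k r@_m * mmap1 y m.
  move=> k0 le_ri; rewrite /mmap (big_mksub 'X_{1..n < i}) ?msupp_uniq //=; first last.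
    by move=> x /msize_mdeg_lt /leq_trans; apply.
  by rewrite big_rmcond //= => j /memN_msupp_eq0 ->; rewrite k0 mul0r.
pose i := maxn (msize p) (msize q).
rewrite (E _ f p i f0 (leq_maxl _ _)) (E _ g q i g0 (leq_maxr _ _)).
by apply: eq_bigr => m _; rewrite fg.
Qed.

Lemma ratfun_eval0 (F : fieldType) n (z : 'I_n -> F) : ratfun_eval z 0 = 0.
Proof.
apply: ratfun_evalE; exists 0, 1.
by split; rewrite ?rmorph1 ?rmorph0 ?mul0r ?oner_neq0.
Qed.

Lemma map_poly2_eq (K K' A : nzRingType) (f : K -> A) (g : K' -> A)
    (P : {poly {poly K}}) (Q : {poly {poly K'}}) :
    f 0 = 0 -> g 0 = 0 -> (forall i j, f P`_i`_j = g Q`_i`_j) ->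
  map_poly (map_poly f) P = map_poly (map_poly g) Q.
Proof.
move=> f0 g0 fg; have m0 (L : nzRingType) (k : L -> A) : map_poly k 0 = 0.
  by rewrite /map_poly size_poly0 poly_def big_ord0.
apply/polyP => i; rewrite !coef_map_id0 ?m0 //; apply/polyP => j.
by rewrite !coef_map_id0.
Qed.

Section PcurveSpectral.
Variables (F : fieldType) (n : nat) (hbar : F) (z : 'I_n.+1 -> F).
Hypothesis z_h : forall a b, z a - z b != hbar.
Variable q : {poly perma F n.+1}.
Let y (j : 'I_n.+1) := q`_j.

Lemma Pcurve_spectral :
  Pcurve hbar z q =
  map_poly (map_poly (commuting_eval (in_alg (perma F n.+1)) y)) (spectral_poly hbar z).
Proof.
have m0 (L : nzRingType) (k : L -> perma F n.+1) : mmap k y 0 = 0.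
  by rewrite /mmap msupp0 big_nil.
apply: map_poly2_eq => [||i j]; [exact: m0 | exact: m0 |].
apply: mmap_coef_eq => [||m]; first by rewrite ratfun_eval0 scale0r.
  exact: rmorph0.
exact: (congr1 (fun c => c%:A) (ratfun_eval_Pdet z_h i j m)).
Qed.
End PcurveSpectral.

(** * Insertion of sites *)

(** The sites in r carry an arbitrary permutation, and the factors
    x_a + h sum_j sigma_{ja} for the sites a of a list s are multiplied on it from the
    right.  The relation al a j says which j, among the elements of r and among
    the sites, may precede a. *)
Section Insertion.
Variables (n : nat) (k : comNzRingType) (A : nzRingType).
Variables (iota : {rmorphism k -> A}) (rho : 'S_n -> A).
Hypothesis iotaC : forall c x, iota c * x = x * iota c.
Hypothesis rhoM : forall s t, rho s * rho t = rho (t * s)%g.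
Variables (h : k) (x : 'I_n -> k) (al : rel 'I_n) (r : {set 'I_n}).

Definition entry_wt (b d : 'I_n) : k := if d == b then x b else if al b d then - h else 0.

Definition partial_wt (s : seq 'I_n) (t : 'S_n) : k :=
  (perm_on (r :|: [set b in s]) t)%:R * \prod_(b <- s) entry_wt b ((t^-1)%g b).

(** The site b is inserted before the site a: then a may precede b, but b may
    not precede a, and all elements of r that may precede a may also precede b. *)
Definition insertion_rel : rel 'I_n := fun b a =>
  [&& al b a, ~~ al a b & [forall (j | j \in r), al a j ==> al b j]].

Lemma partial_wt_out s a (t : 'S_n) :
  a \notin r -> a \notin s -> t a != a -> partial_wt s t = 0.
Proof.
move=> ar aS ta; rewrite /partial_wt; case: (boolP (perm_on _ _)) => [on|_]; last first.
  by rewrite mul0r.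
by rewrite (out_perm on) ?eqxx // !inE negb_or ar in ta.
Qed.

(** If t moves a, then only j = t^-1 a contributes on the right, since all other
    tperm j a * t still move a.  Deleting a from its cycle then changes only the
    predecessor of t a, from a to j, and both are admissible predecessors. *)
Lemma partial_wt_rcons s a (t : 'S_n) :
    a \notin r -> a \notin s -> all (fun b => (b \notin r) && insertion_rel b a) s ->
  partial_wt (rcons s a) t = partial_wt s t * x a
    - h * \sum_(j in r | al a j) partial_wt s (tperm j a * t)%g.
Proof.
move=> ar aS /allP alls.
have setE : r :|: [set b in rcons s a] = a |: (r :|: [set b in s]).
  by apply/setP => b; rewrite !inE mem_rcons inE orbCA.
(* only the first term is present if t fixes a, only the second otherwise *)
have [ta|ta] := eqVneq (t a) a.
  rewrite big1 ?mulr0 ?subr0 => [|j /andP[jr _]]; last first.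
    apply: (partial_wt_out ar) => //; rewrite permM tpermR.
    by apply: contra ar => /eqP tj; rewrite -(perm_inj (etrans tj (esym ta))).
  have wa : entry_wt a ((t^-1)%g a) = x a by rewrite -{2}ta permK /entry_wt eqxx.
  rewrite /partial_wt big_rcons /= wa mulrA setE.
  congr ((nat_of_bool _)%:R * _ * _); apply/idP/idP => [on|on]; last exact: subset_trans on (subsetUr _ _).
  apply/subsetP => b; rewrite inE => tb; have := subsetP on b; rewrite inE tb => /(_ isT).
  by rewrite in_setU1; case: (b =P a) => // e; rewrite e ta eqxx in tb.
rewrite (partial_wt_out ar aS ta) mul0r sub0r.
set j := (t^-1)%g a; have tj : t j = a by rewrite permKV.
have ja : j != a by rewrite -(inj_eq (@perm_inj _ t)) tj eq_sym.
have wa : entry_wt a j = if al a j then - h else 0 by rewrite /entry_wt (negPf ja).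
rewrite {1}/partial_wt big_rcons /= wa setE.
have -> : \sum_(i in r | al a i) partial_wt s (tperm i a * t)%g =
    if (j \in r) && al a j then partial_wt s (tperm j a * t)%g else 0.
  case: ifP => jr; last first.
    rewrite big1 // => i ir; apply: (partial_wt_out ar) => //; rewrite permM tpermR.
    apply: contraFN jr => /eqP ti; have <- // : i = j.
    by apply: (@perm_inj _ t); rewrite ti tj.
  rewrite (bigD1 j) //= big1 ?addr0 // => i /andP[ir ij].
  apply: (partial_wt_out ar) => //; rewrite permM tpermR.
  by rewrite -[X in _ != X]tj (inj_eq perm_inj).
case: (boolP (al a j)) => [aj|_]; last by rewrite andbF !mulr0 oppr0.
case: (boolP (j \in r)) => jr; last first.
  rewrite mulr0 oppr0; case: (boolP (perm_on _ _)) => [on|_]; last by rewrite !mul0r.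
  have : j \in a |: (r :|: [set b in s]).
    by apply: contraR ja => jX; apply/eqP; rewrite -tj (out_perm on jX).
  rewrite !inE (negPf ja) (negPf jr) /= => /alls /andP[_ /and3P[_ /negP]].
  by rewrite aj.
rewrite mulrN -mulNr -mulrN mulrA mulrC; congr (_ * _).
rewrite mulrN; congr (- ((nat_of_bool _)%:R * _)).
  apply/idP/idP => /subsetP on; apply/subsetP => b; rewrite inE => tb.
    have {on} := on b; rewrite [b \in [pred _ | _]]inE in_setU1; move: tb; rewrite permM.
    case: tpermP => [->|->|_ /eqP ba] tb; first by rewrite !inE jr.
      by rewrite tj eqxx in tb.
    by move/(_ tb); rewrite (negPf ba).
  have {on} := on b; rewrite [b \in [pred _ | _]]inE permM in_setU1.
  case: (b =P a) => //= /eqP ba; have [->|bj] := eqVneq b j; first by rewrite !inE jr.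
  by rewrite tpermD ?[a == b]eq_sym ?[j == b]eq_sym // => /(_ tb).
apply: eq_big_seq => b bs; rewrite invMg tpermV permM.
have /andP[br /and3P[ba _ /forallP/(_ j)]] := alls b bs; rewrite jr aj /= => bj.
have bNa : b != a by apply: contraNneq aS => <-.
have bNj : j != b by apply: contraNneq br => <-.
case: tpermP => [e|->|//]; first by rewrite -tj -e permKV eqxx in bNa.
by rewrite /entry_wt [a == b]eq_sym (negPf bNa) (negPf bNj) ba bj.
Qed.

Definition partial_sum (s : seq 'I_n) : A :=
  \sum_(t : 'S_n) iota ((-1) ^+ t * partial_wt s t) * rho t.

Lemma partial_sum_rcons s a :
    a \notin r -> a \notin s -> all (fun b => (b \notin r) && insertion_rel b a) s ->
  partial_sum (rcons s a) = partial_sum s *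
    (iota (x a) + iota h * \sum_(j in r | al a j) rho (tperm j a)).
Proof.
move=> ar aS alls; rewrite mulrDr /partial_sum.
have hC : iota h * \sum_(j in r | al a j) rho (tperm j a) =
    \sum_(j in r | al a j) rho (tperm j a) * iota h.
  by rewrite mulr_sumr; apply: eq_bigr => j _; rewrite iotaC.
have -> : (\sum_(t : 'S_n) iota ((-1) ^+ t * partial_wt s t) * rho t) *
    (iota h * \sum_(j in r | al a j) rho (tperm j a)) =
    - \sum_(t : 'S_n) iota ((-1) ^+ t *
        (h * \sum_(j in r | al a j) partial_wt s (tperm j a * t)%g)) * rho t.
  rewrite hC mulr_sumr.
  under [in RHS]eq_bigr => t _ do rewrite !mulr_sumr raddf_sum mulr_suml.
  rewrite exchange_big -sumrN; apply: eq_bigr => j /andP[jr _].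
  rewrite mulr_suml -sumrN (reindex_inj (mulgI (tperm j a))) /=.
  apply: eq_bigr => t _; rewrite odd_permM odd_tperm.
  have -> : j != a by apply: contraNneq ar => <-.
  rewrite signr_addb -[(-1) ^+ true]/(-1) mulN1r mulNr raddfN /= mulNr mulNr.
  rewrite mulrA -[_ * rho _ * rho _]mulrA rhoM mulgA tperm2 mul1g -mulrA -iotaC mulrA.
  by rewrite -rmorphM mulrAC -mulrA.
rewrite mulr_suml -sumrB; apply: eq_bigr => t _.
rewrite (partial_wt_rcons _ ar aS alls) mulrBr raddfB mulrBl; congr (_ - _).
by rewrite -mulrA -iotaC !mulrA -!rmorphM.
Qed.

Theorem insertion s : pairwise insertion_rel s -> uniq s -> all (fun b => b \notin r) s ->
  partial_sum [::] *
    \prod_(a <- s) (iota (x a) + iota h * \sum_(j in r | al a j) rho (tperm j a)) =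
  partial_sum s.
Proof.
elim/last_ind: s => [|s a IHs]; first by rewrite big_nil mulr1.
rewrite pairwise_rcons rcons_uniq all_rcons => /andP[rel_a rel_s] /andP[aS us].
move=> /andP[ar rs]; rewrite big_rcons /= mulrA IHs // partial_sum_rcons //.
by apply/allP => b bs; rewrite (allP rs) // (allP rel_a).
Qed.

End Insertion.

(** * Permutations pushed along an injection *)

Section Push.
Variables (k n : nat) (r : 'I_k -> 'I_n).
Hypothesis r_inj : injective r.
Implicit Types s t : 'S_k.

Lemma perm_push_val s i : perm_push r s (r i) = r (s i).
Proof.
rewrite perm_pushE //; case: pickP => [j /eqP/r_inj -> //|/(_ i)].
by rewrite eqxx.
Qed.

Lemma perm_push_out s x : x \notin codom r -> perm_push r s x = x.
Proof.
rewrite perm_pushE // => xr; case: pickP => // j /eqP e.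
by rewrite -e codom_f in xr.
Qed.

Lemma perm_pushM s t : perm_push r (s * t) = (perm_push r s * perm_push r t)%g.
Proof.
apply/permP => x; rewrite permM; have [/codomP[i ->]|xr] := boolP (x \in codom r).
  by rewrite !perm_push_val permM.
by rewrite !perm_push_out // perm_push_out.
Qed.

Lemma perm_push1 : perm_push r 1 = 1%g.
Proof. by apply: (mulgI (perm_push r 1)); rewrite -perm_pushM !mulg1. Qed.

Lemma perm_push_tperm i j : perm_push r (tperm i j) = tperm (r i) (r j).
Proof.
apply/permP => x; have [/codomP[l ->]|xr] := boolP (x \in codom r).
  rewrite perm_push_val; case: tpermP => [->|->|li lj]; rewrite ?tpermL ?tpermR //.
  by rewrite tpermD // (inj_eq r_inj) eq_sym; apply/eqP.
have rx l : r l != x by apply: contraNneq xr => <-; rewrite codom_f.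
by rewrite perm_push_out // tpermD.
Qed.

Lemma perm_push_inj : injective (perm_push r).
Proof.
by move=> s t st; apply/permP => i; apply: r_inj; rewrite -!perm_push_val st.
Qed.

Lemma odd_perm_push s : perm_push r s = s :> bool.
Proof.
case: (prod_tpermP s) => ts -> /allP dts.
elim: ts dts => [|[i j] ts IHts] dts; first by rewrite !big_nil perm_push1 !odd_perm1.
rewrite !big_cons perm_pushM !odd_permM perm_push_tperm !odd_tperm /=.
by rewrite IHts => [|t tts]; rewrite ?(inj_eq r_inj) // dts ?inE ?tts ?orbT.
Qed.

(** The pushed permutations are supported on the range of r; by cardinality there
    are no others. *)
Lemma perm_push_imset : perm_push r @: setT = [set t | perm_on [set x in codom r] t].
Proof.
apply/eqP; rewrite eqEcard; apply/andP; split.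
  apply/subsetP => _ /imsetP[s _ ->]; rewrite inE; apply/subsetP => x; rewrite !inE.
  by apply: contraR => /perm_push_out ->.
rewrite card_imset ?cardsT; last exact: perm_push_inj.
by rewrite card_Sn cardsE card_perm cardsE card_codom // card_ord.
Qed.

Lemma sum_perm_push (V : nmodType) (f : 'S_n -> V) :
  \sum_(s : 'S_k) f (perm_push r s) = \sum_(t | perm_on [set x in codom r] t) f t.
Proof.
rewrite (eq_bigl (mem (perm_push r @: setT))) => [|t]; last by rewrite perm_push_imset !inE.
rewrite big_imset /= => [|s t _ _]; last exact: perm_push_inj.
by apply: eq_bigl => s; rewrite inE.
Qed.

Lemma antisymE (F : fieldType) s : (antisym F k) s = (k`!%:R)^-1 * (-1) ^+ s.
Proof.
rewrite /antisym ffunE sum_ffunE (bigD1 s) //= big1 => [|t /negPf ts].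
  by rewrite !ffunE eqxx addr0 /GRing.scale /= mulr1.
by rewrite !ffunE eq_sym ts /GRing.scale /= mulr0.
Qed.

Lemma perma_push_antisym (F : fieldType) : [pchar F] =i pred0 ->
  k`!%:R *: perma_push r (antisym F k) =
  \sum_(u : 'S_n | perm_on [set x in codom r] u) (-1) ^+ u *: permb F u.
Proof.
move=> charF; rewrite -(sum_perm_push (fun u : 'S_n => (-1) ^+ u *: permb F u)) /perma_push.
rewrite scaler_sumr; apply: eq_bigr => s _.
rewrite antisymE scalerA mulrA mulfV ?mul1r ?odd_perm_push //.
by have/charf0P -> := charF; rewrite -lt0n fact_gt0.
Qed.

End Push.

(** * The S_k in explicit form *)

Lemma sorted_enum_ordset n (U : pred 'I_n) : sorted (relpre val ltn) (enum U).
Proof.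
rewrite /enum_mem; apply: sorted_filter; first by move=> y x z; exact: ltn_trans.
by rewrite -enumT -sorted_map val_enum_ord iota_ltn_sorted.
Qed.

Section Increasing.
Variables (k n : nat).
Implicit Types r : {ffun 'I_k -> 'I_n}.

Lemma increasingP r : reflect (forall i j : 'I_k, (i < j)%N -> (r i < r j)%N) (increasing r).
Proof.
rewrite /increasing; apply: (iffP forallP) => rP i.
  by move=> j ij; have h := rP i; have := forallP h => /(_ j); rewrite ij.
by apply/forallP => j; apply/implyP => ij; exact: (rP i j ij).
Qed.

Lemma increasing_inj r : increasing r -> injective r.
Proof.
move=> /increasingP rP i j e; apply: val_inj => /=.
case: (ltngtP i j) => // /rP; by rewrite e ltnn.
Qed.

(** An increasing map is the enumeration of its range. *)
Lemma sum_increasing (V : nmodType) (f : {set 'I_n} -> V) :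
  \sum_(r : {ffun 'I_k -> 'I_n} | increasing r) f [set x in codom r] =
  \sum_(U : {set 'I_n} | #|U| == k) f U.
Proof.
pose c r := [set x in codom r].
have c_inj : {in [pred r | increasing r] &, injective c}.
  move=> r r'; rewrite !inE => rP r'P e.
  have srt (g : {ffun 'I_k -> 'I_n}) : increasing g -> sorted (relpre val ltn) (codom g).
    move/increasingP => gP; rewrite codomE.
    by apply: (homo_sorted (e := relpre val ltn)) (sorted_enum_ordset _) => i j /gP.
  have {}e : codom r = codom r'.
    apply: (irr_sorted_eq (leT := relpre val ltn)); rewrite ?srt //.
    - by move=> y x z; exact: ltn_trans.
    - by move=> x; exact: ltnn.
    by move=> x; have := congr1 (fun U : {set 'I_n} => x \in U) e; rewrite !inE.
  apply/ffunP => i; move: e; rewrite !codomE => /eq_in_map/(_ i).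
  by rewrite mem_enum; apply.
rewrite [RHS](eq_bigl (mem (c @: [pred r | increasing r]))) => [|U] /=.
  by rewrite big_imset.
apply/eqP/imsetP => [cU|[r rP ->]]; last first.
  by rewrite cardsE card_codom ?card_ord //; exact: increasing_inj.
have e : k = #|U| by [].
exists [ffun i => enum_val (cast_ord e i)].
  rewrite inE; apply/increasingP => i j ij; rewrite !ffunE.
  have x0 : 'I_n := enum_val (cast_ord e i).
  rewrite !(enum_val_nth x0) /=.
  have tr : transitive (relpre (@nat_of_ord n) ltn) by move=> y x w; exact: ltn_trans.
  apply: (sorted_ltn_nth tr x0 (sorted_enum_ordset _)) ij.
  - by rewrite inE -cardE -e.
  by rewrite inE -cardE -e.
apply/setP => x; rewrite inE; apply/idP/codomP => [xU|[i ->]]; last first.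
  by rewrite ffunE enum_valP.
exists (cast_ord (esym e) (enum_rank_in xU x)).
by rewrite ffunE cast_ordKV enum_rankK_in.
Qed.
End Increasing.

Section PushSum.
Variables (F : fieldType) (k n : nat) (r : 'I_k -> 'I_n).
Hypothesis charF : [pchar F] =i pred0.
Hypothesis r_inj : injective r.
Local Notation A := (perma F n).

Lemma partial_sum_nil h x al :
  partial_sum (map_poly (in_alg A)) (fun s => (permb F s)%:P) h x al
    [set v in codom r] [::] = (k`!%:R *: perma_push r (antisym F k))%:P.
Proof.
rewrite perma_push_antisym // rmorph_sum big_mkcond /=.
apply: eq_bigr => t _; rewrite /partial_wt big_nil mulr1.
have -> : [set v in codom r] :|: [set b in [::]] = [set v in codom r].
  by apply/setP => b; rewrite !inE orbF.
case: ifP => _; last by rewrite mulr0 raddf0 mul0r.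
by rewrite mulr1 rmorph_sign scaler_sign mulr_sign; case: ifP; rewrite ?polyCN.
Qed.
End PushSum.

Lemma perma_polyC_central (F : fieldType) n (c : {poly F}) (x : {poly perma F n}) :
  map_poly (in_alg (perma F n)) c * x = x * map_poly (in_alg (perma F n)) c.
Proof. by apply: map_poly_central => a y; rewrite /= mulr_algl mulr_algr. Qed.

Lemma permb_polyCM (F : fieldType) n (s t : 'S_n) :
  (permb F s)%:P * (permb F t)%:P = (permb F (t * s))%:P :> {poly perma F n}.
Proof. by rewrite -polyCM permaM. Qed.

Section SpolySgen.
Variables (F : fieldType) (n : nat) (hbar : F) (z : 'I_n -> F).
Hypothesis charF : [pchar F] =i pred0.
Local Notation A := (perma F n).
Let iota := map_poly (in_alg A).
Let rho (s : 'S_n) : {poly A} := (permb F s)%:P.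

Let site a : {poly F} := 'X - (z a)%:P.
Let below (b d : 'I_n) := (d < b)%N.
Let factorE k (r : 'I_k -> 'I_n) a : injective r ->
  'X - ((z a)%:A)%:P + (hbar *: \sum_(j < k | (r j < a)%N) permb F (tperm (r j) a))%:P =
  iota (site a) + iota hbar%:P * \sum_(j in [set x in codom r] | below a j) rho (tperm j a).
Proof.
move=> r_inj; congr (_ + _).
  by rewrite /iota rmorphB /= map_polyX map_polyC.
have -> v : (hbar *: v)%:P = iota hbar%:P * v%:P.
  by rewrite /iota map_polyC /= -polyCM mulr_algl.
congr (_ * _); rewrite rmorph_sum /=.
rewrite -(big_imset (fun j => rho (tperm j a)) (h := r) (A := [pred j | (r j < a)%N])) /=.
  apply: eq_bigl => x; rewrite inE; apply/imsetP/andP => [[j ja ->]|[/codomP[j ->] ja]].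
    by rewrite codom_f.
  by exists j.
by move=> i j _ _; exact: r_inj.
Qed.

(** The insertion formula with all sites d < b admissible before b; once all sites
    are present, the support condition is void. *)
Let psum_prod k (r : 'I_k -> 'I_n) : injective r ->
  (k`!%:R *: perma_push r (antisym F k))%:P *
    \prod_(a <- rev (enum 'I_n) | a \notin codom r)
     ('X - ((z a)%:A)%:P + (hbar *: \sum_(j < k | (r j < a)%N) permb F (tperm (r j) a))%:P) =
  \sum_(t : 'S_n) iota ((-1) ^+ t *
     subset_wt hbar%:P (fun a => (z a)%:P) 'X t [set x in codom r]) * rho t.
Proof.
move=> r_inj; rewrite -(partial_sum_nil charF r_inj hbar%:P site below); under eq_bigr do rewrite factorE //.
rewrite -big_filter; set s := filter _ _.
have sE b : (b \in s) = (b \notin codom r) by rewrite mem_filter mem_rev mem_enum andbT.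
rewrite (insertion (@perma_polyC_central F n) (@permb_polyCM F n)); first last.
- by apply/allP => b; rewrite sE inE.
- by rewrite filter_uniq // rev_uniq enum_uniq.
- apply: pairwise_filter; apply: (sub_pairwise (r := fun b a : 'I_n => (a < b)%N)).
    move=> b a ab; rewrite /insertion_rel /below ab -leqNgt ltnW //=.
    by apply/forallP => j; apply/implyP => _; apply/implyP => ja; exact: ltn_trans ja ab.
  rewrite -sorted_pairwise => [|a b c ab bc]; last exact: ltn_trans bc ab.
  by rewrite rev_sorted; exact: sorted_enum_ordset.
apply: eq_bigr => t _; congr (iota (_ * _) * _); rewrite /partial_wt.
have -> : perm_on ([set x in codom r] :|: [set b in s]) t.
  by apply/subsetP => b _; rewrite !inE sE orbN.
rewrite mul1r /subset_wt big_filter (perm_big (enum 'I_n)) ?perm_rev //= big_enum_cond /=.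
by apply: eq_bigl => b; rewrite !inE.
Qed.

Lemma Spoly_Sgen k : Spoly hbar z k =
  Sgen iota rho hbar%:P (fun a => (z a)%:P) 'X k.
Proof.
have iX a : iota ('X - (z a)%:P) = 'X - ((z a)%:A)%:P.
  by rewrite /iota rmorphB /= map_polyX map_polyC.
case: k => [|k] /=.
  rewrite (@Sgen0 n {poly F} {poly A} iota rho) // /iota rmorph_prod /=.
  by apply: eq_bigr => a _; exact/esym/iX.
rewrite /Sgen.
transitivity (iota (hbar ^+ k.+1)%:P * \sum_(U : {set 'I_n} | #|U| == k.+1)
    \sum_(t : 'S_n) iota ((-1) ^+ t * subset_wt hbar%:P (fun a => (z a)%:P) 'X t U) * rho t).
  rewrite -(sum_increasing k.+1 (fun U => \sum_(t : 'S_n)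
     iota ((-1) ^+ t * subset_wt hbar%:P (fun a => (z a)%:P) 'X t U) * rho t)).
  rewrite -mul_polyC.
  have -> : ((k.+1`!%:R * hbar ^+ k.+1)%:A)%:P =
      iota (hbar ^+ k.+1)%:P * ((k.+1`!%:R)%:A)%:P :> {poly A}.
    by rewrite /iota map_polyC -polyCM -scalerAl mul1r scalerA mulrC.
  rewrite -mulrA; congr (_ * _); rewrite mulr_sumr; apply: eq_bigr => r rP.
  by rewrite mulrA -polyCM mulr_algl psum_prod //; exact: increasing_inj.
rewrite exchange_big mulr_sumr; apply: eq_bigr => t _.
rewrite -mulr_suml mulrA -rmorph_sum /= -rmorphM -mulr_sumr mulrCA.
by rewrite -polyC_exp.
Qed.
End SpolySgen.

(** * Shifts and leading coefficients *)

Section MoreSgen.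
Variables (n : nat) (F : fieldType) (A : nzRingType).
Variables (iota : {rmorphism F -> A}) (rho : 'S_n -> A).
Hypothesis iotaC : forall c x, iota c * x = x * iota c.
Hypothesis rho1 : rho 1%g = 1.
Variables (h : F) (z : 'I_n -> F).
Local Notation Spol := (Sgen (map_poly iota) (fun s => (rho s)%:P) h%:P
  (fun a => (z a)%:P)).

Lemma shiftp_comp p : shiftp iota h p = p \Po ('X - (iota h)%:P).
Proof.
rewrite comp_polyE /shiftp; apply: eq_bigr => i _.
by rewrite mul_polyC rmorphXn rmorphB /= map_polyX map_polyC.
Qed.

Let shift_comm : commr_rmorph (@polyC A) ('X - (iota h)%:P).
Proof.
move=> x; apply/commr_sym/commrB; first exact: commr_polyX.
by rewrite /GRing.comm -!polyCM iotaC.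
Qed.

Let shift : {rmorphism {poly A} -> {poly A}} := horner_morph shift_comm.

(** The element h is central, so the substitution is a ring morphism. *)
Lemma Sgen_shift m : Spol ('X - h%:P) m = shiftp iota h (Spol 'X m).
Proof.
rewrite shiftp_comp; change (Spol ('X - h%:P) m = shift (Spol 'X m)).
pose f : {rmorphism {poly F} -> {poly F}} := comp_poly ('X - h%:P).
apply/esym/(Sgen_map (f := f)) => [c|s||a|] /=.
- rewrite /horner_morph -[LHS]/(map_poly iota c \Po _) map_comp_poly.
  by rewrite rmorphB /= map_polyX map_polyC.
- by rewrite /horner_morph map_polyC hornerC.
- by rewrite comp_polyC.
- by rewrite comp_polyC.
- by rewrite comp_polyX.
Qed.

(** A permutation other than 1 moves at least two sites, so some factor outside
    a one-element U is constant. *)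
Lemma coef_subset_wt1 (t : 'S_n) (U : {set 'I_n}) : #|U| = 1 ->
  (subset_wt h%:P (fun a => (z a)%:P) 'X t U)`_n.-1 = (t == 1%g)%:R.
Proof.
move=> cU; have cCU : #|~: U| = n.-1 by rewrite cardsCs setCK card_ord cU subn1.
have [->|t1] := eqVneq t 1%g.
  rewrite /subset_wt (eq_bigr (fun b => 'X - (z b)%:P)) => [|b _]; last first.
    by rewrite /gwt invg1 perm1 eqxx.
  rewrite -big_enum /=; have /monicP := monic_prod_XsubC (enum (~: U)) predT z.
  by rewrite lead_coefE size_prod_XsubC -cardE cCU.
(* otherwise t would be supported on the one-element set U *)
have [b bU tb] : exists2 b, b \notin U & (t^-1)%g b != b.
  apply/exists_inP; apply: contraR t1 => /exists_inPn tU.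
  have on : perm_on U (t^-1)%g.
    by apply/subsetP => b; rewrite inE; apply: contraR => /tU /negPn.
  by rewrite -eq_invg1 (perm_on_id on) // cU.
rewrite /subset_wt (bigD1 b) ?inE //=.
have -> : gwt h%:P (fun a => (z a)%:P) 'X b ((t^-1)%g b) =
    (if ((t^-1)%g b < b)%N then - h else 0)%:P.
  by rewrite /gwt (negPf tb); case: ifP => _; rewrite ?polyCN ?polyC0.
rewrite coefCM nth_default ?mulr0 //.
rewrite (eq_bigl (mem (~: U :\ b))) => [|c]; last by rewrite !inE andbC.
apply: leq_trans (size_prod_gwt _ _ _ _) _.
by have := cardsD1 b (~: U); rewrite inE bU cCU add1n => <-.
Qed.

Lemma coef_Sgen1 : (Spol 'X 1)`_n.-1 = iota (h * n%:R).
Proof.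
have cf (t : 'S_n) : (h%:P ^+ 1 * \sum_(U : {set 'I_n} | #|U| == 1)
    subset_wt h%:P (fun a => (z a)%:P) 'X t U)`_n.-1 = h * n%:R * (t == 1%g)%:R.
  rewrite expr1 coefCM coef_sum -mulrA; congr (_ * _).
  rewrite (eq_bigr (fun=> (t == 1%g)%:R)) => [|U /eqP]; last exact: coef_subset_wt1.
  rewrite sumr_const -[X in X *+ _]mulr1 -mulrnAr mulrC; congr (_%:R * _).
  transitivity #|[set U : {set 'I_n} | #|U| == 1]|.
    by apply: eq_card => U; rewrite !inE.
  by rewrite card_draws card_ord bin1.
rewrite /Sgen coef_sum (bigD1 1%g) //= [X in _ + X]big1 => [|t /negPf t1]; last first.
  rewrite /= coefMC coef_map /= mulr_sign; case: ifP => _; rewrite ?coefN cf t1 mulr0;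
  by rewrite ?oppr0 rmorph0 mul0r.
by rewrite /= coefMC coef_map /= odd_perm1 mul1r cf eqxx mulr1 rho1 mulr1 addr0.
Qed.
End MoreSgen.

(** * First returns to the lower symbols *)

Section FirstReturn.
Variables n m : nat.
Implicit Types (s t : 'S_(n + m)) (x y v : 'I_(n + m)) (i k : 'I_n).

Lemma keep_low_lshift i : keep_low (lshift m i) = Some i.
Proof. exact: keep_lowK. Qed.

Lemma keep_low_Some v i : keep_low v = Some i -> v = lshift m i.
Proof. by move=> e; have := keep_low_ocancel v; rewrite e. Qed.

Lemma keep_low_None v : (keep_low v == None) = (n <= v)%N.
Proof.
case e : (keep_low v) => [i|].
  by rewrite (keep_low_Some e) /= leqNgt ltn_ord.
rewrite eqxx leqNgt; apply/esym/negP => vn; move: e.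
by have -> : v = lshift m (Ordinal vn) by [apply: val_inj]; rewrite keep_low_lshift.
Qed.

(** The first lower symbol met after v along the cycle of s is k. *)
Inductive returns s : 'I_(n + m) -> 'I_n -> Prop :=
| Return_now v k : s v = lshift m k -> returns s v k
| Return_later v k : keep_low (s v) = None -> returns s (s v) k -> returns s v k.

Lemma returns_inj s v k k' : returns s v k -> returns s v k' -> k = k'.
Proof.
move=> r; elim: r k' => {v k} [v k sv|v k sv r IHr] k' r'.
  case: r' sv => {v k'} [v k' -> /lshift_inj //|v k' sv _ sv'].
  by rewrite sv' keep_low_lshift in sv.
case: r' sv r IHr => {v k'} [v k' sv' sv|v k' _ r' _ _]; last exact.
by rewrite sv' keep_low_lshift in sv.
Qed.

(** Along the orbit the first lower symbol is either met, or all symbols are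
    auxiliary and the search continues at the end. *)
Lemma returns_traject s v (q : nat) k : returns s v (head k (pmap (@keep_low n m) (traject s (s v) q)))
  \/ pmap (@keep_low n m) (traject s (s v) q) = [::] /\
     forall k', returns s (iter q s v) k' -> returns s v k'.
Proof.
elim: q v => [|q IHq] v /=; first by right.
case sv : (keep_low (s v)) => [i|] /=; first by left; apply/Return_now/keep_low_Some.
case: (IHq (s v)) => [r|[e r]]; first by left; apply: Return_later.
right; split=> // k'; rewrite -iterS iterSr => /r; exact: Return_later.
Qed.

Lemma returns_cut_perm s i : returns s (lshift m i) (cut_perm s i).
Proof.
pose q := (fingraph.order s (lshift m i)).-1.
pose l := pmap (@keep_low n m) (traject s (s (lshift m i)) q).
have -> : cut_perm s i = head i l.
  rewrite permE /cut_cycle /fingraph.orbit -fingraph.orderSpred -/q /=.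
  by rewrite keep_low_lshift /= -/l; case: l => [|j l'] /=; rewrite eqxx.
case: (returns_traject s (lshift m i) q i) => // -[e]; rewrite /l e; apply.
apply: Return_now => /=.
by rewrite -iterS /q fingraph.orderSpred fingraph.iter_order //; exact: perm_inj.
Qed.

Lemma cut_permP s i k : returns s (lshift m i) k -> cut_perm s i = k.
Proof. exact/returns_inj/returns_cut_perm. Qed.

(** Inserting the auxiliary symbol x after y lengthens a first return path
    through y by one auxiliary symbol. *)
Lemma cut_perm_insert s x y : (n <= x)%N -> s x = x ->
  cut_perm (tperm y x * s) = cut_perm s.
Proof.
rewrite -keep_low_None => /eqP xn sx; set s' := (tperm y x * s)%g.
have s'x : s' x = s y by rewrite permM tpermR.
have s'y : s' y = x by rewrite permM tpermL.
have s'D v : v != x -> v != y -> s' v = s v.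
  by move=> vx vy; rewrite permM tpermD // eq_sym.
have ret v k : returns s v k -> v != x -> returns s' v k.
  elim=> {v k} [v k sv|v k sv r IHr] vx.
    have [e|vy] := eqVneq v y; last by apply: Return_now; rewrite s'D.
    by rewrite e; apply: Return_later; rewrite s'y //; apply: Return_now; rewrite s'x -e.
  have {}IHr : returns s' (s v) k by apply: IHr; rewrite -{1}sx (inj_eq perm_inj).
  have [e|vy] := eqVneq v y; last by apply: Return_later; rewrite s'D.
  by rewrite e; apply: Return_later; rewrite s'y //; apply: Return_later; rewrite s'x -e.
apply/permP => i; apply/cut_permP/ret; first exact: returns_cut_perm.
by apply/eqP => e; rewrite -e keep_low_lshift in xn.
Qed.

Lemma cut_perm_push (t : 'S_n) : cut_perm (perm_push (@lshift n m) t) = t.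
Proof.
apply/permP => i; apply/cut_permP/Return_now.
by rewrite perm_push_val //; exact: lshift_inj.
Qed.

Definition entrances s : {set 'I_n} := [set b | keep_low ((s^-1)%g (lshift m b)) == None].

Lemma cut_permV_notin s b : b \notin entrances s ->
  (s^-1)%g (lshift m b) = lshift m ((cut_perm s)^-1 b)%g.
Proof.
rewrite inE; case e : (keep_low _) => [i|//] _.
have si := keep_low_Some e; rewrite si; congr lshift.
by apply: (@perm_inj _ (cut_perm s)); rewrite permKV; apply/cut_permP/Return_now; rewrite -si permKV.
Qed.

Lemma entrances_push (t : 'S_n) : entrances (perm_push (@lshift n m) t) = set0.
Proof.
apply/setP => b; rewrite !inE -{1}(permKV t b).
by rewrite -(perm_push_val (@lshift_inj n m)) permK keep_low_lshift.
Qed.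

(** The predecessor of s y becomes x; all other lower symbols keep theirs. *)
Lemma entrances_insert s x y : (n <= x)%N -> s x = x ->
  entrances (tperm y x * s) =
  if keep_low (s y) is Some b then b |: entrances s else entrances s.
Proof.
rewrite -keep_low_None => /eqP xn sx.
have step b : (b \in entrances (tperm y x * s)) = (s y == lshift m b) || (b \in entrances s).
  rewrite !inE invMg tpermV permM; set v := (s^-1)%g _.
  have sv : s v = lshift m b by rewrite permKV.
  have vx : v != x.
    apply/eqP => vx; have := sv; rewrite vx sx => e.
    by rewrite e keep_low_lshift in xn.
  rewrite -sv (inj_eq perm_inj) [y == v]eq_sym; case: tpermP => [->|e|/eqP vy _].
  - by rewrite xn !eqxx.
  - by rewrite e eqxx in vx.
  by rewrite (negPf vy).
apply/setP => b; rewrite step; case e : (keep_low _) => [c|].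
  by rewrite (keep_low_Some e) !inE (inj_eq (@lshift_inj _ _)) eq_sym.
by case: eqP => // sy; rewrite sy keep_low_lshift in e.
Qed.

End FirstReturn.

(** * Adding one auxiliary symbol *)

Lemma porbits1 n : #|porbits (1%g : 'S_n)| = n.
Proof.
rewrite /porbits card_imset ?card_ord // => x y e.
have : x \in porbit 1%g y by rewrite -e porbit_id.
by case/porbitP => i ->; rewrite expg1n perm1.
Qed.

(** By induction on a factorisation into transpositions: each of them merges or
    splits the same cycles before and after pushing. *)
Lemma card_porbits_push k n (r : 'I_k -> 'I_n) (t : 'S_k) : injective r ->
  (#|porbits (perm_push r t)| + k = #|porbits t| + n)%N.
Proof.
move=> r_inj; case: (prod_tpermP t) => ts -> /allP dts.
elim: ts dts => [|[i j] ts IHts] dts.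
  by rewrite !big_nil perm_push1 // !porbits1 addnC.
have {}IHts := IHts (fun t tts => dts t (@mem_behead _ (_ :: _) _ tts)).
rewrite !big_cons /=; set s := (\prod_(_ <- _) _)%g in IHts *.
rewrite perm_pushM // perm_push_tperm //.
have ij : i != j by exact: (dts (i, j) (mem_head _ _)).
have := porbits_mul_tperm (perm_push r s) (r i) (r j).
have := porbits_mul_tperm s i j; rewrite /= (inj_eq r_inj) ij.
have -> : (r i \in porbit (perm_push r s) (r j)) = (i \in porbit s j).
  have pX l : perm_push r (s ^+ l)%g = (perm_push r s ^+ l)%g.
    by elim: l => [|l IHl]; rewrite ?perm_push1 // !expgS perm_pushM ?IHl.
  apply/porbitP/porbitP => -[l e]; exists l.
    by apply: (r_inj); rewrite e -pX (perm_push_val r_inj).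
  by rewrite e -pX (perm_push_val r_inj).
by move: IHts; move: #|_| #|_| #|_| #|_| => a b c d; case: (_ \notin _) => /=; lia.
Qed.

Lemma card_porbits_insert n (s : 'S_n) x y : s x = x -> y != x ->
  #|porbits (tperm y x * s)|.+1 = #|porbits s|.
Proof.
move=> sx yx; have := porbits_mul_tperm s y x; rewrite /= yx.
suff -> : y \in porbit s x = false by rewrite /= addn1 addn2 => -[].
apply: contraNF yx => /porbitP[l ->]; elim: l => [|l /eqP IHl]; first by rewrite expg0 perm1.
by rewrite expgSr permM IHl sx.
Qed.

Section Active.
Variables n m : nat.

(** The lower symbols and the first j auxiliary ones.  Working with permutations
    supported on this set keeps the ambient symmetric group fixed. *)
Definition active (j : nat) : {set 'I_(n + m)} := [set v : 'I_(n + m) | (v < n + j)%N].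

Lemma active0 : active 0 = [set v in codom (@lshift n m)].
Proof.
apply/setP => v; rewrite !inE addn0; apply/idP/codomP => [vn|[i ->]]; last by rewrite /= ltn_ord.
by exists (Ordinal vn); apply: val_inj.
Qed.

Lemma active_full : active m = setT.
Proof. by apply/setP => v; rewrite !inE ltn_ord. Qed.

(** Every permutation of active j.+1 arises in a unique way by inserting the
    new symbol x after some y into a permutation of active j, where y = x leaves x
    fixed. *)
Section Insert.
Variables (j : nat) (x : 'I_(n + m)).
Hypothesis xj : x = (n + j)%N :> nat.

Lemma activeS : active j.+1 = x |: active j.
Proof. by apply/setP => v; rewrite !inE addnS ltnS leq_eqVlt -xj. Qed.

Lemma active_x : x \notin active j.
Proof. by rewrite inE xj ltnn. Qed.

Lemma perm_on_fix (s : 'S_(n + m)) :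
  perm_on (active j) s = perm_on (active j.+1) s && (s x == x).
Proof.
apply/idP/andP => [on|[/subsetP on sx]].
  rewrite (out_perm on active_x) eqxx activeS; split=> //.
  by apply: subset_trans on _; exact: subsetUr.
apply/subsetP => v; rewrite inE => sv; have := on v; rewrite inE => /(_ sv).
by rewrite activeS in_setU1; case: (v =P x) => // e; rewrite e sx in sv.
Qed.

Lemma perm_on_insert (s : 'S_(n + m)) y : y \in active j.+1 ->
  perm_on (active j.+1) (tperm y x * s)%g = perm_on (active j.+1) s.
Proof.
move=> yj; have ont : perm_on (active j.+1) (tperm y x).
  apply: subset_trans (tperm_on y x) _.
  by apply/subsetP => v; rewrite !inE => /orP[]/eqP->; [rewrite inE in yj | rewrite xj addnS].
apply/idP/idP => on; last exact: perm_onM.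
by rewrite -(mulKg (tperm y x) s) tpermV perm_onM.
Qed.

Lemma sum_perm_insert (V : nmodType) (f : 'S_(n + m) -> V) :
  \sum_(s | perm_on (active j.+1) s) f s =
  \sum_(s | perm_on (active j) s) \sum_(y in active j.+1) f (tperm y x * s)%g.
Proof.
have xS : x \in active j.+1 by rewrite activeS setU11.
rewrite (partition_big (fun s : 'S_(n + m) => (s^-1)%g x) (mem (active j.+1))) /=; last first.
  by move=> s on; rewrite (perm_closed _ (perm_onV on)).
rewrite [RHS]exchange_big; apply: eq_bigr => y yj /=.
rewrite (reindex_inj (mulgI (tperm y x))) /=; apply: eq_bigl => s.
rewrite perm_on_insert // perm_on_fix; congr (_ && _).
by rewrite invMg tpermV permM (can2_eq (tpermK y x) (tpermK y x)) tpermL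
  (can2_eq (permKV s) (permK s)) eq_sym.
Qed.

Lemma perm_insertP (s' : 'S_(n + m)) : perm_on (active j.+1) s' ->
  exists s y, [/\ perm_on (active j) s, y \in active j.+1 & s' = (tperm y x * s)%g].
Proof.
move=> on; pose y := (s'^-1)%g x.
have xS : x \in active j.+1 by rewrite activeS setU11.
have yS : y \in active j.+1 by rewrite (perm_closed _ (perm_onV on)).
exists (tperm y x * s')%g, y; split=> //; last by rewrite mulgA tperm2 mul1g.
by rewrite perm_on_fix perm_on_insert // on permM tpermR permKV eqxx.
Qed.
End Insert.

(** Each cycle of the trace comes from a cycle of s, and the m - j unused
    auxiliary symbols are fixed.  So the subtractions in the exponents below are not truncated. *)
Lemma leq_porbits_cut j (s : 'S_(n + m)) : (j <= m)%N -> perm_on (active j) s ->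
  (#|porbits (cut_perm s)| + (m - j) <= #|porbits s|)%N.
Proof.
elim: j s => [|j IHj] s jm on.
  have : s \in [set t | perm_on [set x in codom (@lshift n m)] t] by rewrite inE -active0.
  rewrite -perm_push_imset; last exact: lshift_inj.
  case/imsetP => t _ ->; rewrite cut_perm_push.
  by have := card_porbits_push t (@lshift_inj n m); lia.
have xP : (n + j < n + m)%N by rewrite ltn_add2l.
have [t [y [ont yS ->]]] := perm_insertP (x := Ordinal xP) erefl on.
have tx : t (Ordinal xP) = Ordinal xP by apply: (out_perm ont); exact: active_x.
rewrite cut_perm_insert ?leq_addr //; have := IHj t (ltnW jm) ont.
have [->|yx] := eqVneq y (Ordinal xP); first by rewrite tperm1 mul1g; lia.
by have := card_porbits_insert tx yx; lia.
Qed.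
End Active.

(** * The signed count behind the trace *)

(** The value at k = |U| of m! (p-k choose m-k), written without denominators
    and with j for m. *)
Definition trace_coef (R : comNzRingType) (p : R) (j k : nat) : R :=
  (j ^_ k)%:R * \prod_(k <= i < j) (p - i%:R).

Lemma trace_coef_rec (R : comNzRingType) (p : R) j k :
  trace_coef p j.+1 k =
  (p - j%:R - k%:R) * trace_coef p j k + k%:R * trace_coef p j k.-1.
Proof.
rewrite /trace_coef; case: k => [|k] /=.
  by rewrite !ffactn0 big_nat_recr //=; ring.
rewrite ffactSS ffactnSr; case: (ltngtP k j) => [kj|jk|->].
- rewrite big_nat_recr //= [in RHS](big_ltn kj) !natrM (natrB _ (ltnW kj)).
  move: (\prod_(_ <= _ < _) _) => P; ring.
- by rewrite ffact_small //; ring.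
by rewrite subnn muln0 !big_geq // natrM -!natr1 /=; ring.
Qed.

Section SubsetRecursion.
Variables (F : nzRingType) (V : lmodType F) (n : nat).
Implicit Types (f : {set 'I_n} -> V) (a : nat -> F).

(** Each U is obtained from b in U, either from itself or from U without b. *)
Lemma sum_subsets_add f a :
  \sum_(U : {set 'I_n}) \sum_b a #|U| *: f (b |: U) =
  \sum_(U : {set 'I_n}) (#|U|%:R * (a #|U| + a #|U|.-1)) *: f U.
Proof.
rewrite exchange_big /=.
have one b : \sum_(U : {set 'I_n}) a #|U| *: f (b |: U) =
    \sum_(U : {set 'I_n} | b \in U) (a #|U| + a #|U|.-1) *: f U.
  rewrite (bigID (fun U : {set 'I_n} => b \in U)) /=.
  under [RHS]eq_bigr do rewrite scalerDl.
  rewrite big_split /=; congr (_ + _).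
    by apply: eq_bigr => U bU; congr (_ *: f _); apply/setUidPr; rewrite sub1set.
  rewrite (reindex_onto (fun U : {set 'I_n} => U :\ b) (fun U => b |: U)) /=; last first.
    by move=> U bU; rewrite setU1K.
  apply: eq_big => [U|U /andP[_ /eqP bU]].
    rewrite !inE eqxx /=; apply/eqP/idP => [<-|bU]; first by rewrite setU11.
    by rewrite setD1K.
  have UbU : b \in U by rewrite -bU setU11.
  by rewrite setD1K // (cardsD1 b U) UbU.
under eq_bigr do rewrite one.
rewrite (exchange_big_dep predT) //=; apply: eq_bigr => U _.
by rewrite sumr_const -scaler_nat scalerA.
Qed.

Lemma sum_subsets_rec f a c :
  \sum_(U : {set 'I_n}) a #|U| *: (c *: f U - \sum_b f (b |: U)) =
  \sum_(U : {set 'I_n}) (a #|U| * c - #|U|%:R * (a #|U| + a #|U|.-1)) *: f U.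
Proof.
under eq_bigr do rewrite scalerBr scalerA scaler_sumr.
by rewrite sumrB sum_subsets_add -sumrB; apply: eq_bigr => U _; rewrite scalerBl.
Qed.
End SubsetRecursion.

Section TraceSum.
Variables (F : fieldType) (V : lmodType F) (n m : nat) (p : F).
Implicit Types (f : 'S_n -> {set 'I_n} -> V).
Local Notation active := (active n m).

(** The exponent counts the cycles of s on active j without lower symbols. *)
Definition trace_weight (j : nat) (s : 'S_(n + m)) : F :=
  (-1) ^+ s * p ^+ (#|porbits s| - (#|porbits (cut_perm s)| + (m - j))).

Definition trace_sum j f : V :=
  \sum_(s | perm_on (active j) s) trace_weight j s *: f (cut_perm s) (entrances s).

Lemma trace_sum0 f : trace_sum 0 f = \sum_(t : 'S_n) (-1) ^+ t *: f t set0.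
Proof.
have inj := @lshift_inj n m.
rewrite /trace_sum active0 -(sum_perm_push inj (fun s => trace_weight 0 s *: f (cut_perm s) (entrances s))).
apply: eq_bigr => t _; rewrite cut_perm_push entrances_push /trace_weight cut_perm_push.
have := card_porbits_push t inj; rewrite subn0 => e.
have -> : (#|porbits (perm_push (@lshift n m) t)| - (#|porbits t| + m) = 0)%N by lia.
by rewrite mulr1 odd_perm_push.
Qed.

(** The new symbol x is fixed, or inserted before a lower symbol b, or before one of
    the j other auxiliary symbols.  The first creates a cycle; the others change
    the sign, and the second adds b to the entrances. *)
Lemma trace_sumS j f : (j < m)%N ->
  trace_sum j.+1 f =
  trace_sum j (fun t U => (p - j%:R) *: f t U - \sum_b f t (b |: U)).
Proof.
move=> jm; have xP : (n + j < n + m)%N by rewrite ltn_add2l.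
pose x := Ordinal xP; have xj : x = (n + j)%N :> nat by [].
have nx : (n <= x)%N by rewrite leq_addr.
rewrite /trace_sum (sum_perm_insert xj); apply: eq_bigr => s on.
have sx : s x = x by apply: (out_perm on); exact: active_x.
rewrite (activeS xj) big_setU1 ?active_x //= tperm1 mul1g.
(* y = x: the fixed symbol x is a new cycle without lower symbols *)
have wx : trace_weight j.+1 s = trace_weight j s * p.
  rewrite /trace_weight -mulrA -exprSr; congr (_ * p ^+ _).
  by have := leq_porbits_cut (ltnW jm) on; lia.
have wy y : y != x -> trace_weight j.+1 (tperm y x * s)%g = - trace_weight j s.
  move=> yx; rewrite /trace_weight cut_perm_insert // odd_permM odd_tperm yx signr_addb.
  rewrite -[(-1) ^+ true]/(-1) mulN1r mulNr; congr (- (_ * p ^+ _)).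
  have := card_porbits_insert sx yx; move: #|_| #|_| #|_| => a b c; lia.
have -> : \sum_(y in active j) trace_weight j.+1 (tperm y x * s)%g *:
      f (cut_perm (tperm y x * s)) (entrances (tperm y x * s)) =
    - (trace_weight j s *: \sum_(v in active j) f (cut_perm s)
        (if keep_low v is Some b then b |: entrances s else entrances s)).
  (* indexed by the successor v = s y, which determines the new entrance *)
rewrite [in RHS](reindex_inj (@perm_inj _ s)) /= scaler_sumr -sumrN.
  apply: eq_big => [y|y yj]; first by rewrite (perm_closed _ on).
  have yx : y != x by apply: contraTneq yj => ->; exact: active_x.
  by rewrite wy // cut_perm_insert // entrances_insert // scaleNr.
rewrite wx -scalerA -scalerBr; congr (_ *: _).
rewrite scalerBl -addrA -opprD; congr (_ - _).
rewrite big_mkcond big_split_ord /= addrC; congr (_ + _); last first.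
  by apply: eq_bigr => b _; rewrite inE /= ltn_addr // keep_low_lshift.
transitivity (\sum_(i < m | (i < j)%N) f (cut_perm s) (entrances s)).
  rewrite [RHS]big_mkcond; apply: eq_bigr => i _; rewrite inE /= ltn_add2l.
  have /eqP-> : keep_low (rshift n i) == None by rewrite keep_low_None leq_addr.
  by [].
by rewrite -(big_ord_widen m (fun=> _) (ltnW jm)) sumr_const card_ord scaler_nat.
Qed.

(** Induction on j with f varying: the recursion transposes to the one of
    trace_coef. *)
Theorem trace_sumE j f : (j <= m)%N ->
  trace_sum j f = \sum_(t : 'S_n) \sum_(U : {set 'I_n})
    ((-1) ^+ t * ((-1) ^+ #|U| * trace_coef p j #|U|)) *: f t U.
Proof.
elim: j f => [|j IHj] f jm.
  rewrite trace_sum0; apply: eq_bigr => t _.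
  rewrite (bigD1 set0) //= big1 => [|U U0].
    by rewrite cards0 addr0 /trace_coef ffactn0 big_geq // !mulr1.
  by rewrite /trace_coef ffact_small ?mul0r ?mulr0 ?scale0r // card_gt0.
rewrite trace_sumS // IHj 1?ltnW //; apply: eq_bigr => t _.
under eq_bigr do rewrite -scalerA.
under [RHS]eq_bigr do rewrite -scalerA.
rewrite -!scaler_sumr; congr (_ *: _).
rewrite (sum_subsets_rec (f t) (fun k => (-1) ^+ k * trace_coef p j k)).
apply: eq_bigr => U _; congr (_ *: _); rewrite trace_coef_rec.
move: #|U| => [|k] /=; first by ring.
by rewrite [(-1) ^+ k.+1]exprS; move: ((-1) ^+ k) => e; ring.
Qed.
End TraceSum.

(** * The T_m in terms of the S_k *)

Lemma ptrace_sum (F : fieldType) n m (p : F) (c : 'S_(n + m) -> F) :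
  ptrace p (\sum_s c s *: permb F s) =
  \sum_s (c s * p ^+ (#|porbits s| - #|porbits (cut_perm s)|)) *: permb F (cut_perm s).
Proof.
apply: eq_bigr => s _; congr ((_ * _) *: _).
rewrite sum_ffunE (bigD1 s) //= big1 => [|t /negPf ts].
  by rewrite !ffunE eqxx addr0 /GRing.scale /= mulr1.
by rewrite !ffunE eq_sym ts /GRing.scale /= mulr0.
Qed.

Lemma ptraceZ (F : fieldType) n m (p c : F) (f : perma F (n + m)) :
  ptrace p (c *: f) = c *: ptrace p f.
Proof.
rewrite /ptrace scaler_sumr; apply: eq_bigr => s _; rewrite scalerA mulrA ffunE.
by [].
Qed.

Lemma coef_sign (R : nzRingType) (b : bool) (q : {poly R}) i :
  ((-1) ^+ b * q)`_i = (-1) ^+ b * q`_i.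
Proof. by rewrite !mulr_sign; case: b; rewrite ?coefN. Qed.

Section TpolyS.
Variables (F : fieldType) (n : nat) (hbar : F) (z : 'I_n -> F).
Hypothesis charF : [pchar F] =i pred0.
Local Notation swt := (subset_wt hbar%:P (fun a => (z a)%:P) 'X).

Lemma TpolyE p m : (0 < m)%N -> Tpoly hbar z p m =
  map_poly (ptrace p) ((perma_push (@rshift n m) (antisym F m))%:P *
     \prod_(a <- rev (enum 'I_n))
        ('X - ((z a)%:A)%:P +
         (hbar *: \sum_(i < m) permb F (tperm (lshift m a) (rshift n i)))%:P)).
Proof. by case: m. Qed.

Section Aux.
Variable m : nat.
Local Notation B := (perma F (n + m)).
Local Notation iota := (map_poly (in_alg B)).
Let rho (s : 'S_(n + m)) : {poly B} := (permb F s)%:P.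
Let site (v : 'I_(n + m)) : {poly F} :=
  if keep_low v is Some a then 'X - (z a)%:P else 0.
Let before (b d : 'I_(n + m)) := (n <= d)%N || (d < b)%N.
Let R := [set v in codom (@rshift n m)].

Let R_E v : (v \in R) = (n <= v)%N.
Proof.
rewrite inE; apply/codomP/idP => [[i ->]|]; first exact: leq_addr.
rewrite -keep_low_None; case: (splitP v) => [i e|i e].
  by have -> : v = lshift m i by [exact: val_inj]; rewrite keep_low_lshift.
by move=> _; exists i; apply: val_inj.
Qed.

Let s : seq 'I_(n + m) := map (lshift m) (rev (enum 'I_n)).

(** For a lower symbol b outside the entrances of t the predecessor of b is lower,
    hence also its predecessor in the trace of t. *)
Let wtE (t : 'S_(n + m)) : partial_wt hbar%:P site before R s t =
  (- hbar%:P) ^+ #|entrances t| * swt (cut_perm t) (entrances t).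
Proof.
have sE v : (v \in s) = (v < n)%N.
  apply/mapP/idP => [[i _ ->]|vn]; first by rewrite /= ltn_ord.
  by exists (Ordinal vn); [rewrite mem_rev mem_enum | apply: val_inj].
rewrite /partial_wt; have -> : perm_on (R :|: [set b in s]) t.
  apply/subsetP => v _; rewrite inE R_E inE sE; by case: ltnP.
rewrite mul1r big_map (perm_big (enum 'I_n)) ?perm_rev //= big_enum /=.
rewrite (bigID (mem (entrances t))) /=; congr (_ * _).
  rewrite -prodr_const; apply: eq_bigr => b; rewrite inE => bt.
  rewrite /entry_wt /before; case: (_ =P lshift m b) bt => [->|_]; first by rewrite keep_low_lshift.
  by rewrite keep_low_None => ->.
rewrite (eq_bigl (mem (~: entrances t))) => [|b]; last by rewrite !inE.
apply: eq_bigr => b; rewrite /= in_setC => bt; rewrite (cut_permV_notin bt) /entry_wt /gwt.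
rewrite (inj_eq (@lshift_inj n m)) /before /site keep_low_lshift /=.
by rewrite leqNgt ltn_ord.
Qed.

(** The insertion formula with all auxiliary symbols admissible before every
    lower symbol. *)
Let insertion_prod :
  (m`!%:R *: perma_push (@rshift n m) (antisym F m))%:P *
    \prod_(a <- rev (enum 'I_n))
      ('X - ((z a)%:A)%:P + (hbar *: \sum_(i < m) permb F (tperm (lshift m a) (rshift n i)))%:P) =
  \sum_(t : 'S_(n + m)) iota ((-1) ^+ t *
    ((- hbar%:P) ^+ #|entrances t| * swt (cut_perm t) (entrances t))) * rho t.
Proof.
rewrite -(partial_sum_nil charF (@rshift_inj n m) hbar%:P site before).
have factorE a : 'X - ((z a)%:A)%:P +
    (hbar *: \sum_(i < m) permb F (tperm (lshift m a) (rshift n i)))%:P =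
    iota (site (lshift m a)) + iota hbar%:P *
      \sum_(j in R | before (lshift m a) j) rho (tperm j (lshift m a)).
  congr (_ + _).
    by rewrite /site keep_low_lshift rmorphB /= map_polyX map_polyC.
  have -> v : (hbar *: v)%:P = iota hbar%:P * v%:P.
    by rewrite map_polyC /= -polyCM mulr_algl.
  congr (_ * _); rewrite rmorph_sum /=.
  rewrite (eq_bigl (mem R)) => [|v]; last by rewrite /= R_E /before; case: (n <= v)%N.
  have RE : R = @rshift n m @: setT.
    by apply/setP => v; rewrite inE; apply/codomP/imsetP => [[i ->]|[i _ ->]]; exists i.
  rewrite RE big_imset /=; last by move=> i j _ _; exact: rshift_inj.
  by apply: eq_big => [i|i _]; rewrite ?inE // tpermC.
under eq_bigr do rewrite factorE.
rewrite -(big_map (lshift m) predT (fun v => iota (site v) + iota hbar%:P *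
      \sum_(j in R | before v j) rho (tperm j v))) /= -/s.
rewrite (insertion (@perma_polyC_central F (n + m)) (@permb_polyCM F (n + m))).
- by apply: eq_bigr => t _; rewrite wtE.
- rewrite /s pairwise_map; apply: (sub_pairwise (r := fun b a : 'I_n => (a < b)%N)).
    move=> b a ab; rewrite /insertion_rel /before /= ab orbT negb_or -ltnNge ltn_ord.
    rewrite -leqNgt ltnW //=; apply/forallP => v; apply/implyP; rewrite R_E => ->.
    by rewrite orTb implybT.
  rewrite -sorted_pairwise => [|a b c ab bc]; last exact: ltn_trans bc ab.
  by rewrite rev_sorted; exact: sorted_enum_ordset.
- by rewrite map_inj_uniq ?rev_uniq ?enum_uniq //; exact: lshift_inj.
by apply/allP => v /mapP[a _ ->]; rewrite R_E -ltnNge /= ltn_ord.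
Qed.

Lemma coef_Tpoly_sum p i : (0 < m)%N ->
  m`!%:R *: (Tpoly hbar z p m)`_i = \sum_(t : 'S_n) \sum_(U : {set 'I_n})
    ((-1) ^+ t * (trace_coef p m #|U| * (hbar ^+ #|U| * (swt t U)`_i))) *: permb F t.
Proof.
move=> m0; have ptrace0 : ptrace (n := n) (m := m) p 0 = 0 :> perma F n.
  by rewrite -[X in ptrace _ X](scale0r (0 : B)) ptraceZ scale0r.
rewrite TpolyE // coef_map_id0 // -ptraceZ -[m`!%:R *: _]mulr_algl -coefCM.
rewrite mulrA -polyCM mulr_algl insertion_prod coef_sum.
rewrite (eq_bigr (fun t : 'S_(n + m) => ((-1) ^+ t * ((- hbar) ^+ #|entrances t| *
    (swt (cut_perm t) (entrances t))`_i)) *: permb F t)) => [|t _]; last first.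
  rewrite coefMC coef_map /= mulr_algl coef_sign -polyCN -rmorphXn /= coefCM.
  by [].
rewrite ptrace_sum.
transitivity (trace_sum m p m (fun t U => ((- hbar) ^+ #|U| * (swt t U)`_i) *: permb F t)
    : perma F n).
  rewrite /trace_sum active_full; apply: eq_big => [t|t _].
    by apply/esym/subsetP => v _; rewrite inE.
  rewrite scalerA /trace_weight subnn addn0; congr (_ *: _).
  by rewrite -!mulrA; congr (_ * _); rewrite mulrA mulrC.
rewrite trace_sumE //; apply: eq_bigr => t _; apply: eq_bigr => U _.
rewrite scalerA -!mulrA; congr ((_ * _) *: _).
have -> : hbar ^+ #|U| = (-1) ^+ #|U| * (- hbar) ^+ #|U|.
  by rewrite -exprMn mulN1r opprK.
by move: ((-1) ^+ #|U|) ((- hbar) ^+ #|U|) => e1 e2; ring.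
Qed.
End Aux.

Lemma coef_Spoly k i : (Spoly hbar z k)`_i =
  \sum_(t : 'S_n) ((-1) ^+ t *
    (hbar ^+ k * \sum_(U : {set 'I_n} | #|U| == k) (swt t U)`_i)) *: permb F t.
Proof.
rewrite Spoly_Sgen // coef_sum; apply: eq_bigr => t _.
rewrite coefMC coef_map /= mulr_algl coef_sign -rmorphXn /= coefCM coef_sum.
by [].
Qed.

Theorem coef_Tpoly p m i : m`!%:R *: (Tpoly hbar z p m)`_i =
  \sum_(k < m.+1) trace_coef p m k *: (Spoly hbar z k)`_i.
Proof.
have [->|m0] := posnP m.
  by rewrite big_ord1 fact0 /trace_coef big_geq // mulr1.
rewrite coef_Tpoly_sum // (eq_bigr _ (fun (k : 'I_m.+1) _ => congr1 _ (coef_Spoly k i))).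
under [RHS]eq_bigr do rewrite scaler_sumr.
rewrite [RHS]exchange_big /=; apply: eq_bigr => t _.
under [RHS]eq_bigr do rewrite scalerA.
rewrite -!scaler_suml; congr (_ *: _).
under [RHS]eq_bigr do rewrite mulrCA.
rewrite -!mulr_sumr; congr (_ * _).
under [RHS]eq_bigr do rewrite mulrA mulr_sumr.
rewrite [RHS](exchange_big_dep predT) //=; apply: eq_bigr => U _.
have [Um|mU] := leqP #|U| m.
  rewrite (bigD1 (inord #|U|)) /=; last by rewrite inordK.
  rewrite inordK // big1 ?addr0 ?mulrA //.
  by move=> k /andP[/eqP -> ]; rewrite inord_val eqxx.
rewrite /trace_coef ffact_small // !mul0r big_pred0 // => k.
by apply: contraTF mU => /eqP ->; rewrite -leqNgt -ltnS ltn_ord.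
Qed.
End TpolyS.

(** * The spectral curve of the S_k *)

Section SpolyCurve.
Variables (F : fieldType) (n : nat) (hbar : F) (z : 'I_n.+1 -> F).
Local Notation N := n.+1.
Local Notation A := (perma F N).
Hypothesis charF : [pchar F] =i pred0.
Hypothesis hbar_neq0 : hbar != 0.
Hypothesis z_h : forall a b, z a - z b != hbar.

Let rho (s : 'S_N) : A := permb F s.
Let iotaC c (x : A) : in_alg A c * x = x * in_alg A c.
Proof. by rewrite /= mulr_algl mulr_algr. Qed.
Let rhoM s t : rho s * rho t = rho (t * s)%g. Proof. exact: permaM. Qed.
Let rho1 : rho 1%g = 1. Proof. by []. Qed.

Let SE k := Spoly_Sgen hbar z charF k.

Lemma Spoly_comm i j : (Spoly hbar z 1)`_i * (Spoly hbar z 1)`_j =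
  (Spoly hbar z 1)`_j * (Spoly hbar z 1)`_i.
Proof. by rewrite SE; exact: (Spol1_comm iotaC rhoM rho1 z charF hbar_neq0). Qed.

Let S0 : Spoly hbar z 0 = map_poly (in_alg A) (\prod_(a < N) ('X - (z a)%:P)).
Proof. by rewrite SE Sgen0. Qed.

Let S_top : Spoly hbar z N.+1 = 0.
Proof. by rewrite SE Sgen0_gt. Qed.

Let size_S k : (size (Spoly hbar z k) <= (N - k).+1)%N.
Proof. by rewrite SE; exact: size_Sgen. Qed.

Let S1_lead : (Spoly hbar z 1)`_n = in_alg A (hbar * N%:R).
Proof. by rewrite SE; exact: (coef_Sgen1 _ rho1). Qed.

Let S_fusion k : (k <= N)%N -> exists q,
  map_poly (in_alg A) (\prod_(a < N) ('X - hbar%:P - (z a)%:P)) *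
    (Spoly hbar z k.+1 - Spoly hbar z k)
  - Spoly hbar z 1 * shiftp (in_alg A) hbar (Spoly hbar z k) =
  q * map_poly (in_alg A) (\prod_(a < N) ('X - (z a)%:P)).
Proof.
move=> kN; have [q e] := Spol_fusion iotaC rhoM rho1 z charF hbar_neq0 kN.
by exists q; rewrite !SE -(Sgen_shift _ iotaC) e.
Qed.

Let y (j : 'I_N) := (Spoly hbar z 1)`_j.

Let W_unit : shiftprod z hbar N \in unitmx.
Proof.
rewrite unitmxE unitfE det_shiftprod; apply/prodf_neq0 => i _.
by apply/prodf_neq0 => j _; rewrite opprD addrA addrAC subr_eq0 z_h.
Qed.

Definition spectral_eval : {rmorphism {mpoly F[N]} -> A} :=
  @commuting_rmorphism _ _ _ (in_alg A) y iotaC (fun i j => Spoly_comm i j).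

Let spectral_evalC c : spectral_eval c%:MP = in_alg A c.
Proof. exact: commuting_evalC. Qed.

Let spectral_evalX i : spectral_eval 'X_i = (Spoly hbar z 1)`_i.
Proof. exact: commuting_evalX. Qed.

Theorem Suv_spectral :
  Suv hbar z = map_poly (map_poly spectral_eval) (spectral_poly hbar z).
Proof.
exact: (spectral_curve iotaC charF hbar_neq0 W_unit S0 S_top size_S S1_lead S_fusion
  spectral_evalC spectral_evalX).
Qed.

Theorem Suv_Pcurve : Suv hbar z = Pcurve hbar z (Spoly hbar z 1).
Proof. by rewrite Suv_spectral (Pcurve_spectral z_h). Qed.

End SpolyCurve.

(** * Generating functions and generated subalgebras *)

Lemma prod_natr_sub (R : nzRingType) n k m : (k <= m)%N -> (m <= n)%N ->
  \prod_(k <= i < m) (n%:R - i%:R) = ((n - k) ^_ (m - k))%:R :> R.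
Proof.
move=> km mn; rewrite -{1}(subnKC km); elim: (m - k)%N (leq_sub2r k mn) => [|j IHj] jn.
  by rewrite addn0 big_geq.
rewrite addnS big_nat_recr ?leq_addr //= IHj 1?ltnW // ffactnSr natrM -natrB.
  by rewrite subnDA.
by rewrite -(subnKC (leq_trans km mn)) leq_add2l ltnW.
Qed.

Lemma trace_coef_nat (R : comNzRingType) n m k : (k <= m)%N -> (m <= n)%N ->
  trace_coef n%:R m k = (m`! * 'C(n - k, m - k))%:R :> R.
Proof.
move=> km mn; rewrite /trace_coef prod_natr_sub // -natrM; congr _%:R.
have := ffact_fact km; have := bin_ffact (n - k) (m - k) => <- <-.
by rewrite [('C(_, _) * _)%N]mulnC mulnA.
Qed.

Section Generating.
Variables (F : fieldType) (n : nat) (hbar : F) (z : 'I_n -> F).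
Hypothesis charF : [pchar F] =i pred0.
Local Notation A := (perma F n).
Local Notation S := (Spoly hbar z).

Lemma fact_neq0 m : (m`!%:R : F) != 0.
Proof. by have/charf0P -> := charF; rewrite -lt0n fact_gt0. Qed.

Lemma Tpoly_binomial m : (m <= n)%N ->
  Tpoly hbar z n%:R m = \sum_(k < m.+1) S k *+ 'C(n - k, m - k).
Proof.
move=> mn; apply/polyP => i; apply: (scalerI (fact_neq0 m)).
rewrite coef_Tpoly // coef_sum scaler_sumr; apply: eq_bigr => k _.
have km : (k <= m)%N by rewrite -ltnS.
by rewrite trace_coef_nat // natrM coefMn -scalerA; congr (_ *: _); exact: scaler_nat.
Qed.

Lemma sum_bin_expr (R : nzRingType) (a : {poly R}) k : (k <= n)%N ->
  \sum_(m < n.+1 | (k <= m)%N) (-1) ^+ m * ((a *+ 'C(n - k, m - k))%:P * 'X^(n - m)) =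
  (-1) ^+ k * (a%:P * ('X - 1) ^+ (n - k)) :> {poly {poly R}}.
Proof.
move=> kn; rewrite exprBn_comm; last exact: commr1.
rewrite !mulr_sumr -(big_geq_mkord k n.+1 predT (fun m : nat => (-1) ^+ m *
  ((a *+ 'C(n - k, m - k))%:P * 'X^(n - m)))) -{1}[k]add0n big_addn subSn // big_mkord.
apply: eq_bigr => j _; rewrite addnK addnC subnDA exprD expr1n mulr1 polyCMn.
rewrite mulrnAl !mulrnAr -mulrA; congr (_ * _ *+ _).
by rewrite !mulrA commr_sign.
Qed.

(** The binomial coefficients in T_m(n) are those of the powers of v - 1. *)
Theorem Tuv_Suv : Tuv hbar z = Suv hbar z.
Proof.
rewrite /Tuv /Suv.
transitivity (\sum_(m < n.+1) \sum_(k < n.+1 | (k <= m)%N)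
   (-1) ^+ m * ((S k *+ 'C(n - k, m - k))%:P * 'X^(n - m)) : {poly {poly A}}).
  apply: eq_bigr => m _; rewrite Tpoly_binomial -1?ltnS //.
  rewrite (@big_ord_widen _ _ _ m.+1 n.+1 (fun k => S k *+ 'C(n - k, m - k))) //.
  by rewrite (rmorph_sum polyC) mulr_suml mulr_sumr.
rewrite (exchange_big_dep predT) //=; apply: eq_bigr => k _.
by rewrite sum_bin_expr // -ltnS.
Qed.

Lemma Spoly0 : S 0 = map_poly (in_alg A) (\prod_(a < n) ('X - (z a)%:P)).
Proof. by rewrite Spoly_Sgen // Sgen0. Qed.

Lemma size_Spoly k : (size (S k) <= (n - k).+1)%N.
Proof. by rewrite Spoly_Sgen //; exact: size_Sgen. Qed.

Lemma Spoly_gt k : (n < k)%N -> S k = 0.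
Proof. by move=> nk; rewrite Spoly_Sgen // Sgen0_gt. Qed.

(** The triangular system of coef_Tpoly at p = n has diagonal entries k!. *)
Lemma Spoly_in_algebra (X : {aspace A}) : 1 \in X ->
    (forall m i, (m <= n)%N -> (Tpoly hbar z n%:R m)`_i \in X) ->
  forall k i, (S k)`_i \in X.
Proof.
move=> X1 TX k i; have [nk|kn] := ltnP n k; first by rewrite Spoly_gt // coef0 mem0v.
elim/ltn_ind: k kn => k IHk kn.
have := coef_Tpoly hbar z charF n%:R k i; rewrite big_ord_recr /= => e.
have tk : trace_coef n%:R k k = k`!%:R :> F by rewrite trace_coef_nat // subnn bin0 muln1.
have {}e : k`!%:R *: (S k)`_i =
   k`!%:R *: (Tpoly hbar z n%:R k)`_i - \sum_(j < k) trace_coef n%:R k j *: (S j)`_i.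
  by rewrite e tk addrAC subrr add0r.
rewrite -(scalerK (fact_neq0 k) (S k)`_i) e memvZ // memvB ?memvZ ?TX //.
apply: memv_suml => j _; rewrite memvZ // IHk //.
exact: leq_trans (ltnW (ltn_ord j)) kn.
Qed.

Lemma Tpoly_in_algebra p (X : {aspace A}) : (forall k i, (S k)`_i \in X) ->
  forall m i, (Tpoly hbar z p m)`_i \in X.
Proof.
move=> SX m i; have e := coef_Tpoly hbar z charF p m i.
by rewrite -(scalerK (fact_neq0 m) (Tpoly _ _ _ _)`_i) e memvZ // memv_suml // => k _; rewrite memvZ.
Qed.
End Generating.

Lemma sub_generated (K : fieldType) (B : falgType K) (Y : {aspace B}) (L : seq B) :
  1 \in Y -> {subset L <= Y} -> (<<1 & L>> <= Y)%VS.
Proof.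
move=> Y1 LY; have UY : (1 + <<L>> <= Y)%VS.
  by rewrite subv_add -memvE Y1 /=; apply/span_subvP.
by apply: agenv_sub_modr; rewrite -?memvE // (subv_trans (prodvSr Y UY)) // asubv.
Qed.

Lemma mem1_generated (K : fieldType) (B : falgType K) (L : seq B) : 1 \in <<1 & L>>%AS.
Proof. by rewrite memvE; exact: sub1_agenv. Qed.

Lemma mem_generated (K : fieldType) (B : falgType K) (L : seq B) v :
  v \in L -> v \in <<1 & L>>%AS.
Proof. by move=> vL; exact: seqv_sub_adjoin. Qed.

Lemma commuting_eval_mem (F : fieldType) (B : falgType F) n (y : 'I_n -> B)
    (X : {aspace B}) (q : {mpoly F[n]}) :
  1 \in X -> (forall i, y i \in X) -> commuting_eval (in_alg B) y q \in X.
Proof.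
move=> X1 yX; apply: memv_suml => m _; apply: memvM; first by rewrite /= memvZ.
rewrite /mmap1; elim/big_ind: _ => // [u v uX vX|i _]; first exact: memvM.
by elim: (m i) => [|d IHd]; rewrite ?expr0 // exprS memvM.
Qed.

(** * Generation by the coefficients of S_1 *)

Lemma coef_Tuv (F : fieldType) n (hbar : F) (z : 'I_n -> F) m : (m <= n)%N ->
  (Tuv hbar z)`_(n - m) = (-1) ^+ m * Tpoly hbar z n%:R m.
Proof.
move=> mn; rewrite /Tuv coef_sum (bigD1 (Ordinal (mn : (m < n.+1)%N))) //= big1 => [|k km].
  by rewrite -(rmorph_sign polyC) coefCM coefCM coefXn eqxx mulr1 addr0.
rewrite -(rmorph_sign polyC) coefCM coefCM coefXn.
case: eqP => [e|]; last by rewrite !mulr0.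
case/eqP: km; apply: val_inj => /=; move: (ltn_ord k); lia.
Qed.

Section Main.
Variables (F : fieldType) (n : nat) (hbar : F) (z : 'I_n.+1 -> F).
Local Notation N := n.+1.
Local Notation A := (perma F N).
Hypothesis charF : [pchar F] =i pred0.
Hypothesis hbar_neq0 : hbar != 0.
Hypothesis z_h : forall a b, z a - z b != hbar.
Local Notation X := (<<1 & [seq S1coef hbar z i | i <- iota 1 n]>>%AS : {aspace A}).

Lemma Spoly1_mem i : (Spoly hbar z 1)`_i \in X.
Proof.
case: (ltngtP i n) => [lt_in|lt_ni|->].
- have -> : (Spoly hbar z 1)`_i = hbar ^+ (n - i).+1 *: S1coef hbar z (n - i).
    rewrite /S1coef scalerA mulfV ?expf_neq0 // scale1r.
    by congr (_`_ _); lia.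
  rewrite memvZ //; apply/mem_generated/map_f; rewrite mem_iota; lia.
- rewrite nth_default ?mem0v //; apply: leq_trans (size_Spoly _ _ charF 1) _.
  by rewrite subn1.
rewrite Spoly_Sgen // (coef_Sgen1 (in_alg A) (rho := fun s => permb F s)) //=.
by rewrite memvZ ?mem1_generated.
Qed.

(** Up to sign T_m(n) is a coefficient of the spectral curve, evaluated at the
    coefficients of S_1. *)
Lemma Tpoly_binomial_mem m i : (m <= N)%N -> (Tpoly hbar z N%:R m)`_i \in X.
Proof.
move=> mN; have -> : Tpoly hbar z N%:R m = (-1) ^+ m * (Tuv hbar z)`_(N - m).
  by rewrite coef_Tuv // mulrA -expr2 sqrr_sign mul1r.
have cX j l : (Tuv hbar z)`_j`_l \in X.
  rewrite Tuv_Suv // (Suv_spectral charF hbar_neq0 z_h) coef_map /= coef_map /=.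
  by apply: commuting_eval_mem; [exact: mem1_generated | move=> a; exact: Spoly1_mem].
by rewrite -signr_odd coef_sign mulr_sign; case: ifP => _; rewrite ?memvN cX.
Qed.

(** Conversely, S_1 = T_1(p) - p S_0, and S_0 has scalar coefficients. *)
Theorem bethe_generated p : bethe hbar z p = X.
Proof.
have X1 : 1 \in X by exact: mem1_generated.
have SX := Spoly_in_algebra charF X1 Tpoly_binomial_mem.
have TX := Tpoly_in_algebra charF p SX.
apply: val_inj; apply/eqP; rewrite eqEsubv; apply/andP; split.
  by apply: sub_generated => // v /allpairsP[[m i] [_ _ ->]]; exact: TX.
have Y1 : 1 \in bethe hbar z p by exact: mem1_generated.
apply: sub_generated => // v vS.
have [j] := mapP vS; rewrite mem_iota => j_n ->.
rewrite memvZ //.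
have -> : (Spoly hbar z 1)`_(N - j.+1) =
    Tcoef hbar z p 1 j.+1 - trace_coef p 1 0 *: (Spoly hbar z 0)`_(N - j.+1).
  have := coef_Tpoly hbar z charF p 1 (N - j.+1).
  rewrite big_ord_recl big_ord1 scale1r /Tcoef => ->; rewrite addrAC subrr add0r.
  by rewrite {1}/trace_coef big_geq // mulr1 scale1r.
rewrite memvB //; last by rewrite memvZ // Spoly0 // coef_map /= memvZ.
apply/mem_generated/allpairsP; exists (1%N, j.+1); split=> //=; rewrite ?in_cons mem_iota; lia.
Qed.
End Main.

Lemma Pcurve0 (F : fieldType) (hbar : F) (z : 'I_0 -> F) q : Pcurve hbar z q = 1.
Proof.
have e1 : ratfun_eval z 1 = 1.
  apply: ratfun_evalE; exists 1, 1.
  by split; rewrite ?rmorph1 ?divr1 ?oner_neq0.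
have m0 : mmap (fun c => (ratfun_eval z c)%:A) (fun j : 'I_0 => q`_j) 0 = 0 :> perma F 0.
  by rewrite /mmap msupp0 big_nil.
rewrite /Pcurve /generic_Pdet /Pdet det_mx00.
apply/polyP => i; rewrite coef_map_id0; last by rewrite /map_poly size_poly0 poly_def big_ord0.
rewrite !coef1; case: eqP => _; last by rewrite /map_poly size_poly0 poly_def big_ord0.
apply/polyP => j; rewrite coef_map_id0 // !coef1; case: eqP => _; last exact: m0.
rewrite /mmap msupp1 big_seq1 mcoeff1 eqxx e1 scale1r mul1r.
by rewrite /mmap1 big_ord0.
Qed.

Theorem theorem7p7 (R : realType) (n : nat) (hbar : R[i]) (z : 'I_n -> R[i]) :
  hbar != 0 ->
  (forall a b : 'I_n, z a - z b != hbar) ->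
  (forall p : R[i],
     bethe hbar z p = <<1 & [seq S1coef hbar z i | i <- iota 1 n.-1]>>%AS) /\
  Tuv hbar z = Suv hbar z /\
  Tuv hbar z = Pcurve hbar z (Spoly hbar z 1).
Proof.
move=> h0 z_h; have charF : [pchar R[i]] =i pred0 by exact: Num.Theory.pchar_num.
have TS := Tuv_Suv hbar z charF.
case: n z z_h TS => [|n] z z_h TS.
  split=> [p|]; first by [].
  split=> //; rewrite TS Pcurve0 /Suv big_ord1 /= big_ord0.
  by rewrite mul1r expr0 mulr1.
split; first by move=> p; exact: bethe_generated.
by split=> //; rewrite TS; exact: Suv_Pcurve.
Qed.
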